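(* Let $f\in L^2(\mathbb T^d)$. There exists a weak solution $u\in H_{1,W}(\mathbb T^d)$ of the equation $$\nabla A\nabla_Wu=f$$ if and only if $\int_{\mathbb T^d}f\,dx=0$. In this case the weak solution is unique if we disregard addition by constant functions. Also, let $u$ be the unique weak solution in $H^\bot_{1,W}(\mathbb T^d)$. Then $$\|u\|_{1,W}\le C\|f\|_{L^2(\mathbb T^d)}$$ for some constant $C$ independent of $f$.
   Context: $\mathbb T=\mathbb R/\mathbb Z=[0,1)$ and $\mathbb T^d=[0,1)^d$. $W(x)=\sum_{k=1}^dW_k(x_k)$, where each $W_k:\mathbb R\to\mathbb R$ is strictly increasing, right continuous with left limits, and satisfies $W_k(u+1)-W_k(u)=W_k(1)-W_k(0)$ for all $u$. $dW_k$ is the measure induced by $W_k$ on $\mathbb T$. The generalized derivative is $\partial_{W_k}f(x)=\lim_{\epsilon\to0}\frac{f(x+\epsilon e_k)-f(x)}{W_k(x_k+\epsilon)-W_k(x_k)}$ when the limit exists and is finite. One-dimensional operator: $\mathcal D_{W_k}$ is the set of $f\in L^2(\mathbb T)$ of the form $f(x)=a+bW_k(x)+\int_{(0,x]}W_k(dy)\int_0^y\mathfrak f(z)\,dz$ with $\mathfrak f\in L^2(\mathbb T)$, $\int_0^1\mathfrak f(z)\,dz=0$ and $\int_{(0,1]}W_k(dy)\{b+\int_0^y\mathfrak f(z)\,dz\}=0$; on $\mathcal D_{W_k}$, $\mathcal L_{W_k}f=\partial_{x_k}\partial_{W_k}f$ (with $\partial_{W_k}f(x)=b+\int_0^x\mathfrak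 f(z)\,dz$ and $\mathcal L_{W_k}f=\mathfrak f$). $\mathcal A_{W_k}$ is a countable complete orthonormal system of $L^2(\mathbb T)$ consisting of eigenvectors of $\mathcal L_{W_k}$. $\mathcal A_W=\{f:\ f(x)=\prod_{k=1}^df_k(x_k),\ f_k\in\mathcal A_{W_k}\}$ and $\mathbb D_W=\mathrm{span}(\mathcal A_W)$. For $f\in\mathbb D_W$, $\partial_{W_i}f$ and $\partial_{x_i}\partial_{W_i}f$ act on the $i$th coordinate with the others fixed. $d(x^i\otimes W_i)=dx_1\cdots dx_{i-1}\,dW_i\,dx_{i+1}\cdots dx_d$ on $\mathbb T^d$; $L^2_{x^i\otimes W_i}(\mathbb T^d)$ is the corresponding $L^2$ space, and $L^2_{x^i\otimes W_i,0}(\mathbb T^d)$ is its closed subspace of functions $f$ with zero mean, $\int_{\mathbb T^d}f\,d(x^i\otimes W_i)=0$. The $W$-Sobolev space $H_{1,W}(\mathbb T^d)$ is the set of $g\in L^2(\mathbb T^d)$ such that for each $i=1,\dots,d$ there is $G_i\in L^2_{x^i\otimes W_i,0}(\mathbb T^d)$ with $\int_{\mathbb T^d}(\partial_{x_i}\partial_{W_i}f)\,g\,dx=-\int_{\mathbb T^d}(\partial_{W_i}f)\,G_i\,d(x^i\otimes W_i)$ for all $f\in\mathbb D_W$; the (unique) $G_i$ is denoted $\partial_{W_i}g$. Its norm $\|\cdot\|_{1,W}$ is induced by $\langle f,g\rangle_{1,W}=\int_{\mathbb T^d}fg\,dx+\sum_{i=1}^d\int_{\mathbb T^d}(\partial_{W_i}f)(\partial_{W_i}g)\,d(x^i\otimes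 W_i)$. $H^\bot_{1,W}(\mathbb T^d)=\{f\in H_{1,W}(\mathbb T^d):\int_{\mathbb T^d}f\,dx=0\}$. $A(x)=\mathrm{diag}(a_1(x),\dots,a_d(x))$, $x\in\mathbb T^d$, is a diagonal matrix function for which there is a constant $\theta>0$ with $\theta^{-1}\le a_i(x)\le\theta$ for all $x$ and $i$. $\nabla A\nabla_Wu:=\sum_{i=1}^d\partial_{x_i}(a_i\partial_{W_i}u)$. A function $u\in H_{1,W}(\mathbb T^d)$ is a weak solution of $\nabla A\nabla_Wu=f$ (i.e. of $-\nabla A\nabla_Wu=-f$) if $\sum_{i=1}^d\int_{\mathbb T^d}a_i(\partial_{W_i}u)(\partial_{W_i}v)\,d(x^i\otimes W_i)=-\int_{\mathbb T^d}fv\,dx$ for all $v\in H_{1,W}(\mathbb T^d)$.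
   Formalization: For d ≥ 2 the zero-mean G_i is not unique (cos(2πx_2) can be added to G_1), so the norm and weak solutions are ill-defined; here ∂_{W_i}g is the G_i in the L²-closure of {∂_{W_i}f : f in D_W}, which is the same G_i for d = 1. *)

(* Defs.v *)
From HB Require Import structures.
From mathcomp Require Import all_boot all_order all_algebra.
From mathcomp Require Import all_classical all_reals all_analysis.

Set Implicit Arguments.
Unset Strict Implicit.
Unset Printing Implicit Defensive.

Import Order.TTheory GRing.Theory Num.Theory.
Import numFieldNormedType.Exports.

Local Open Scope classical_set_scope.
Local Open Scope ring_scope.

(* The torus is represented by its fundamental domain: points of T^d are points
   of R^d, and every measure below charges only [0,1)^d.  An element of an L^2
   space is represented by a function R^d -> R, up to almost everywhere
   equality. *)

Section CircleMeasure.
Context {R : realType}.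
Variable F : cumulative R R.

Lemma measurable_circle : measurable (`[0, 1[%classic : set (measurableTypeR R)).
Proof. exact: measurable_itv. Qed.

Lemma circle_lty : (lebesgue_stieltjes_measure F `[0%R, 1%R[%classic < +oo)%E.
Proof.
apply: (@le_lt_trans _ _ (lebesgue_stieltjes_measure F `](-1)%R, 1%R]%classic)).
  apply: le_measure; rewrite ?inE.
  - exact: measurable_circle.
  - exact: (@measurable_itv R).
  - move=> x /=; rewrite !in_itv/= => /andP[x0 x1]; apply/andP; split.
      by rewrite (lt_le_trans _ x0)// ltrN10.
    exact: ltW.
rewrite /lebesgue_stieltjes_measure /measure_extension.
rewrite measurable_mu_extE/=; last exact: is_ocitv.
by rewrite wlength_itv/=; case: ifP => // _; rewrite -EFinB ltry.
Qed.

(* For F with periodic increments, this is the measure induced by F on R/Z: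
   the mass of the point 0 ~ 1 is F 0 - F 0^- = F 1 - F 1^-. *)
Definition circle_measure : {finite_measure set (measurableTypeR R) -> \bar R} :=
  mfrestr measurable_circle circle_lty.

End CircleMeasure.

Section ProductMeasure.
Context {R : realType}.
Local Notation S := (measurableTypeR R).

Definition tcons n (p : S * n.-tuple S) : n.+1.-tuple S := [tuple of p.1 :: p.2].

Lemma measurable_tcons n : measurable_fun [set: S * n.-tuple S] (@tcons n).
Proof. exact: measurable_cons. Qed.

Section step.
Variables (n : nat) (mu : {finite_measure set S -> \bar R})
  (nu : {finite_measure set (n.-tuple S) -> \bar R}).

Definition product_cons : set (n.+1.-tuple S) -> \bar R :=
  pushforward (mu \x nu)%E (@tcons n).

Let product_cons0 : product_cons set0 = 0%E.
Proof. by rewrite /product_cons /pushforward preimage_set0 measure0. Qed.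

Let product_cons_ge0 A : (0 <= product_cons A)%E.
Proof. exact: (measure_ge0 (mu \x nu)%E). Qed.

Let product_cons_sigma_additive : semi_sigma_additive product_cons.
Proof.
move=> B mB tB mUB; rewrite /product_cons /pushforward preimage_bigcup.
have mpre C : measurable C -> measurable (@tcons n @^-1` C).
  by move=> mC; rewrite -[X in measurable X]setTI; exact: measurable_tcons.
apply: measure_semi_sigma_additive.
- by move=> k; exact: mpre.
- apply/trivIsetP => /= i j _ _ ij; rewrite -preimage_setI.
  by move/trivIsetP : tB => /(_ _ _ _ _ ij) ->//; rewrite preimage_set0.
- by rewrite -preimage_bigcup; exact: mpre.
Qed.

HB.instance Definition _ := isMeasure.Build _ _ _ product_cons
  product_cons0 product_cons_ge0 product_cons_sigma_additive.

Let product_cons_fin : fin_num_fun product_cons.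
Proof.
move=> U mU; rewrite ge0_fin_numE ?measure_ge0//.
apply: (@le_lt_trans _ _ (product_cons setT)).
  by apply: le_measure; rewrite ?inE.
rewrite /product_cons /pushforward preimage_setT -setXTT product_measure1E//.
by rewrite lte_mul_pinfty// ?fin_num_measure// ltey_eq fin_num_measure.
Qed.

HB.instance Definition _ :=
  Measure_isFinite.Build _ _ _ product_cons product_cons_fin.

End step.

(* The dirac mass on the one-point space R^0 is finite. *)
Fixpoint product_measure n :
    ('I_n -> {finite_measure set S -> \bar R}) ->
    {finite_measure set (n.-tuple S) -> \bar R} :=
  match n with
  | 0 => fun _ => dirac [tuple]
  | m.+1 => fun mu =>
      product_cons (mu ord0) (product_measure (fun k => mu (lift ord0 k)))
  end.

End ProductMeasure.

Section OneDimensional.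
Context {R : realType}.
Implicit Types (W : cumulative R R) (f h : R -> R).

(* lebesgue_measure is the Lebesgue-Stieltjes measure of the identity. *)
Definition dx1 : {finite_measure set (measurableTypeR R) -> \bar R} :=
  circle_measure idfun.

Definition gen_derive W f (x : R) : R :=
  lim ((f (x + e) - f x) / (W (x + e) - W x) @[e --> 0^']).

(* f belongs to the domain of L_W and L_W f = h; functions on the circle are
   extended to R by periodicity. *)
Definition gen_laplacian W f h : Prop :=
  [/\ forall x, f (x + 1) = f x,
      h \in Lfun dx1 2%:E,
      \int[lebesgue_measure]_(z in `[0, 1]) h z = 0
    & exists a b : R,
        \int[lebesgue_stieltjes_measure W]_(y in `]0, 1])
          (b + \int[lebesgue_measure]_(z in `[0, y]) h z) = 0
        /\ forall x, 0 <= x < 1 ->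
             f x = a + b * W x +
               \int[lebesgue_stieltjes_measure W]_(y in `]0, x])
                 (\int[lebesgue_measure]_(z in `[0, y]) h z)].

Definition eigenvector W f : Prop :=
  (exists x, f x != 0) /\
  exists lambda : R, gen_laplacian W f (fun x => lambda * f x).

Definition orthonormal_eigenbasis W (B : set (R -> R)) : Prop :=
  [/\ countable B,
      forall f, B f -> f \in Lfun dx1 2%:E /\ eigenvector W f,
      forall f, B f -> \int[dx1]_x (f x ^+ 2) = 1,
      forall f g, B f -> B g -> f <> g -> \int[dx1]_x (f x * g x) = 0
    & forall g, g \in Lfun dx1 2%:E ->
        (forall f, B f -> \int[dx1]_x (f x * g x) = 0) ->
        g = cst 0 %[ae dx1]].

End OneDimensional.

Section WSobolev.
Context {R : realType} {d : nat}.
Local Notation S := (measurableTypeR R).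
Local Notation X := (d.-tuple S).
Variables (W : 'I_d -> cumulative R R) (A : 'I_d -> set (R -> R)).
Implicit Types (i : 'I_d) (f g h u v G : X -> R).

Definition dx : {finite_measure set X -> \bar R} :=
  product_measure (fun _ => dx1).

Definition dxW i : {finite_measure set X -> \bar R} :=
  product_measure (fun k => if k == i then circle_measure (W i) else dx1).

Definition slice f (x : X) i : R -> R :=
  fun t => f [tuple if k == i then t else tnth x k | k < d].

Definition in_DW f : Prop :=
  exists (n : nat) (c : 'I_n -> R) (phi : 'I_n -> 'I_d -> R -> R),
    (forall j k, A k (phi j k)) /\
    f = fun x => \sum_j c j * \prod_k phi j k (tnth x k).

Definition partial_W i f : X -> R :=
  fun x => gen_derive (W i) (slice f x i) (tnth x i).

(* h is a version of the partial derivative d_{x_i} d_{W_i} f: L_{W_i} maps the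
   slices of f to those of h.  For a product of eigenvectors f, with i-th
   eigenvalue lambda, this holds for h = lambda f; h is unique almost
   everywhere. *)
Definition is_partial_xW i f h : Prop :=
  h \in Lfun dx 2%:E /\
  forall x : X, gen_laplacian (W i) (slice f x i) (slice h x i).

Definition L2_zero_mean i G : Prop :=
  G \in Lfun (dxW i) 2%:E /\ \int[dxW i]_x G x = 0.

Definition is_weak_partial_W i g G : Prop :=
  L2_zero_mean i G /\
  forall f h, in_DW f -> is_partial_xW i f h ->
    \int[dx]_x (h x * g x) = - \int[dxW i]_x (partial_W i f x * G x).

Definition H1W g : Prop :=
  g \in Lfun dx 2%:E /\ forall i, exists G, is_weak_partial_W i g G.

Definition closure_partial_W i G : Prop :=
  forall e : R, 0 < e -> exists2 f, in_DW f &
    \int[dxW i]_x ((partial_W i f x - G x) ^+ 2) < e.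

(* The weak derivative.  The identity defining is_weak_partial_W does not see
   the component of G orthogonal to the functions d_{W_i} f, f in D_W.  When
   d = 1 zero mean alone makes G unique, but when d > 1 one can still add to G
   any zero-mean function that does not depend on x_i.  The derivative is the
   version lying in the closure of { d_{W_i} f : f in D_W }; such a version
   exists as soon as any does, and is unique almost everywhere. *)
Definition weak_partial_W i g : X -> R :=
  xget (cst 0) [set G : X -> R | is_weak_partial_W i g G /\ closure_partial_W i G].

Definition inner_1W f g : R :=
  \int[dx]_x (f x * g x) +
  \sum_i \int[dxW i]_x (weak_partial_W i f x * weak_partial_W i g x).

Definition norm_1W f : R := Num.sqrt (inner_1W f f).

Definition norm_L2 f : R := Num.sqrt (\int[dx]_x (f x ^+ 2)).

Definition H1W_perp f : Prop := H1W f /\ \int[dx]_x f x = 0.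

Definition weak_solution (a : 'I_d -> X -> R) f u : Prop :=
  H1W u /\
  forall v, H1W v ->
    \sum_i \int[dxW i]_x (a i x * weak_partial_W i u x * weak_partial_W i v x)
    = - \int[dx]_x (f x * v x).

End WSobolev.

(* Main.v *)
(** In dimension one, Fubini on the triangle 0 < y <= x <= 1 gives the integration
    by parts [\int (L_W f) g dx = - \int (d_W f) (d_W g) dW].  Applied to an
    eigenvector of nonzero eigenvalue it bounds the eigenvalue away from 0 by
    [1 / (W 1 - W 0)]; the other eigenvectors are constant.  Products of
    eigenvectors therefore form an orthonormal basis of L^2(T^d) which also
    diagonalizes the Dirichlet form, and the Poincare inequality holds on D_W.

    D_W is dense in H_{1,W}: the defect r of the orthogonal projection of
    (v, grad v) on the closure of the graph of the gradient over D_W satisfies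
    [<r, e> (1 + M_e) = 0] for every basis element e, of eigenvalue -M_e, so
    r = 0.  Hence the Poincare inequality extends to H_{1,W}, and constants are
    the only functions with zero gradient.

    Testing with v = 1 shows that f has zero mean.  Conversely, almost minimisers
    in D_W of the energy, coercive on zero mean functions, form a Cauchy sequence
    in H_{1,W}, whose limit is the solution.  Working with such sequences replaces
    the Riesz representation theorem, both here and for the projection above. *)

Require Import Defs.
From HB Require Import structures.
From mathcomp Require Import all_boot all_order all_algebra.
From mathcomp Require Import all_classical all_reals all_analysis.
From mathcomp Require Import measurable_realfun ring lra.

Set Implicit Arguments.
Unset Strict Implicit.
Unset Printing Implicit Defensive.

Import Order.TTheory GRing.Theory Num.Theory.
Import numFieldNormedType.Exports.

Local Open Scope classical_set_scope.
Local Open Scope ring_scope.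

(** [weak_partial_W] is picked by [xget], and the weak identity sees a derivative only through its
    pairings with gradients of D_W, so not even linearity can be read off the definition. The
    calculus on H_{1,W} therefore rests on graph limits: [DWcvg fs v G] records that functions and
    gradients converge together, and identities proved for finite sums of products of eigenvectors
    pass to the limit in L^2 inner products.

    The functions W_k may jump. The circle measure lives on [[0, 1[], whereas the domain of L_W is
    described by integrals over []0, x]]; for periodic integrands the two agree because 0 and 1
    carry atoms of equal mass. Difference quotients converge even at a jump, being averages of a
    continuous function.

    The tolerance [4^-1 ^+ n] of the almost minimisers makes increments of norm of order 2^-n, hence
    summable, which is the form of completeness proved here.

    The bounds on the coefficients hold on the unit cube alone; coefficients clamped to
    [[theta^-1, theta]] replace them everywhere. *)

(** * Almost minimisers of quadratic functionals *)

Section discriminant.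
Context {R : realType}.

(** No sign of [C] is assumed: a negative leading coefficient is refuted at a large [t], a zero one
    leaves an affine function, and otherwise the vertex [- B / C] decides. *)
Lemma discriminant_le (A B C : R) :
  (forall t, 0 <= A + t * (2 * B) + t ^+ 2 * C) -> B ^+ 2 <= A * C.
Proof.
move=> h.
have C0 : 0 <= C.
  rewrite leNgt; apply/negP => C0.
  have A0 : 0 <= A by have := h 0; rewrite mul0r expr0n/= mul0r !addr0.
  (* Chosen so that [s * C] is [-(2|B| + A + 1)]; at [t = 1 + s] the polynomial is then negative. *)
  set s := (`|B| * 2 + A + 1) / (- C).
  have e : s * C = - (`|B| * 2 + A + 1) by rewrite /s; field; lra.
  have B1 := normr_ge0 B; have B2 := ler_norm B; have B3 := ler_norm (- B).
  rewrite normrN in B3.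
  have s0 : 0 < s by rewrite divr_gt0//; lra.
  have := h (1 + s).
  have -> : A + (1 + s) * (2 * B) + (1 + s) ^+ 2 * C =
    A + 2 * B * (1 + s) + (1 + s) * C + (1 + s) * (s * C) by ring.
  rewrite e => k.
  have k1 : (1 + s) * (B - `|B|) <= 0 by rewrite mulr_ge0_le0//; lra.
  have k2 : (1 + s) * C <= 0 by rewrite mulr_ge0_le0//; lra.
  have k3 : 0 <= s * A by rewrite mulr_ge0//; lra.
  lra.
have [C00|C1] := eqVneq C 0.
  rewrite C00 mulr0 in h *.
  have [->|B0] := eqVneq B 0; first by rewrite expr0n.
  have := h (- (A + 1) / (2 * B)); rewrite mulr0 addr0.
  have -> : A + - (A + 1) / (2 * B) * (2 * B) = - 1 by field.
  lra.
have := h (- B / C).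
have -> : A + - B / C * (2 * B) + (- B / C) ^+ 2 * C = A - B ^+ 2 / C.
  by field.
by rewrite subr_ge0 ler_pdivrMr// lt_neqAle eq_sym C1.
Qed.

End discriminant.

Section quadratic_minimisation.
Context {R : realType} {V : lmodType R}.
Variables (D : set V) (q : V -> V -> R) (l : V -> R).
Hypothesis D_comb : forall a u v, D u -> D v -> D (a *: u + v).
Hypothesis q_comb : forall a u v w, D u -> D v -> D w ->
  q (a *: u + v) w = a * q u w + q v w.
Hypothesis q_sym : forall u v, D u -> D v -> q u v = q v u.
Hypothesis q_ge0 : forall u, D u -> 0 <= q u u.
Hypothesis l_comb : forall a u v, D u -> D v -> l (a *: u + v) = a * l u + l v.

(** The discriminant of [q w w] along [w = t *: v + u]. The form is only semidefinite, and
    [q v v = 0] is allowed. *)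
Lemma quadratic_form_CS u v : D u -> D v -> q u v ^+ 2 <= q u u * q v v.
Proof.
move=> Du Dv; apply: discriminant_le => t.
have Dw := D_comb t Dv Du; have := q_ge0 Dw.
rewrite q_comb// (q_sym Dv Dw) (q_sym Du Dw) !q_comb// (q_sym Dv Du).
by move=> /le_trans; apply; rewrite le_eqVlt; apply/orP; left; apply/eqP; ring.
Qed.

(* The v n are almost minimisers of q v v - 2 l v; varying them along w gives the
   discriminant condition of a quadratic polynomial. *)
Lemma approximate_riesz C : D !=set0 -> (forall v, D v -> l v ^+ 2 <= C * q v v) ->
  exists v : nat -> V, (forall n, D (v n)) /\
    forall n w, D w -> (q (v n) w - l w) ^+ 2 <= 4^-1 ^+ n * q w w.
Proof.
move=> [v0 Dv0] lC.
pose J v := q v v - 2 * l v.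
(* [C] may be negative when [q] vanishes on [D], hence the absolute value. *)
have C0 : exists2 C', 0 <= C' & forall v, D v -> l v ^+ 2 <= C' * q v v.
  exists `|C|; first exact: normr_ge0.
  move=> v Dv; apply: (le_trans (lC _ Dv)); apply: ler_wpM2r; first exact: q_ge0.
  exact: ler_norm.
case: C0 => C' C'0 {}lC.
(* [J] is bounded below because [2|l v| <= 2 sqrt(C' * q v v) <= C' + q v v]. *)
have Jlb v : D v -> - C' <= J v.
  move=> Dv; have q0 := q_ge0 Dv; have := lC _ Dv; rewrite /J => h.
  have [->|/eqP lv0] := eqVneq (l v) 0; first by lra.
  have h1 : (2 * l v) ^+ 2 <= (C' + q v v) ^+ 2.
    apply: (@le_trans _ _ (4 * (C' * q v v))); first by rewrite exprMn; lra.
    by have := sqr_ge0 (C' - q v v); nra.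
  have h2 : `|2 * l v| <= C' + q v v.
    by rewrite -(ger0_norm (addr_ge0 C'0 q0)) -ler_sqr ?nnegrE// !real_normK// num_real.
  have := ler_norm (2 * l v); lra.
pose S := [set J v | v in D].
have infS : has_inf S.
  by split; [exists (J v0), v0 | exists (- C') => _ [v Dv <-]; exact: Jlb].
(* This tolerance puts consecutive terms at distance of order 2^-n, the summable rate that
   [L2_complete] exploits. *)
have ex n : exists v, D v /\ J v < inf S + 4^-1 ^+ n.
  have e0 : (0 : R) < 4^-1 ^+ n by rewrite exprn_gt0// invr_gt0 ltr0n.
  by have [_ [v Dv <-] h] := inf_adherent e0 infS; exists v.
have /choice[v vP] := ex.
exists v; split=> [n|n w Dw]; first by case: (vP n).
have [Dv Jv] := vP n; apply: discriminant_le => t.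
have Dz := D_comb t Dw Dv.
have Jz : inf S <= J (t *: w + v n).
  by apply: ge_inf; [case: infS | exists (t *: w + v n)].
have Jz1 : J (t *: w + v n) = J (v n) + 2 * t * (q (v n) w - l w) + t ^+ 2 * q w w.
  rewrite /J q_comb// (q_sym Dw Dz) (q_sym Dv Dz) !q_comb// (q_sym Dw Dv) l_comb//.
  ring.
rewrite Jz1 in Jz.
move: Jz Jv; move: (J _) (inf S) (4^-1 ^+ n) (q (v n) w) (l w) (q w w) => ? ? ? ? ? ?.
lra.
Qed.

(** Both approximate identities are tested with [w = v n - v m] itself: [q w w] is then a difference
    of two errors, whose squares are at most [4^-n q w w] and [4^-m q w w]. One factor [q w w]
    cancels, the case [q w w = 0] being trivial. *)
Lemma approximate_riesz_cauchy (v : nat -> V) :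
  (forall n, D (v n)) ->
  (forall n w, D w -> (q (v n) w - l w) ^+ 2 <= 4^-1 ^+ n * q w w) ->
  forall n m, q (v n - v m) (v n - v m) <= 2 * (4^-1 ^+ n + 4^-1 ^+ m).
Proof.
move=> Dv vP n m; set w := v n - v m.
have Dw : D w by rewrite /w addrC -scaleN1r; exact: D_comb.
have qw : q w w = q (v n) w - q (v m) w.
  by rewrite {1}/w addrC -scaleN1r q_comb//; ring.
have := vP n _ Dw; have := vP m _ Dw.
have := q_ge0 Dw; rewrite le_eqVlt => /orP[/eqP<- _ _|qw0 h1 h2].
  by rewrite mulr_ge0// addr_ge0// exprn_ge0.
suff : q w w ^+ 2 <= 2 * (4^-1 ^+ n + 4^-1 ^+ m) * q w w by rewrite expr2 ler_pM2r.
rewrite {1}qw; have := sqr_ge0 ((q (v n) w - l w) + (q (v m) w - l w)).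
move: h1 h2; move: (4^-1 ^+ n) (4^-1 ^+ m) (q (v n) w) (q (v m) w) (l w) (q w w) => ? ? ? ? ? ?.
nra.
Qed.

End quadratic_minimisation.

(** * Square integrable functions for a finite measure *)

Section integrable_real_valued.
Context d (T : measurableType d) (R : realType).
Variables (mu : {measure set T -> \bar R}) (D : set T).
Hypothesis mD : measurable D.
Implicit Types f g : T -> R.

Lemma integrable_EFinD f g : mu.-integrable D (EFin \o f) ->
  mu.-integrable D (EFin \o g) -> mu.-integrable D (EFin \o (fun x => f x + g x)).
Proof. by move=> if_ ig; have := integrableD mD if_ ig; apply: eq_integrable. Qed.

Lemma integrable_EFinZ c f : mu.-integrable D (EFin \o f) ->
  mu.-integrable D (EFin \o (fun x => c * f x)).
Proof. by move=> if_; have := integrableZl mD c if_; apply: eq_integrable. Qed.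

End integrable_real_valued.

Section square_integrable.
Context d (T : measurableType d) (R : realType).
Variable mu : {finite_measure set T -> \bar R}.
Implicit Types f g h : T -> R.

Lemma Lfun2P f : f \in Lfun mu 2%:E <->
  measurable_fun setT f /\ mu.-integrable setT (EFin \o (fun x => f x ^+ 2)).
Proof.
split=> [Lf|[mf /integrableP[m2 i2]]].
  split; last exact: Lfun2_integrable_sqr.
  by move: Lf; rewrite inE => /andP[+ _]; rewrite inE.
rewrite inE; apply/andP; split; rewrite inE//=.
rewrite /finite_norm unlock/= poweR_lty//.
apply: le_lt_trans i2; rewrite le_eqVlt; apply/orP; left; apply/eqP.
by apply: eq_integral => x _; rewrite /= powR_mulrn// normrX.
Qed.

Lemma Lfun2_measurable f : f \in Lfun mu 2%:E -> measurable_fun setT f.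
Proof. by move=> /Lfun2P[]. Qed.

Lemma Lfun2_integrable_mul f g : f \in Lfun mu 2%:E -> g \in Lfun mu 2%:E ->
  mu.-integrable setT (EFin \o (fun x => f x * g x)).
Proof. by move=> Lf Lg; apply/Lfun1_integrable; exact: Lfun2_mul_Lfun1. Qed.

Lemma Lfun2_bounded f (M : R) : measurable_fun setT f ->
  (forall x, `|f x| <= M) -> f \in Lfun mu 2%:E.
Proof.
move=> mf fM; apply/Lfun2P; split => //.
apply: (@le_integrable _ _ _ mu setT _ _ (cst (M ^+ 2)%:E)) => //.
- by apply/measurable_EFinP; exact: measurable_funX.
- move=> x _ /=; rewrite lee_fin (ger0_norm (sqr_ge0 M)) normrX.
  by rewrite ler_pXn2r ?nnegrE// (le_trans (normr_ge0 (f x))).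
- exact: finite_measure_integrable_cst.
Qed.

Lemma Lfun2_cst c : cst c \in Lfun mu 2%:E.
Proof. exact: Lfun_cst. Qed.

Lemma Lfun2_comb a f g : f \in Lfun mu 2%:E -> g \in Lfun mu 2%:E ->
  (fun x => a * f x + g x) \in Lfun mu 2%:E.
Proof.
move=> Lf Lg; apply/Lfun2P; split.
  by apply: measurable_funD => //; [apply: measurable_funM => //|];
    exact: Lfun2_measurable.
have -> : EFin \o (fun x => (a * f x + g x) ^+ 2) =
   ((EFin \o (fun x => a ^+ 2 * (f x * f x))) \+ (EFin \o (fun x => (2 * a) * (f x * g x))))
   \+ (EFin \o (fun x => g x * g x)).
  by apply/funext => x /=; rewrite -!EFinD; congr EFin; ring.
have mulZ c h : mu.-integrable setT (EFin \o h) ->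
    mu.-integrable setT (EFin \o (fun x => c * h x)).
  by move=> ih; have := integrableZl measurableT c ih; apply: eq_integrable.
apply: integrableD => //; last exact: Lfun2_integrable_mul.
by apply: integrableD => //; apply: mulZ; exact: Lfun2_integrable_mul.
Qed.

Lemma Lfun2Z a f : f \in Lfun mu 2%:E -> (fun x => a * f x) \in Lfun mu 2%:E.
Proof.
move=> Lf; have := Lfun2_comb a Lf (Lfun2_cst 0).
by rewrite (_ : (fun x => _ + _) = fun x => a * f x)//; apply/funext => x; rewrite addr0.
Qed.

Lemma Lfun2B f g : f \in Lfun mu 2%:E -> g \in Lfun mu 2%:E ->
  (fun x => f x - g x) \in Lfun mu 2%:E.
Proof.
move=> Lf Lg; have := Lfun2_comb (-1) Lg Lf.
by rewrite (_ : (fun x => -1 * _ + _) = fun x => f x - g x)//; apply/funext => x; rewrite mulN1r addrC.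
Qed.

Lemma Lfun2_sum (I : Type) (s : seq I) (c : I -> R) (F : I -> T -> R) :
  (forall i, F i \in Lfun mu 2%:E) ->
  (fun x => \sum_(i <- s) c i * F i x) \in Lfun mu 2%:E.
Proof.
move=> LF; elim: s => [|i s ih].
  by under eq_fun do rewrite big_nil; exact: Lfun2_cst.
by under eq_fun do rewrite big_cons; exact: Lfun2_comb.
Qed.

Lemma Lfun2M f g (M : R) : f \in Lfun mu 2%:E -> measurable_fun setT g ->
  (forall x, `|g x| <= M) -> (fun x => g x * f x) \in Lfun mu 2%:E.
Proof.
move=> /Lfun2P[mf if2] mg gM; apply/Lfun2P; split; first exact: measurable_funM.
apply: (@le_integrable _ _ _ mu setT _ _ (EFin \o (fun x => M ^+ 2 * f x ^+ 2))) => //.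
- by apply/measurable_EFinP; apply: measurable_funX; exact: measurable_funM.
- move=> x _ /=; rewrite lee_fin !normrX -exprMn normrX ler_pXn2r ?nnegrE// !normrM ler_wpM2r//.
  by rewrite (le_trans (gM x))// ler_norm.
- by have := integrableZl measurableT (M ^+ 2) if2; apply: eq_integrable.
Qed.

Lemma ip_combl a f g h : f \in Lfun mu 2%:E -> g \in Lfun mu 2%:E ->
  h \in Lfun mu 2%:E ->
  \int[mu]_x ((a * f x + g x) * h x) =
  a * \int[mu]_x (f x * h x) + \int[mu]_x (g x * h x).
Proof.
move=> Lf Lg Lh.
have ifh := Lfun2_integrable_mul Lf Lh; have igh := Lfun2_integrable_mul Lg Lh.
rewrite -RintegralZl// -RintegralD//; last first.
  by have := integrableZl measurableT a ifh; apply: eq_integrable.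
by congr Rintegral; apply/funext => x; ring.
Qed.

Lemma ipC f g : \int[mu]_x (f x * g x) = \int[mu]_x (g x * f x).
Proof. by congr Rintegral; apply/funext => x; rewrite mulrC. Qed.

Lemma ip_combr a f g h : f \in Lfun mu 2%:E -> g \in Lfun mu 2%:E ->
  h \in Lfun mu 2%:E ->
  \int[mu]_x (h x * (a * f x + g x)) =
  a * \int[mu]_x (h x * f x) + \int[mu]_x (h x * g x).
Proof. by move=> Lf Lg Lh; rewrite ipC ip_combl// !(ipC h). Qed.

Lemma ipBl f g h : f \in Lfun mu 2%:E -> g \in Lfun mu 2%:E ->
  h \in Lfun mu 2%:E ->
  \int[mu]_x ((f x - g x) * h x) =
  \int[mu]_x (f x * h x) - \int[mu]_x (g x * h x).
Proof.
move=> Lf Lg Lh.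
have ifh := Lfun2_integrable_mul Lf Lh; have igh := Lfun2_integrable_mul Lg Lh.
by rewrite -RintegralB//; congr Rintegral; apply/funext => x; ring.
Qed.

Lemma ipBr f g h : f \in Lfun mu 2%:E -> g \in Lfun mu 2%:E ->
  h \in Lfun mu 2%:E ->
  \int[mu]_x (h x * (f x - g x)) =
  \int[mu]_x (h x * f x) - \int[mu]_x (h x * g x).
Proof. by move=> Lf Lg Lh; rewrite ipC ipBl// !(ipC h). Qed.

Lemma ip_suml (I : Type) (s : seq I) (c : I -> R) (F : I -> T -> R) h :
  (forall i, F i \in Lfun mu 2%:E) -> h \in Lfun mu 2%:E ->
  \int[mu]_x ((\sum_(i <- s) c i * F i x) * h x) =
  \sum_(i <- s) c i * \int[mu]_x (F i x * h x).
Proof.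
move=> LF Lh; elim: s => [|i s ih].
  under eq_Rintegral do rewrite big_nil mul0r.
  by rewrite big_nil Rintegral_cst// mul0r.
under eq_Rintegral do rewrite big_cons.
by rewrite ip_combl ?ih ?big_cons//; exact: Lfun2_sum.
Qed.

Lemma ip_sumr (I : Type) (s : seq I) (c : I -> R) (F : I -> T -> R) h :
  (forall i, F i \in Lfun mu 2%:E) -> h \in Lfun mu 2%:E ->
  \int[mu]_x (h x * (\sum_(i <- s) c i * F i x)) =
  \sum_(i <- s) c i * \int[mu]_x (h x * F i x).
Proof.
by move=> LF Lh; rewrite ipC ip_suml//; apply: eq_bigr => i _; rewrite (ipC h).
Qed.

Lemma sqE f : \int[mu]_x (f x ^+ 2) = \int[mu]_x (f x * f x).
Proof. by []. Qed.

Lemma ip_ge0 f : 0 <= \int[mu]_x (f x * f x).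
Proof. by apply: Rintegral_ge0 => x _; exact: sqr_ge0. Qed.

Lemma ip_CS f g : f \in Lfun mu 2%:E -> g \in Lfun mu 2%:E ->
  (\int[mu]_x (f x * g x)) ^+ 2 <= \int[mu]_x (f x * f x) * \int[mu]_x (g x * g x).
Proof.
move=> Lf Lg.
apply: (@quadratic_form_CS _ (T -> R) [set f | f \in Lfun mu 2%:E]
  (fun f g => \int[mu]_x (f x * g x))) => //.
- by move=> a u v; exact: Lfun2_comb.
- by move=> a u v w; exact: ip_combl.
- by move=> u v _ _; exact: ipC.
- by move=> u _; exact: ip_ge0.
Qed.

Lemma ip_self_eq0 f : f \in Lfun mu 2%:E -> \int[mu]_x (f x * f x) = 0 ->
  f = cst 0 %[ae mu].
Proof.
move=> Lf f0; have ff := Lfun2_integrable_mul Lf Lf.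
have : (\int[mu]_x `|(f x * f x)%:E| = 0)%E.
  under eq_integral do rewrite gee0_abs ?lee_fin ?sqr_ge0//.
  rewrite -[LHS]fineK ?[fine _]f0//.
  exact: integrable_fin_num ff.
move/(ae_eq_integral_abs mu measurableT (measurable_int _ ff)).1.
apply: filterS => x /(_ I) [] /eqP; rewrite mulf_eq0 orbb => /eqP h _.
exact: h.
Qed.

Lemma ae_eq_ip f f' g : f \in Lfun mu 2%:E -> f' \in Lfun mu 2%:E ->
  g \in Lfun mu 2%:E -> f = f' %[ae mu] ->
  \int[mu]_x (f x * g x) = \int[mu]_x (f' x * g x).
Proof.
move=> Lf Lf' Lg ff'; congr fine; apply: ae_eq_integral => //.
- by apply/measurable_EFinP; apply: measurable_funM; exact: Lfun2_measurable.
- by apply/measurable_EFinP; apply: measurable_funM; exact: Lfun2_measurable.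
- by apply: filterS ff' => x /= h /h ->.
Qed.

Lemma Lfun2_integrable f : f \in Lfun mu 2%:E -> mu.-integrable setT (EFin \o f).
Proof.
move=> Lf; have := Lfun2_integrable_mul Lf (Lfun2_cst 1).
by apply: eq_integrable => // x _ /=; rewrite mulr1.
Qed.

Lemma Rintegral_ip1 f : \int[mu]_x f x = \int[mu]_x (f x * cst 1 x).
Proof. by congr Rintegral; apply/funext => x; rewrite mulr1. Qed.

End square_integrable.

Lemma cvg0_le (R : realType) (u v : nat -> R) :
  (forall n, `|u n| <= v n) -> v @ \oo --> 0 -> u @ \oo --> 0.
Proof.
move=> uv v0.
have h : (fun n => `|u n|) @ \oo --> (0 : R).
  apply: (@squeeze_cvgr _ _ _ _ (cst 0) v).
  - by apply: nearW => n; rewrite normr_ge0 uv.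
  - exact: cvg_cst.
  - exact: v0.
exact: (norm_cvg0 h).
Qed.

Lemma cvg_dist_le (R : realType) (u v : nat -> R) (l : R) :
  (forall n, `|u n - l| <= v n) -> v @ \oo --> 0 -> u @ \oo --> l.
Proof.
move=> uv v0; have h : (fun n => u n - l + l) @ \oo --> 0 + l.
  by apply: cvgD; [exact: cvg0_le uv v0 | exact: cvg_cst].
move: h; rewrite add0r.
by under eq_fun do rewrite subrK.
Qed.

Section L2_convergence.
Context d (T : measurableType d) (R : realType).
Variable mu : {finite_measure set T -> \bar R}.
Implicit Types f g h : T -> R.
Implicit Types fs gs : nat -> T -> R.

Definition L2cvg fs f := \int[mu]_x ((fs n x - f x) ^+ 2) @[n --> \oo] --> (0 : R).

Lemma ip_CS_sqrt f g : f \in Lfun mu 2%:E -> g \in Lfun mu 2%:E ->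
  `|\int[mu]_x (f x * g x)| <=
    Num.sqrt (\int[mu]_x (f x ^+ 2)) * Num.sqrt (\int[mu]_x (g x ^+ 2)).
Proof.
move=> Lf Lg; have := ip_CS Lf Lg => h.
rewrite -sqrtrM; last by apply: Rintegral_ge0 => x _; exact: sqr_ge0.
rewrite -[leLHS]sqrtr_sqr; apply: ler_wsqrtr; exact: h.
Qed.

Lemma sqrt_cvg0 (u : nat -> R) : u @ \oo --> 0 -> (fun n => Num.sqrt (u n)) @ \oo --> 0.
Proof. by move=> u0; rewrite -[0]sqrtr0; apply: continuous_cvg => //; exact: sqrt_continuous. Qed.

(** The tool by which identities over D_W pass to H_{1,W}: both factors may vary, and each of the
    three error terms is controlled by Cauchy-Schwarz. *)
Lemma L2cvg_ip fs f gs g : (forall n, fs n \in Lfun mu 2%:E) -> f \in Lfun mu 2%:E ->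
  (forall n, gs n \in Lfun mu 2%:E) -> g \in Lfun mu 2%:E ->
  L2cvg fs f -> L2cvg gs g ->
  \int[mu]_x (fs n x * gs n x) @[n --> \oo] --> \int[mu]_x (f x * g x).
Proof.
move=> Lfs Lf Lgs Lg /sqrt_cvg0 cf /sqrt_cvg0 cg.
set F := fun n => Num.sqrt _ in cf; set G := fun n => Num.sqrt _ in cg.
pose sf := Num.sqrt (\int[mu]_x (f x ^+ 2)).
pose sg := Num.sqrt (\int[mu]_x (g x ^+ 2)).
apply: (@cvg_dist_le _ _ (fun n => F n * G n + F n * sg + sf * G n)); last first.
  rewrite [X in _ --> X](_ : 0 = 0 * 0 + 0 * sg + sf * 0); last by ring.
  apply: cvgD; first apply: cvgD.
  - exact: cvgM.
  - by apply: cvgM => //; exact: cvg_cst.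
  - by apply: cvgM => //; exact: cvg_cst.
move=> n.
have -> : \int[mu]_x (fs n x * gs n x) - \int[mu]_x (f x * g x) =
  \int[mu]_x ((fs n x - f x) * (gs n x - g x)) + \int[mu]_x ((fs n x - f x) * g x)
  + \int[mu]_x (f x * (gs n x - g x)).
  have L1 := Lfun2B (Lfs n) Lf; have L2 := Lfun2B (Lgs n) Lg.
  by rewrite !ipBl// !ipBr//; ring.
apply: (le_trans (ler_normD _ _)); apply: lerD; first apply: (le_trans (ler_normD _ _)).
- by apply: lerD; apply: ip_CS_sqrt => //; exact: Lfun2B.
- by apply: ip_CS_sqrt => //; exact: Lfun2B.
Qed.

Lemma L2cvg_cst f : L2cvg (fun=> f) f.
Proof.
rewrite /L2cvg; under eq_fun do under eq_Rintegral do rewrite subrr expr0n/=.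
by under eq_fun do rewrite Rintegral_cst// mul0r; exact: cvg_cst.
Qed.

Lemma L2cvgM fs f (a : T -> R) (M : R) : (forall n, fs n \in Lfun mu 2%:E) -> f \in Lfun mu 2%:E ->
  measurable_fun setT a -> (forall x, `|a x| <= M) ->
  L2cvg fs f -> L2cvg (fun n x => a x * fs n x) (fun x => a x * f x).
Proof.
move=> Lfs Lf ma aM cf.
apply: (@cvg0_le _ _ (fun n => M ^+ 2 * \int[mu]_x ((fs n x - f x) ^+ 2))); last first.
  by rewrite -[X in _ --> X](mulr0 (M ^+ 2)); apply: cvgM => //; exact: cvg_cst.
move=> n; have Ld := Lfun2B (Lfs n) Lf.
have Lad := Lfun2M Ld ma aM.
rewrite ger0_norm; last by apply: Rintegral_ge0 => x _; exact: sqr_ge0.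
have id2 := ((Lfun2P _ _).1 Ld).2; have iad2 := ((Lfun2P _ _).1 Lad).2.
rewrite -RintegralZl//.
apply: le_Rintegral => //.
- by apply: eq_integrable iad2 => // x _ /=; rewrite mulrBr.
- by have := integrableZl measurableT (M ^+ 2) id2; apply: eq_integrable.
- move=> x _; rewrite -mulrBr exprMn ler_wpM2r ?sqr_ge0//.
  by rewrite -(real_normK (num_real (a x))) ler_pXn2r ?nnegrE// (le_trans _ (aM x)).
Qed.

Lemma L2cvg_comb fs f gs g a : (forall n, fs n \in Lfun mu 2%:E) -> f \in Lfun mu 2%:E ->
  (forall n, gs n \in Lfun mu 2%:E) -> g \in Lfun mu 2%:E ->
  L2cvg fs f -> L2cvg gs g ->
  L2cvg (fun n x => a * fs n x + gs n x) (fun x => a * f x + g x).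
Proof.
move=> Lfs Lf Lgs Lg cf cg; have cfg : L2cvg (fun n x => fs n x - f x) (cst 0) by
  rewrite /L2cvg; under eq_fun do under eq_Rintegral do rewrite subr0.
rewrite /L2cvg.
(* The cross term of the expanded square; it tends to 0 as an inner product of two sequences with
   limit 0. *)
pose c n := \int[mu]_x ((fs n x - f x) * (gs n x - g x)).
have -> : (fun n => \int[mu]_x ((a * fs n x + gs n x - (a * f x + g x)) ^+ 2)) =
  (fun n => a ^+ 2 * \int[mu]_x ((fs n x - f x) ^+ 2) + 2 * a * c n
    + \int[mu]_x ((gs n x - g x) ^+ 2)).
  apply/funext => n.
  have L1 := Lfun2B (Lfs n) Lf; have L2 := Lfun2B (Lgs n) Lg.
  have L3 := Lfun2_comb a L1 L2.
  transitivity (\int[mu]_x ((a * (fs n x - f x) + (gs n x - g x)) *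
      (a * (fs n x - f x) + (gs n x - g x)))).
    by apply: eq_Rintegral => x _; ring.
  by rewrite ip_combl// !ip_combr// /c (ipC _ (fun x => gs n x - g x)); ring.
have cc : c n @[n --> \oo] --> 0.
  have cg0 : L2cvg (fun n x => gs n x - g x) (cst 0) by
    rewrite /L2cvg; under eq_fun do under eq_Rintegral do rewrite subr0.
  have := L2cvg_ip (fun n => Lfun2B (Lfs n) Lf) (Lfun2_cst _ _) (fun n => Lfun2B (Lgs n) Lg) (Lfun2_cst _ _) cfg cg0.
  by under [X in _ --> X -> _]eq_Rintegral do rewrite mul0r; rewrite Rintegral_cst// mul0r.
rewrite [X in _ --> X](_ : 0 = a ^+ 2 * 0 + 2 * a * 0 + 0); last by ring.
by apply: cvgD => //; apply: cvgD; apply: cvgM => //; exact: cvg_cst.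
Qed.

End L2_convergence.

(** * Completeness of L^2 for geometrically Cauchy sequences *)

Section L2_completeness.
Context d (T : measurableType d) (R : realType).
Variable mu : {finite_measure set T -> \bar R}.

Lemma cvg_summable_increments (u : nat -> R) :
  (\sum_(0 <= n <oo) (`|u n.+1 - u n|)%:E < +oo)%E -> cvgn u.
Proof.
move=> uoo.
have h : cvgn (series (telescope u)).
  by apply: normed_cvg; apply: nnseries_is_cvg => [n|]; [exact: normr_ge0|exact: uoo].
have -> : u = (fun n => u 0%N + series (telescope u) n).
  by apply/funext => n; exact: eq_sum_telescope.
by apply: is_cvgD; [exact: is_cvg_cst|exact: h].
Qed.

Lemma limn_einf_le (u : nat -> \bar R) (c : \bar R) :
  (forall n, (u n <= c)%E) -> (limn_einf u <= c)%E.
Proof.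
move=> uc; rewrite limn_einf_lim; apply: lime_le; first exact: is_cvg_einfs.
apply: nearW => n; apply: le_trans (uc n).
by apply: ereal_inf_lbound; exists n => /=.
Qed.

(** Riesz-Fischer without extraction of a subsequence: the rate makes the increments summable in
    L^1, so the sequence itself converges almost everywhere, and Fatou turns the pointwise limit
    into an L^2 limit. *)
Lemma L2_complete (fs : nat -> T -> R) (K : R) :
  (forall n, fs n \in Lfun mu 2%:E) ->
  (forall n m, \int[mu]_x ((fs n x - fs m x) ^+ 2) <= K * (4^-1 ^+ n + 4^-1 ^+ m)) ->
  exists2 f, f \in Lfun mu 2%:E & L2cvg mu fs f.
Proof.
move=> Lfs cau.
have K0 : 0 <= K.
  have := cau 0%N 0%N; rewrite !expr0.
  have : 0 <= \int[mu]_x ((fs 0%N x - fs 0%N x) ^+ 2).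
    by apply: Rintegral_ge0 => x _; exact: sqr_ge0.
  by move=> /le_trans h /h; lra.
have mfs n := Lfun2_measurable (Lfs n).
pose dd n x := fs n.+1 x - fs n x.
have Ldd n : dd n \in Lfun mu 2%:E by exact: Lfun2B.
pose g x := (\sum_(0 <= n <oo) (`|dd n x|)%:E)%E.
have mabsd n : measurable_fun setT (fun x => (`|dd n x|)%:E).
  by apply/measurable_EFinP; apply: measurableT_comp => //; exact: Lfun2_measurable.
have mg : measurable_fun setT g by apply: ge0_emeasurable_sum.
pose m0 := fine (mu setT).
have m00 : 0 <= m0 by exact: fine_ge0.
(* From [|x| <= e + x^2 / e] with [e = 2^-(n+1)]. Since [4^-n = 4 e^2], the quadratic part
   contributes at most [5 K e], rounded up to [8 K e]; the bound is the term of a geometric series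
   of ratio one half. *)
have intd n : (\int[mu]_x (`|dd n x|)%:E <= ((m0 + 8 * K) / (2 ^ (n + 1)%N)%:R)%:E)%E.
  have idd2 := ((Lfun2P _ _).1 (Ldd n)).2.
  pose e : R := 2^-1 ^+ n.+1.
  have e0 : 0 < e by rewrite exprn_gt0.
  have e2 : e ^+ 2 = 4^-1 * 4^-1 ^+ n.
    by rewrite /e -exprM mulnC exprM -exprS; congr (_ ^+ _); field.
  have e1 : ((2 ^ (n + 1)%N)%:R : R)^-1 = e by rewrite /e natrX addn1 exprVn.
  have ih : mu.-integrable setT (EFin \o (fun x => e + e^-1 * dd n x ^+ 2)).
    apply: integrable_EFinD => //; first exact: finite_measure_integrable_cst.
    exact: integrable_EFinZ.
  apply: (@le_trans _ _ (\int[mu]_x (e + e^-1 * dd n x ^+ 2)%:E)%E).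
    apply: ge0_le_integral => //.
    - exact: measurable_int ih.
    - move=> x _; rewrite lee_fin.
      have -> : e + e^-1 * dd n x ^+ 2 = e^-1 * (e ^+ 2 + dd n x ^+ 2) by field; lra.
      rewrite ler_pdivlMl// -(real_normK (num_real (dd n x))).
      by have := sqr_ge0 (e - `|dd n x|); nra.
  rewrite -[leLHS]fineK; last exact: integrable_fin_num ih.
  rewrite lee_fin -/(Rintegral mu setT _) RintegralD//; last 2 first.
    - exact: finite_measure_integrable_cst.
    - exact: integrable_EFinZ.
  rewrite Rintegral_cst// RintegralZl// -/m0 e1.
  have := cau n.+1 n; rewrite -/(dd n) => h.
  have h2 : \int[mu]_x (dd n x ^+ 2) <= K * (4 * e ^+ 2 * 2).
    apply: (le_trans h); apply: ler_wpM2l => //; rewrite e2 exprS.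
    have p0 : (0 : R) <= 4^-1 ^+ n by rewrite exprn_ge0.
    by lra.
  have : e^-1 * \int[mu]_x (dd n x ^+ 2) <= K * (8 * e).
    by rewrite ler_pdivrMl//; apply: (le_trans h2); nra.
  by nra.
have g0 x : (0 <= g x)%E by apply: nneseries_ge0 => n _ _; rewrite lee_fin.
have ig : mu.-integrable setT g.
  apply/integrableP; split => //.
  under eq_integral do rewrite gee0_abs//.
  rewrite integral_nneseries//.
  have := cvg_lim (@ereal_hausdorff R) (@cvg_geometric_eseries_half _ (m0 + 8 * K) 0).
  rewrite /eseries/= expr0 divr1 => e.
  apply: (@le_lt_trans _ _ (m0 + 8 * K)%:E); last exact: ltry.
  rewrite -e; apply: lee_nneseries => [n _ _|n _]; first exact: integral_ge0.
  exact: intd.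
pose C := [set x | (g x < +oo)%E].
have mC : measurable C.
  by rewrite /C -[X in measurable X]setTI; exact: emeasurable_fun_infty_o.
have aeC : {ae mu, forall x, C x}.
  apply: filterS (integrable_ae measurableT ig) => x /(_ I).
  by rewrite ge0_fin_numE.
(* Cut off outside the convergence set, so that the limit exists at every point and is
   measurable. *)
pose hs n x := fs n x * \1_C x.
have mhs n : measurable_fun setT (hs n) by apply: measurable_funM.
have chs x : cvgn (hs ^~ x).
  rewrite /hs indicE; case: (asboolP (C x)) => Cx.
    rewrite mem_set//; under eq_fun do rewrite mulr1.
    exact: cvg_summable_increments.
  by rewrite memNset//; under eq_fun do rewrite mulr0; exact: is_cvg_cst.
pose f x := lim (hs ^~ x @ \oo).
have mf : measurable_fun setT f.
  by apply: (@measurable_fun_cvg _ _ _ setT hs) => // x _; exact: chs.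
have fatou_fs n : (\int[mu]_x ((fs n x - f x) ^+ 2)%:E <= (2 * K * 4^-1 ^+ n)%:E)%E.
  (* The index is shifted by [n] so that the Cauchy bound is at most [2 K 4^-n] for every [m]. *)
  pose F m x := ((fs n x - hs (m + n)%N x) ^+ 2)%:E.
  have mF m : measurable_fun setT (F m).
    by apply/measurable_EFinP; apply: measurable_funX; apply: measurable_funB.
  have cF x : F ^~ x @ \oo --> ((fs n x - f x) ^+ 2)%:E.
    apply: cvg_EFin; first by apply: nearW.
    have c : hs (m + n)%N x @[m --> \oo] --> f x by rewrite (cvg_shiftn n (hs ^~ x)); exact: chs.
    by rewrite /comp/=; apply: cvgM; apply: cvgB => //; exact: cvg_cst.
  have := fatou mu measurableT mF (fun m x _ => sqr_ge0 _).
  under eq_integral do rewrite (cvg_limn_einf_sup (cF _)).1.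
  move=> /le_trans; apply; apply: limn_einf_le => m.
  have Ld : (fun x => fs n x - fs (m + n)%N x) \in Lfun mu 2%:E by exact: Lfun2B.
  have id2 := ((Lfun2P _ _).1 Ld).2.
  rewrite (@ae_eq_integral _ _ _ mu setT (EFin \o (fun x => (fs n x - fs (m + n)%N x) ^+ 2))) //.
  - rewrite -[leLHS]fineK; last exact: integrable_fin_num id2.
    rewrite lee_fin; apply: le_trans (cau n (m + n)%N) _.
    rewrite (mulrC 2) -mulrA ler_wpM2l// exprD.
    have p0 : (0 : R) <= 4^-1 ^+ n by rewrite exprn_ge0.
    have p1 : (4^-1 : R) ^+ m <= 1 by rewrite exprn_ile1// invf_le1 ?ler1n.
    by nra.
  - exact: measurable_int id2.
  - by apply: filterS aeC => x Cx _; rewrite /F /hs indicE mem_set// mulr1.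
(* [f] is recovered as [fs 0 - (fs 0 - f)]; the Fatou bound at [n = 0] puts the difference in
   L^2. *)
have Lf : f \in Lfun mu 2%:E.
  have Ld : (fun x => fs 0%N x - f x) \in Lfun mu 2%:E.
    apply/Lfun2P; split; first exact: measurable_funB.
    apply/integrableP; split.
      by apply/measurable_EFinP; apply: measurable_funX; exact: measurable_funB.
    under eq_integral do rewrite gee0_abs ?lee_fin ?sqr_ge0//.
    by apply: le_lt_trans (fatou_fs 0%N) _; exact: ltry.
  have := Lfun2B (Lfs 0%N) Ld.
  by rewrite (_ : (fun x => _ - _) = f)//; apply/funext => x; rewrite subKr.
exists f => //.
apply: (@cvg0_le _ _ (fun n => 2 * K * 4^-1 ^+ n)); last first.
  apply: cvg_geometric; rewrite ger0_norm// invf_lt1 ?ltr1n//.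
move=> n; rewrite ger0_norm; last by apply: Rintegral_ge0 => x _; exact: sqr_ge0.
have id2 := ((Lfun2P _ _).1 (Lfun2B (Lfs n) Lf)).2.
by rewrite -lee_fin /Rintegral fineK//; exact: integrable_fin_num id2.
Qed.

End L2_completeness.

(** * Stieltjes measures on the circle *)

Section stieltjes.
Context {R : realType}.
Implicit Types (W : cumulative R R).
Local Notation S := (measurableTypeR R).
Local Notation mu := lebesgue_stieltjes_measure.

Lemma stieltjes_oc W (a b : R) : a <= b -> mu W `]a, b]%classic = (W b - W a)%:E.
Proof.
move=> ab; rewrite /lebesgue_stieltjes_measure /measure_extension.
rewrite measurable_mu_extE/=; last exact: is_ocitv.
exact: wlength_itv_bnd.
Qed.

Lemma measurable_ocitv (i : interval R) : measurable ([set` i] : set S).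
Proof. exact: measurable_itv. Qed.

Lemma integral_circle W (f : S -> \bar R) : measurable_fun setT f ->
  (\int[circle_measure W]_x f x = \int[mu W]_(x in `[0%R, 1%R[) f x)%E.
Proof.
move=> mf.
have mI : measurable (`[0, 1[%classic : set S) by exact: measurable_ocitv.
have h (g : S -> \bar R) : measurable_fun setT g -> (forall x, 0 <= g x)%E ->
    (\int[circle_measure W]_x g x = \int[mu W]_(x in `[0%R, 1%R[) g x)%E.
  move=> mg g0.
  rewrite (@ge0_negligible_integral _ _ _ _ setT (~` (`[0, 1[%classic : set S)))//; last 2 first.
  - exact: measurableC.
  - by rewrite /= /mfrestr /mrestr setICl measure0.
  rewrite setTD setCK; apply: eq_measure_integral => A mA AI.
  by rewrite /circle_measure /= /mfrestr /mrestr setIidl.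
rewrite integralE [RHS]integralE h//; last exact: measurable_funepos.
by rewrite h//; exact: measurable_funeneg.
Qed.

Lemma integrable_circle W (f : S -> \bar R) : measurable_fun setT f ->
  ((circle_measure W).-integrable setT f <-> (mu W).-integrable `[0, 1[ f).
Proof.
move=> mf; split=> /integrableP[mf' foo]; apply/integrableP; split => //.
- exact: measurable_funTS.
- by rewrite -integral_circle//; exact: measurableT_comp.
- by rewrite integral_circle//; exact: measurableT_comp.
Qed.

Lemma stieltjes_set1 W (a : R) :
  (W a - W (a - n.+1%:R^-1))%:E @[n --> \oo] --> mu W [set a].
Proof.
pose F n : set S := `](a - n.+1%:R^-1), a]%classic.
have F0 n : 0 < n.+1%:R^-1 :> R by rewrite invr_gt0.
have mF n : measurable (F n) by exact: measurable_ocitv.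
have muF n : mu W (F n) = (W a - W (a - n.+1%:R^-1))%:E.
  by rewrite stieltjes_oc// gerBl ltW.
have FE : [set a] = \bigcap_n F n.
  apply/seteqP; split=> [x -> n _|x Fx] /=.
    by rewrite /F/= in_itv/= lexx andbT ltrBlDr ltrDl.
  apply/eqP; rewrite eq_le.
  have := Fx 0%N I; rewrite /F/= in_itv/= => /andP[_ ->]/=.
  apply/ler_addgt0Pr => e e0.
  have [n ne] : exists n, n.+1%:R^-1 < e.
    exists (Num.truncn (e^-1)); rewrite -[ltRHS]invrK ltf_pV2 ?posrE ?invr_gt0//.
    by rewrite truncnS_gt.
  have := Fx n I; rewrite /F/= in_itv/= => /andP[h _].
  by rewrite ltrBlDr in h; rewrite ltW// (lt_trans h)// ltrD2l.
rewrite FE; under eq_fun do rewrite -muF.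
apply: nonincreasing_cvg_mu => //.
- by apply: (le_lt_trans _ (ltry (W a - W (a - 1%:R^-1)))); rewrite -(muF 0%N).
- exact: bigcapT_measurable.
- apply/nonincreasing_seqP => n; apply/subsetPset => x; rewrite /F/= !in_itv/= => /andP[h ->].
  rewrite andbT (le_lt_trans _ h)// lerB// lef_pV2 ?posrE//.
  by rewrite ler_nat.
Qed.

(** An atom is the limit of the left increments [W a - W (a - 1/(n+1))], and by periodicity these
    coincide term by term at [a = 0] and [a = 1]. *)
Lemma stieltjes_periodic_atom W : (forall x, W (x + 1) - W x = W 1 - W 0) ->
  mu W [set 0] = mu W [set 1].
Proof.
move=> Wper; have := @stieltjes_set1 W 1; have := @stieltjes_set1 W 0.
have -> : (fun n => (W 1 - W (1 - n.+1%:R^-1))%:E) =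
          (fun n => (W 0 - W (0 - n.+1%:R^-1))%:E).
  apply/funext => n; congr EFin; have := Wper (0 - n.+1%:R^-1).
  rewrite (_ : 0 - n.+1%:R^-1 + 1 = 1 - n.+1%:R^-1); last by ring.
  by lra.
by move=> /(cvg_lim (@ereal_hausdorff R)) <- /(cvg_lim (@ereal_hausdorff R)) <-.
Qed.

(** The fundamental domains [[0, 1[] and []0, 1]] differ by their endpoints, which have equal mass
    and, by [f 0 = f 1], equal values. *)
Lemma integral_circle_oc W (f : S -> \bar R) :
  (forall x, W (x + 1) - W x = W 1 - W 0) ->
  measurable_fun setT f -> f 0 = f 1 ->
  (\int[circle_measure W]_x f x = \int[mu W]_(x in `]0%R, 1%R]) f x)%E.
Proof.
move=> Wper mf f01; rewrite integral_circle//.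
have int1 (a : R) : (\int[mu W]_(x in [set a]) f x = f a * mu W [set a])%E.
  rewrite -integral_cst; last exact: measurable_set1.
  by apply: eq_integral => x; rewrite inE => ->.
have mO : measurable (`]0, 1[%classic : set S) by exact: measurable_ocitv.
have -> : (`[0, 1[%classic : set S) = [set 0] `|` `]0, 1[%classic.
  by rewrite setU1itv// bnd_simp.
have -> : (`]0, 1]%classic : set S) = `]0, 1[%classic `|` [set 1].
  by rewrite setUitv1// bnd_simp.
have m1 (a : R) : measurable ([set a] : set S) by exact: measurable_set1.
rewrite integral_setU//; last 2 first.
- exact: measurable_funTS.
- by apply/disj_set2P; apply/seteqP; split => // x [/= ->]; rewrite in_itv/= ltxx.
rewrite integral_setU//; last 2 first.
- exact: measurable_funTS.
- by apply/disj_set2P; apply/seteqP; split => // x [/= h e]; move: h; rewrite e in_itv/= ltxx andbF.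
by rewrite int1 int1 f01 (stieltjes_periodic_atom Wper) addeC.
Qed.

End stieltjes.

Lemma integrable_oc_bounded (R : realType) (W : cumulative R R) (x y M : R) (f : R -> R) :
  x <= y -> measurable_fun (`]x, y]%classic : set R) f -> (forall z : R, x < z <= y -> `|f z| <= M) ->
  (lebesgue_stieltjes_measure W).-integrable `]x, y] (EFin \o f).
Proof.
move=> xy mf fM.
have mI : measurable (`]x, y]%classic : set (measurableTypeR R)) by exact: measurable_ocitv.
apply: measurable_bounded_integrable => //.
  by rewrite [ltLHS]stieltjes_oc// ltry.
exists M; split; first exact: num_real.
move=> N MN z /=; rewrite in_itv/= => zxy.
by apply: le_trans (fM _ zxy) (ltW MN).
Qed.

Lemma periodic_int (R : realType) (f : R -> R) :
  (forall x, f (x + 1) = f x) -> forall (n : int) x, f (x + n%:~R) = f x.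
Proof.
move=> fp.
have fn (n : nat) x : f (x + n%:R) = f x.
  by elim: n => [|n ih]; rewrite ?addr0// -natr1 addrA fp.
case=> n x; first exact: fn.
by rewrite NegzE -(fn n.+1) mulrNz addrNK.
Qed.

(** * The generalized derivative of a Stieltjes primitive *)

Section stieltjes_primitive.
Context {R : realType}.
Variable W : cumulative R R.
Hypothesis Winc : forall x y : R, x < y -> W x < W y.
Hypothesis Wper : forall x : R, W (x + 1) - W x = W 1 - W 0.
Local Notation mu := (lebesgue_stieltjes_measure W).

Definition increment_quotient (f : R -> R) (x e : R) : R := (f (x + e) - f x) / (W (x + e) - W x).

Variables (f g : R -> R) (M : R).
Hypothesis fper : forall x : R, f (x + 1) = f x.
Hypothesis mf : measurable_fun setT f.
Hypothesis mg : measurable_fun (`[0, 1]%classic : set R) g.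
Hypothesis gM : forall x : R, 0 <= x <= 1 -> `|g x| <= M.
Hypothesis gcont : forall x : R, 0 <= x <= 1 -> forall e : R, 0 < e -> exists2 dlt : R, 0 < dlt &
  forall y : R, 0 <= y <= 1 -> `|x - y| < dlt -> `|g x - g y| <= e.
Hypothesis g01 : g 0 = g 1.
Hypothesis fg : forall x y : R, 0 <= x -> x <= y -> y <= 1 ->
  f y - f x = \int[mu]_(z in `]x, y]) g z.

Let ig (x y : R) : 0 <= x -> x <= y -> y <= 1 -> mu.-integrable `]x, y] (EFin \o g).
Proof.
move=> x0 xy y1; apply: (@integrable_oc_bounded _ _ _ _ M) => //.
  apply: measurable_funS mg => //.
  move=> z /=; rewrite !in_itv/= => /andP[xz zy].
  by rewrite (le_trans x0 (ltW xz)) (le_trans zy y1).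
by move=> z /andP[xz zy]; apply: gM; rewrite (le_trans x0 (ltW xz)) (le_trans zy y1).
Qed.

Let mI (x y : R) : measurable (`]x, y]%classic : set (measurableTypeR R)).
Proof. exact: measurable_ocitv. Qed.

Let icst (x y c : R) : x <= y -> mu.-integrable `]x, y] (EFin \o cst c).
Proof.
move=> xy; by apply: (@integrable_oc_bounded _ _ _ _ `|c|).
Qed.

Let Rcst (x y c : R) : x <= y -> \int[mu]_(z in `]x, y]) cst c z = c * (W y - W x).
Proof. by move=> xy; rewrite Rintegral_cst// [X in fine X]stieltjes_oc. Qed.

(** The ratio of the increments of [f] and [W] is an average of [g], hence close to [c] when [g] is.
    Nothing is asked of the size of [W y - W x], so a jump of [W] does no harm. *)
Lemma increment_approx (x y c e : R) : 0 <= x -> x <= y -> y <= 1 ->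
  (forall z : R, x < z <= y -> `|c - g z| <= e) ->
  `|f y - f x - c * (W y - W x)| <= e * (W y - W x).
Proof.
move=> x0 xy y1 gc.
have igxy := ig x0 xy y1.
rewrite fg// -Rcst// -RintegralB//; last exact: icst.
have iB : mu.-integrable `]x, y] (EFin \o (fun z => g z - c)).
  have := integrableB (mI x y) igxy (icst c xy).
  by apply: eq_integrable.
apply: le_trans (le_normr_Rintegral _ iB) _ => //.
rewrite -Rcst//; apply: le_Rintegral => //.
- by have := integrable_norm iB; apply: eq_integrable.
- exact: icst.
- by move=> z /=; rewrite in_itv/= => zxy; rewrite distrC; exact: gc.
Qed.

Lemma increment_quotient_near_right (x : R) : 0 <= x < 1 -> forall e : R, 0 < e ->
  exists2 dlt : R, 0 < dlt & forall t : R, 0 < t < dlt ->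
    `|g x - increment_quotient f x t| <= e.
Proof.
move=> /andP[x0 x1] e e0.
have x01 : 0 <= x <= 1 by rewrite x0 ltW.
have [dlt d0 dP] := gcont x01 e0.
exists (Num.min dlt (1 - x)); first by rewrite lt_min d0 subr_gt0.
move=> t /andP[t0]; rewrite lt_min => /andP[td tx].
have xt : x <= x + t by lra.
have xt1 : x + t <= 1 by lra.
have W0 : 0 < W (x + t) - W x by rewrite subr_gt0 Winc//; lra.
have gz z : x < z <= x + t -> `|g x - g z| <= e.
  by move=> /andP[xz zt]; apply: dP; [lra | rewrite ltr_norml; lra].
have := increment_approx x0 xt xt1 gz; rewrite /increment_quotient.
set u := f _ - f _; set w := W _ - W _ in W0 *.
have -> : u - g x * w = - ((g x - u / w) * w) by field; lra.
by rewrite normrN normrM (gtr0_norm W0) ler_pM2r.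
Qed.

Lemma increment_quotient_near_left (x : R) : 0 < x <= 1 -> forall e : R, 0 < e ->
  exists2 dlt : R, 0 < dlt & forall t : R, 0 < t < dlt ->
    `|g x - increment_quotient f x (- t)| <= e.
Proof.
move=> /andP[x0 x1] e e0.
have x01 : 0 <= x <= 1 by rewrite ltW.
have [dlt d0 dP] := gcont x01 e0.
exists (Num.min dlt x); first by rewrite lt_min d0.
move=> t /andP[t0]; rewrite lt_min => /andP[td tx].
have xt : x - t <= x by lra.
have xt1 : 0 <= x - t by lra.
have W0 : 0 < W x - W (x - t) by rewrite subr_gt0 Winc//; lra.
have gz z : x - t < z <= x -> `|g x - g z| <= e.
  by move=> /andP[xz zt]; apply: dP; [lra | rewrite ltr_norml; lra].
have := increment_approx xt1 xt x1 gz; rewrite /increment_quotient.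
rewrite -(opprB (f x)) -(opprB (W x)).
set u := f _ - f _; set w := W _ - W _ in W0 *.
have -> : u - g x * w = - ((g x - (- u) / (- w)) * w) by field; lra.
by rewrite normrN normrM (gtr0_norm W0) ler_pM2r.
Qed.

Lemma increment_quotientD1 (x e : R) : increment_quotient f (x + 1) e = increment_quotient f x e.
Proof.
rewrite /increment_quotient (addrAC x) !fper; congr (_ / _).
have := Wper (x + e); have := Wper x; lra.
Qed.

Lemma increment_quotient_cvg01 (x : R) : 0 <= x < 1 ->
  increment_quotient f x e @[e --> 0^'] --> g x.
Proof.
move=> x01; apply/cvgrPdist_le => e e0.
have [d1 d10 d1P] := increment_quotient_near_right x01 e0.
have [d2 d20 d2P] : exists2 dlt : R, 0 < dlt & forall t : R, 0 < t < dlt ->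
    `|g x - increment_quotient f x (- t)| <= e.
  have [->|xN0] := eqVneq x 0.
    have [|dd d0 dP] := @increment_quotient_near_left 1 _ _ e0; first by rewrite lexx ltr01.
    exists dd => // t /dP; rewrite g01 -[X in increment_quotient f X]add0r.
    by rewrite increment_quotientD1.
  by apply: increment_quotient_near_left => //; lra.
near=> t.
have tN0 : t != 0 by near: t; exact: nbhs_dnbhs_neq.
have [t0|t0|t0] := ltgtP t 0; last by rewrite t0 eqxx in tN0.
- rewrite -[t]opprK; apply: d2P; rewrite oppr_gt0 t0/=.
  have : `|t| < d2 by near: t; apply: dnbhs0_lt.
  by rewrite ltr0_norm.
- apply: d1P; rewrite t0/=.
  have : `|t| < d1 by near: t; apply: dnbhs0_lt.
  by rewrite gtr0_norm.
Unshelve. all: by end_near. Qed.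

Lemma increment_quotient_frac (x e : R) :
  increment_quotient f x e = increment_quotient f (x - (Num.floor x)%:~R) e.
Proof.
have p : forall x, increment_quotient f (x + 1) e = increment_quotient f x e.
  by move=> y; exact: increment_quotientD1.
by rewrite -[in LHS](subrK (Num.floor x)%:~R x) (periodic_int p).
Qed.

Lemma increment_quotient_cvg (x : R) :
  increment_quotient f x e @[e --> 0^'] --> g (x - (Num.floor x)%:~R).
Proof.
under eq_fun do rewrite increment_quotient_frac.
apply: increment_quotient_cvg01.
have := floor_itv x; rewrite intrD; lra.
Qed.

Lemma gen_deriveE (x : R) : gen_derive W f x = g (x - (Num.floor x)%:~R).
Proof. exact: (cvg_lim (@Rhausdorff R) (@increment_quotient_cvg x)). Qed.

Lemma gen_derive_itv (x : R) : 0 <= x <= 1 -> gen_derive W f x = g x.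
Proof.
move=> /andP[x0]; rewrite le_eqVlt => /orP[/eqP->|x1].
  by rewrite gen_deriveE floor1 subrr g01.
rewrite gen_deriveE (@floor_def _ x 0) ?subr0// x0/= add0r//.
Qed.

Lemma gen_derive_bounded (x : R) : `|gen_derive W f x| <= M.
Proof.
rewrite gen_deriveE; apply: gM; have := floor_itv x; rewrite intrD; lra.
Qed.

(** The quotients converge at every point, so the derivative is a pointwise limit of the measurable
    quotients with step [1/(n+1)]. *)
Lemma measurable_gen_derive : measurable_fun setT (gen_derive W f).
Proof.
have mW : measurable_fun setT W.
  by apply: nondecreasing_measurable => //; exact: cumulative_is_nondecreasing.
have mshift (c : R) : measurable_fun setT (fun x : R => x + c).
  by apply: measurable_funD => //; exact: measurable_cst.
apply: (@measurable_fun_cvg _ _ _ setT (fun n x => increment_quotient f x (n.+1%:R^-1))).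
  move=> n; have n0 : 0 < n.+1%:R^-1 :> R by rewrite invr_gt0.
  (* The division is written as a power of exponent -1, a measurable operation; it agrees with the
     inverse because the increment of [W] is nonnegative. *)
  have -> : increment_quotient f ^~ n.+1%:R^-1 = fun x =>
      (f (x + n.+1%:R^-1) - f x) * (W (x + n.+1%:R^-1) - W x) `^ (-1).
    apply/funext => x; rewrite /increment_quotient powR_inv1//.
    by rewrite subr_ge0 ltW// Winc// ltrDl.
  apply: measurable_funM.
    by apply: measurable_funB => //; exact: (measurableT_comp mf).
  apply: (measurableT_comp (measurable_powR _)); apply: measurable_funB => //.
  exact: (measurableT_comp mW).
move=> x _; have h := @increment_quotient_cvg x; rewrite -gen_deriveE in h.
move=> P /h [e e0 eP]; have := @cvg_harmonic R.
move=> /cvgrPdist_lt/(_ e e0); apply: filterS => n /=; rewrite distrC => hn.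
apply: eP; last by rewrite invr_neq0.
by move: hn; rewrite /= !sub0r subr0 normrN.
Qed.

End stieltjes_primitive.

(** * The operator L_W on the circle *)

Lemma Lfun_dx1_integrable (R : realType) (h : R -> R) : h \in Lfun (@dx1 R) 2%:E ->
  lebesgue_measure.-integrable `[0, 1] (EFin \o h).
Proof.
move=> Lh; have mh := Lfun2_measurable Lh.
have meh : measurable_fun setT (EFin \o h) by exact/measurable_EFinP.
have /integrable_circle := Lfun2_integrable Lh => /(_ meh) /integrableP[m0 i0].
apply/integrableP; split; first exact: measurable_funTS.
rewrite -integral_itv_bndo_bndc//; apply: measurable_funTS.
exact: measurableT_comp.
Qed.

Section generalized_laplacian.
Context {R : realType}.
Variable W : cumulative R R.
Hypothesis Winc : forall x y : R, x < y -> W x < W y.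
Hypothesis Wper : forall x : R, W (x + 1) - W x = W 1 - W 0.
Local Notation mu := (lebesgue_stieltjes_measure W).
Local Notation lam := (@lebesgue_measure R).
Variables (f h : R -> R).
Hypothesis fh : gen_laplacian W f h.
Hypothesis mf : measurable_fun setT f.

Let mI (x y : R) : measurable (`]x, y]%classic : set (measurableTypeR R)).
Proof. exact: measurable_ocitv. Qed.

(** Provides the hypotheses of the previous section. Here [g 0 = g 1] expresses the zero mean of
    [h], and continuity of [g] is that of an indefinite Lebesgue integral. *)
Lemma gen_laplacian_primitive : exists b M : R,
  let g y := b + \int[lam]_(z in `[0, y]) h z in
  [/\ measurable_fun (`[0, 1]%classic : set R) g,
      (forall x : R, 0 <= x <= 1 -> `|g x| <= M),
      (forall x : R, 0 <= x <= 1 -> forall e : R, 0 < e -> exists2 dlt : R, 0 < dlt &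
        forall y : R, 0 <= y <= 1 -> `|x - y| < dlt -> `|g x - g y| <= e),
      g 0 = g 1 &
      (forall x y : R, 0 <= x -> x <= y -> y <= 1 ->
         f y - f x = \int[mu]_(z in `]x, y]) g z)].
Proof.
have [fper Lh h0 [a [b [intb fE]]]] := fh.
pose H y := \int[lam]_(z in `[0, y]) h z.
pose g y := b + H y.
have ih := Lfun_dx1_integrable Lh.
have ihx x : x <= 1 -> lam.-integrable `[0, x] (EFin \o h).
  move=> x1; apply: integrableS ih => //.
  by move=> z /=; rewrite !in_itv/= => /andP[-> /le_trans]; apply.
pose M := `|b| + \int[lam]_(z in `[0, 1]) `|h z|.
have Hcont : {within `[0, 1], continuous H}.
  exact: (parameterized_integral_continuous ler01 ih).
have H0 : H 0 = 0 by rewrite /H set_itv1 Rintegral_set1.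
have H1 : H 1 = 0 by exact: h0.
have mH : measurable_fun (`[0, 1]%classic : set R) H.
  by apply: subspace_continuous_measurable_fun => //.
have mg : measurable_fun (`[0, 1]%classic : set R) g.
  by apply: measurable_funD => //; exact: measurable_cst.
have HM x : 0 <= x <= 1 -> `|H x| <= \int[lam]_(z in `[0, 1]) `|h z|.
  move=> /andP[x0 x1].
  apply: le_trans (le_normr_Rintegral _ (ihx _ x1)) _ => //.
  rewrite /Rintegral fine_le//.
  - by apply: integrable_fin_num => //; have := integrable_norm (ihx _ x1); apply: eq_integrable.
  - by apply: integrable_fin_num => //; have := integrable_norm ih; apply: eq_integrable.
  - apply: ge0_subset_integral => //.
      by apply/measurable_EFinP; apply: measurableT_comp => //; apply: measurable_funTS; exact: Lfun2_measurable Lh.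
    by move=> z /=; rewrite !in_itv/= => /andP[-> /le_trans]; apply.
exists b, M; rewrite /= -/H; split.
- exact: mg.
- by move=> x x01; apply: (le_trans (ler_normD _ _)); rewrite lerD2l HM.
- move=> x x01 e e0.
  have := Hcont x; rewrite /continuous_at => /cvgrPdist_le /(_ e e0).
  rewrite /nbhs/= -nbhs_subspace_in; last by rewrite /= in_itv.
  move=> [d0 d00 dP]; exists d0 => // y y01 xy.
  rewrite opprD addrACA subrr add0r; apply: dP => //.
- by rewrite -/(H 0) -/(H 1) H0 H1.
- have igI x y : 0 <= x -> x <= y -> y <= 1 -> mu.-integrable `]x, y] (EFin \o g).
    move=> x0 xy y1; apply: (@integrable_oc_bounded _ _ _ _ M) => //.
      apply: measurable_funS mg => //.
      move=> z /=; rewrite !in_itv/= => /andP[xz zy].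
      by rewrite (le_trans x0 (ltW xz)) (le_trans zy y1).
    move=> z /andP[xz zy]; apply: (le_trans (ler_normD _ _)); rewrite lerD2l HM//.
    by rewrite (le_trans x0 (ltW xz)) (le_trans zy y1).
  have Rcst x y (c : R) : x <= y -> \int[mu]_(z in `]x, y]) cst c z = c * (W y - W x).
    by move=> xy; rewrite Rintegral_cst// [X in fine X]stieltjes_oc.
  have icst x y (c : R) : x <= y -> mu.-integrable `]x, y] (EFin \o cst c).
    by move=> xy; apply: (@integrable_oc_bounded _ _ _ _ `|c|).
  (* The defining formula covers [[0, 1[] only; at 1 both sides equal [f 0], the left one by
     periodicity and the right one by the vanishing of the integral of [b + H]. *)
  have fg0 x : 0 <= x <= 1 -> f x = f 0 + \int[mu]_(z in `]0, x]) g z.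
    move=> /andP[x0]; rewrite le_eqVlt => /orP[/eqP->|x1].
      by rewrite intb addr0 -[in LHS](add0r 1) fper.
    rewrite !fE ?x0 ?lexx ?ltr01//= set_itvoc0 Rintegral_set0 addr0.
    rewrite RintegralD//; last 2 first.
    - exact: icst.
    - have := integrableB (mI 0 x) (igI _ _ (lexx 0) x0 (ltW x1)) (icst _ _ b x0).
      by apply: eq_integrable => // z _; rewrite /g/= -EFinB addrAC subrr add0r.
    - by rewrite Rcst//; rewrite /H; ring.
  move=> x y x0 xy y1.
  rewrite (fg0 y) ?(le_trans x0)// (fg0 x) ?x0 ?(le_trans xy)//.
  have -> : (`]0, y]%classic : set (measurableTypeR R)) = `]0, x]%classic `|` `]x, y]%classic.
    by apply: itv_bndbnd_setU; rewrite bnd_simp.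
  rewrite Rintegral_setU//.
  - ring.
  - by rewrite -itv_bndbnd_setU ?bnd_simp//; apply: igI => //; exact: le_trans xy.
  - apply/disj_set2P; apply/seteqP; split => // z [/=].
    by rewrite !in_itv/= => /andP[_ zx] /andP[/lt_le_trans/(_ zx)]; rewrite ltxx.
Qed.

Local Notation Df := (gen_derive W f).

(** The primitive [b + H] is identified with [gen_derive W f], so that later statements mention
    neither [b] nor the primitive. *)
Lemma gen_laplacian_derive :
  [/\ measurable_fun setT Df,
      exists M : R, forall x, `|Df x| <= M,
      forall x : R, increment_quotient W f x e @[e --> 0^'] --> Df x,
      Df 0 = Df 1 &
   (forall x : R, 0 <= x <= 1 -> Df x = Df 0 + \int[lam]_(z in `[0, x]) h z) /\
   (forall x y : R, 0 <= x -> x <= y -> y <= 1 ->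
      f y - f x = \int[mu]_(z in `]x, y]) Df z)].
Proof.
have [b [M []]] := gen_laplacian_primitive.
set g := fun y => b + _ => mg gM gc g01 fg.
have [fper _ _ _] := fh.
have DfE (x : R) : 0 <= x <= 1 -> Df x = g x by exact: (gen_derive_itv Winc Wper fper mg gM gc g01 fg).
have in0 : 0 <= (0 : R) <= 1 by rewrite lexx ler01.
have in1 : 0 <= (1 : R) <= 1 by rewrite lexx ler01.
split.
- exact: (measurable_gen_derive Winc Wper fper mf mg gM gc g01 fg).
- by exists M; exact: (gen_derive_bounded Winc Wper fper mg gM gc g01 fg).
- move=> x; rewrite (gen_deriveE Winc Wper fper mg gM gc g01 fg).
  exact: (increment_quotient_cvg Winc Wper fper mg gM gc g01 fg).
- by rewrite !DfE.
- split => [x x01|x y x0 xy y1].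
    by rewrite !DfE// /g set_itv1 Rintegral_set1 addr0.
  rewrite fg//; apply: eq_Rintegral => z; rewrite inE/= in_itv/= => /andP[xz zy].
  by rewrite DfE// (le_trans x0 (ltW xz)) (le_trans zy y1).
Qed.

(** Over []0, 1]] the integral is [f 1 - f 0], which vanishes by periodicity. *)
Lemma gen_laplacian_derive_mean : \int[circle_measure W]_x Df x = 0.
Proof.
have [mD _ _ D01 [_ fD]] := gen_laplacian_derive.
have [fper _ _ _] := fh.
rewrite /Rintegral (@integral_circle_oc _ W (EFin \o Df))//.
- by rewrite -/(Rintegral _ _ _) -fD// -[in X in X - _](add0r 1) fper subrr.
- exact/measurable_EFinP.
- by rewrite /= D01.
Qed.

End generalized_laplacian.

(** * Integrals of products, and integration by parts on the circle *)

Section tensor_integral.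
Context d1 d2 (T1 : measurableType d1) (T2 : measurableType d2) (R : realType).
Variables (m1 : {sigma_finite_measure set T1 -> \bar R}).
Variables (m2 : {sigma_finite_measure set T2 -> \bar R}).

Lemma integrable_tensor (u : T1 -> R) (v : T2 -> R) :
  m1.-integrable setT (EFin \o u) -> m2.-integrable setT (EFin \o v) ->
  (m1 \x m2)%E.-integrable setT (EFin \o (fun p => u p.1 * v p.2)).
Proof.
move=> iu iv.
have mu' : measurable_fun setT u by exact/measurable_EFinP/(measurable_int _ iu).
have mv' : measurable_fun setT v by exact/measurable_EFinP/(measurable_int _ iv).
have muv : measurable_fun setT (fun p : T1 * T2 => u p.1 * v p.2).
  by apply: measurable_funM; [exact: (measurableT_comp mu')|exact: (measurableT_comp mv')].
apply/integrable12ltyP; first exact/measurable_EFinP.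
have uvE x : (\int[m2]_y `|(u x * v y)%R%:E| = (\int[m2]_y `|(v y)%:E|) * `|(u x)%:E|)%E.
  rewrite -ge0_integralZr//.
  - by apply: eq_integral => y _; rewrite /= normrM EFinM muleC.
  - by apply: measurableT_comp => //; exact/measurable_EFinP.
have /integrableP[_ iu'] := iu; have /integrableP[_ iv'] := iv.
under eq_integral do rewrite /= uvE.
rewrite ge0_integralZl//.
- by rewrite lte_mul_pinfty// ?integral_ge0// ge0_fin_numE// integral_ge0.
- by apply: measurableT_comp => //; exact/measurable_EFinP.
- exact: integral_ge0.
Qed.

Lemma Rintegral_tensor (u : T1 -> R) (v : T2 -> R) :
  m1.-integrable setT (EFin \o u) -> m2.-integrable setT (EFin \o v) ->
  \int[(m1 \x m2)%E]_p (u p.1 * v p.2) = \int[m1]_x u x * \int[m2]_y v y.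
Proof.
move=> iu iv; have iuv := integrable_tensor iu iv.
rewrite /Rintegral -(integral12_prod_meas1 iuv)/=.
have -> : fubini_F m2 (EFin \o (fun p : T1 * T2 => u p.1 * v p.2)) =
  (fun x => (\int[m2]_y v y)%:E * (u x)%:E)%E.
  apply/funext => x; rewrite /fubini_F /= /Rintegral fineK; last exact: integrable_fin_num.
  rewrite muleC -integralZl//; apply: eq_integral => y _; by rewrite EFinM.
rewrite integralZl// fineM//; last exact: integrable_fin_num.
by rewrite mulrC.
Qed.

End tensor_integral.

Section integration_by_parts.
Context {R : realType}.
Variable W : cumulative R R.
Local Notation mu := (lebesgue_stieltjes_measure W).
Local Notation lam := (@lebesgue_measure R).
Local Notation S := (measurableTypeR R).

Lemma Rintegral_circle (V : cumulative R R) (u : R -> R) : measurable_fun setT u ->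
  \int[circle_measure V]_x u x = \int[lebesgue_stieltjes_measure V]_(x in `[0, 1[) u x.
Proof. by move=> mu'; rewrite /Rintegral integral_circle//; exact/measurable_EFinP. Qed.

Lemma Rintegral_dx1 (u : R -> R) : measurable_fun setT u ->
  \int[dx1]_x u x = \int[lam]_(x in `[0, 1]) u x.
Proof.
move=> mu'; rewrite Rintegral_circle// /Rintegral; congr fine.
rewrite -integral_itv_bndo_bndc//; apply: measurable_funTS; exact/measurable_EFinP.
Qed.

Lemma Rintegral_circle_oc (u : R -> R) : (forall x, W (x + 1) - W x = W 1 - W 0) ->
  measurable_fun setT u -> u 0 = u 1 ->
  \int[circle_measure W]_x u x = \int[mu]_(x in `]0, 1]) u x.
Proof.
move=> Wper mu' u01; rewrite /Rintegral (@integral_circle_oc _ W (EFin \o u))//.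
  exact/measurable_EFinP.
by rewrite /= u01.
Qed.

(* Fubini on the triangle 0 < y <= x <= 1. *)
Lemma stieltjes_parts (h E : R -> R) (M : R) :
  lam.-integrable `[0, 1] (EFin \o h) -> measurable_fun setT h -> measurable_fun setT E -> (forall x, `|E x| <= M) ->
  \int[lam]_(x in `[0, 1]) (h x * \int[mu]_(y in `]0, x]) E y) =
  \int[mu]_(y in `]0, 1]) (E y * \int[lam]_(x in `[y, 1]) h x).
Proof.
move=> ih mh mE EM.
have m01 : measurable (`[0, 1]%classic : set S) by exact: measurable_ocitv.
have mo1 : measurable (`]0, 1]%classic : set S) by exact: measurable_ocitv.
(* Both functions are extended by zero, so that the triangle becomes the indicator of [y <= x] in an
   integral over the whole product space. *)
pose hh : S -> R := h \_ `[0, 1]%classic.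
pose EE : S -> R := E \_ `]0, 1]%classic.
have iE : mu.-integrable `]0, 1] (EFin \o E).
  by apply: (@integrable_oc_bounded _ _ _ _ M) => //; exact: measurable_funTS.
have ihh : lam.-integrable setT (EFin \o hh).
  by rewrite /hh -restrict_EFin; exact: ((integrable_mkcond _ m01).1 ih).
have iEE : mu.-integrable setT (EFin \o EE).
  by rewrite /EE -restrict_EFin; exact: ((integrable_mkcond _ mo1).1 iE).
pose Tr : set (S * S) := [set p | p.2 <= p.1].
have mTr : measurable Tr.
  have := @measurable_lee _ (S * S)%type R setT measurableT (fun p => (p.2)%:E) (fun p => (p.1)%:E).
  rewrite setTI; apply; apply/measurable_EFinP.
    exact: measurable_snd.
  exact: measurable_fst.
pose F (p : S * S) := (hh p.1 * EE p.2 * \1_Tr p)%:E.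
have iF : (lam \x mu)%E.-integrable setT F.
  have it := integrable_tensor ihh iEE.
  apply: (le_integrable _ _ _ it) => //.
    apply/measurable_EFinP; apply: measurable_funM => //.
    by have := measurable_int _ it; move/measurable_EFinP.
  move=> p _; rewrite /F/= lee_fin normrM ler_piMr// indicE.
  by case: (_ \in _); rewrite ?normr1// normr0 ler01.
have := Fubini iF.
have -> : (fun x => \int[mu]_y F (x, y))%E =
   EFin \o ((fun x => h x * \int[mu]_(y in `]0, x]) E y) \_ `[0, 1]%classic).
  apply/funext => x; rewrite /F/= /patch; case: ifPn => x01; last first.
    rewrite (_ : (fun _ => _) = cst 0%E) ?integral_cst ?mul0e//.
    by apply/funext => y; rewrite /hh/= /patch (negbTE x01) !mul0r.
  move: (x01); rewrite inE/= in_itv/= => /andP[x0 x1].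
  have mox : measurable (`]0, x]%classic : set S) by exact: measurable_ocitv.
  have iEx : mu.-integrable `]0, x] (EFin \o E).
    by apply: (@integrable_oc_bounded _ _ _ _ M) => //; exact: measurable_funTS.
  rewrite -RintegralZl//= [in RHS]/Rintegral fineK; last first.
    by apply: integrable_fin_num => //; exact: integrable_EFinZ.
  rewrite [RHS]integral_mkcond; apply: eq_integral => y _.
  rewrite restrict_EFin/=; congr EFin.
  rewrite /hh/= /EE /patch x01 indicE /Tr.
  have -> : (y \in `]0, x]%classic) = (y \in `]0, 1]%classic) && ((x, y) \in [set p : S * S| p.2 <= p.1]).
    apply/idP/andP => [/set_mem/=|[/set_mem/= + /set_mem/= yx]]; rewrite in_itv/= => /andP[y0].
      by move=> yx; split; apply/mem_set => //=; rewrite in_itv/= y0 (le_trans yx x1).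
    by move=> _; apply/mem_set; rewrite /= in_itv/= y0.
  by case: (y \in _) => /=; case: (_ \in _); rewrite ?mulr0 ?mulr1 ?mul0r.
have -> : (fun y => \int[lam]_x F (x, y))%E =
   EFin \o ((fun y => E y * \int[lam]_(x in `[y, 1]) h x) \_ `]0, 1]%classic).
  apply/funext => y; rewrite /F/= /patch; case: ifPn => y01; last first.
    rewrite (_ : (fun _ => _) = cst 0%E) ?integral_cst ?mul0e//.
    by apply/funext => x; rewrite /EE/= /patch (negbTE y01) mulr0 mul0r.
  move: (y01); rewrite inE/= in_itv/= => /andP[y0 y1].
  have my1 : measurable (`[y, 1]%classic : set S) by exact: measurable_ocitv.
  have ihy : lam.-integrable `[y, 1] (EFin \o h).
    apply: integrableS ih => // z /=; rewrite !in_itv/= => /andP[yz ->].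
    by rewrite andbT (le_trans (ltW y0) yz).
  rewrite -RintegralZl//= [in RHS]/Rintegral fineK; last first.
    by apply: integrable_fin_num => //; exact: integrable_EFinZ.
  rewrite [RHS]integral_mkcond; apply: eq_integral => x _.
  rewrite restrict_EFin/=; congr EFin.
  rewrite /hh/= /EE /patch y01 indicE /Tr.
  have -> : (x \in `[y, 1]%classic) = (x \in `[0, 1]%classic) && ((x, y) \in [set p : S * S| p.2 <= p.1]).
    apply/idP/andP => [/set_mem/=|[/set_mem/= + /set_mem/= yx]]; rewrite in_itv/=.
      move=> /andP[yx x1]; split; apply/mem_set => //=.
      by rewrite in_itv/= x1 (le_trans (ltW y0) yx).
    by move=> /andP[_ x1]; apply/mem_set; rewrite /= in_itv/= yx.
  by case: (x \in _) => /=; case: (_ \in _); rewrite ?mulr0 ?mulr1 ?mul0r// mulrC.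
by move=> /(congr1 fine) e; rewrite Rintegral_mkcond [RHS]Rintegral_mkcond.
Qed.

Hypothesis Winc : forall x y : R, x < y -> W x < W y.
Hypothesis Wper : forall x : R, W (x + 1) - W x = W 1 - W 0.

Lemma gen_laplacian_bounded (f h : R -> R) :
  gen_laplacian W f h -> measurable_fun setT f -> exists K : R, forall x, `|f x| <= K.
Proof.
move=> fh mf.
have [mD [M DM] _ D01 [Dh fD]] := gen_laplacian_derive Winc Wper fh mf.
have [fper _ _ _] := fh.
set D := gen_derive W f in mD DM D01 Dh fD *.
have M0 : 0 <= M by apply: le_trans (DM 0).
exists (`|f 0| + M * (W 1 - W 0)) => x.
rewrite -(subrK (Num.floor x)%:~R x) (periodic_int fper).
have [y0 y1] : 0 <= x - (Num.floor x)%:~R /\ x - (Num.floor x)%:~R <= 1.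
  by have := floor_itv x; rewrite intrD; lra.
move: (x - _) y0 y1 => y y0 y1.
have moy : measurable (`]0, y]%classic : set S) by exact: measurable_ocitv.
have iD : mu.-integrable `]0, y] (EFin \o D).
  by apply: (@integrable_oc_bounded _ _ _ _ M) => //; exact: measurable_funTS.
rewrite -(subrK (f 0) (f y)) addrC; apply: (le_trans (ler_normD _ _)).
rewrite lerD2l fD//; apply: le_trans (le_normr_Rintegral _ iD) _ => //.
apply: (@le_trans _ _ (\int[mu]_(z in `]0, y]) cst M z)).
  apply: le_Rintegral => //.
  - by have := integrable_norm iD; apply: eq_integrable.
  - by apply: (@integrable_oc_bounded _ _ _ _ `|M|).
rewrite Rintegral_cst// [X in fine X]stieltjes_oc//= ler_wpM2l// lerD2r.
by move: y1; rewrite le_eqVlt => /orP[/eqP->//|/Winc/ltW].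
Qed.

(** On the circle both boundary terms vanish. Write [g x] as [g 0] plus the integral of [E] over
    []0, x]]: the term in [g 0] is killed by the zero mean of [h]. After the exchange of integrals,
    the integral of [h] over [[y, 1]] is [D 0 - D y], and [D 0] multiplies [g 1 - g 0 = 0]. *)
Lemma gen_laplacian_parts (f h g k : R -> R) :
  gen_laplacian W f h -> measurable_fun setT f ->
  gen_laplacian W g k -> measurable_fun setT g ->
  \int[dx1]_x (h x * g x) =
  - \int[circle_measure W]_x (gen_derive W f x * gen_derive W g x).
Proof.
move=> fh mf gk mg.
have [mD [M DM] _ D01 [Dh _]] := gen_laplacian_derive Winc Wper fh mf.
have [mE [N EN] _ E01 [_ gE]] := gen_laplacian_derive Winc Wper gk mg.
have [gper _ _ _] := gk; have [fper Lh h0 _] := fh.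
have mh := Lfun2_measurable Lh; have ih := Lfun_dx1_integrable Lh.
set D := gen_derive W f in mD DM D01 Dh *; set E := gen_derive W g in mE EN E01 gE *.
have mo1 : measurable (`]0, 1]%classic : set S) by exact: measurable_ocitv.
have ibd (u : R -> R) (K : R) : measurable_fun setT u -> (forall x, `|u x| <= K) ->
    mu.-integrable `]0, 1] (EFin \o u).
  move=> mu' uK; apply: (@integrable_oc_bounded _ _ _ _ K) => //; exact: measurable_funTS.
have mDE : measurable_fun setT (fun x => D x * E x) by exact: measurable_funM.
rewrite Rintegral_dx1; last exact: measurable_funM.
rewrite Rintegral_circle_oc//; last by rewrite D01 E01.
have -> : \int[lam]_(x in `[0, 1]) (h x * g x) =
    \int[lam]_(x in `[0, 1]) (h x * g 0 + h x * \int[mu]_(y in `]0, x]) E y).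
  apply: eq_Rintegral => x; rewrite inE/= in_itv/= => /andP[x0 x1].
  by rewrite -gE// -mulrDr addrC subrK.
rewrite RintegralD//; first last.
- have [K gK] := gen_laplacian_bounded gk mg.
  apply: (@le_integrable _ _ _ lam _ _ _ (EFin \o (fun x => 2 * K * h x))) => //; last exact: integrable_EFinZ.
    apply: (@eq_measurable_fun _ _ _ _ _ (EFin \o (fun x => h x * (g x - g 0)))).
      by move=> x; rewrite inE/= in_itv/= => /andP[x0 x1]; rewrite /= gE.
    apply/measurable_EFinP; apply: measurable_funTS; apply: measurable_funM => //.
    exact: measurable_funB.
  move=> x /=; rewrite in_itv/= => /andP[x0 x1]; rewrite -gE// lee_fin !normrM mulrC.
  rewrite ler_wpM2r// normr_nat (le_trans (ler_normB _ _))//.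
  have := gK x; have := gK 0; have := ler_norm K; lra.
- have : lam.-integrable `[0, 1] (EFin \o (fun x => g 0 * h x)) by exact: integrable_EFinZ.
  by apply: eq_integrable => // x _ /=; rewrite mulrC.
rewrite RintegralZr// h0 mul0r add0r (stieltjes_parts ih mh mE EN).
have -> : \int[mu]_(y in `]0, 1]) (E y * \int[lam]_(x in `[y, 1]) h x) =
   \int[mu]_(y in `]0, 1]) (D 0 * E y - D y * E y).
  apply: eq_Rintegral => y; rewrite inE/= in_itv/= => /andP[y0 y1].
  rewrite (Dh y) ?(ltW y0)//.
  have : \int[lam]_(x in `[0, 1]) h x = \int[lam]_(x in `[0, y]) h x + \int[lam]_(x in `[y, 1]) h x.
    have ihy (a b : R) : 0 <= a -> b <= 1 -> lam.-integrable `[a, b] (EFin \o h).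
      move=> a0 b1; apply: integrableS ih => // z /=; rewrite !in_itv/= => /andP[az zb].
      by rewrite (le_trans a0 az) (le_trans zb b1).
    have E1 : (`[0, 1]%classic : set S) = `[0, y]%classic `|` `]y, 1]%classic.
      by apply: itv_bndbnd_setU; rewrite bnd_simp// ltW.
    rewrite E1 Rintegral_setU//.
    - rewrite [in LHS]Rintegral_itv_obnd_cbnd//.
      by apply: integrableS (ihy y 1 (ltW y0) (lexx _)) => // z /=; rewrite !in_itv/= => /andP[/ltW-> ->].
    - by rewrite -E1.
    - apply/disj_set2P; apply/seteqP; split => // z [/=].
      by rewrite !in_itv/= => /andP[_ zy] /andP[/lt_le_trans/(_ zy)]; rewrite ltxx.
  by rewrite h0 => e; rewrite -(addr0_eq (esym e)); ring.
rewrite RintegralB//; last 2 first.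
- by apply: integrable_EFinZ => //; exact: ibd EN.
- apply: (ibd _ (M * N)) => // x; rewrite normrM; apply: ler_pM => //.
rewrite RintegralZl//; last exact: ibd EN.
rewrite -gE ?lexx ?ler01// -[in X in X - _](add0r 1) gper subrr mulr0 add0r//.
Qed.

End integration_by_parts.

(** * Eigenvalues of L_W *)

Section eigenvectors.
Context {R : realType}.
Variable W : cumulative R R.
Local Notation mu := (lebesgue_stieltjes_measure W).
Local Notation lam := (@lebesgue_measure R).
Local Notation S := (measurableTypeR R).
Hypothesis Winc : forall x y : R, x < y -> W x < W y.
Hypothesis Wper : forall x : R, W (x + 1) - W x = W 1 - W 0.

Lemma dx1_setT : dx1 [set: S] = 1%E :> \bar R.
Proof.
rewrite /dx1 /circle_measure /= /mfrestr /mrestr setTI.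
have -> : lebesgue_stieltjes_measure idfun (`[0, 1[%classic : set S) = lam (`[0, 1[%classic : set S) by [].
by rewrite lebesgue_measure_itv/= lte_fin ltr01 oppr0 adde0.
Qed.

Lemma Rintegral_dx1_cst (c : R) : \int[dx1]_x c = c.
Proof. by rewrite Rintegral_cst// [X in fine X]dx1_setT mulr1. Qed.

Lemma gen_derive_cst (c : R) (x : R) : gen_derive W (cst c) x = 0.
Proof.
rewrite /gen_derive; under eq_fun do rewrite subrr mul0r.
by rewrite lim_cst//; exact: Rhausdorff.
Qed.

(** Needed because a slice of a product of eigenvectors is an eigenvector times a constant. *)
Lemma gen_laplacianZ (c : R) (f h : R -> R) :
  gen_laplacian W f h -> gen_laplacian W (fun x => c * f x) (fun x => c * h x).
Proof.
move=> fh; have [fper Lh h0 [a [b [intb fE]]]] := fh.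
have ih := Lfun_dx1_integrable Lh.
have ihx (x : R) : x <= 1 -> lam.-integrable `[0, x] (EFin \o h).
  move=> x1; apply: integrableS ih => //.
  by move=> z /=; rewrite !in_itv/= => /andP[-> /le_trans]; apply.
have [b' [M [mg gM _ _ _]]] := gen_laplacian_primitive fh.
(* The constant [k] is free: [b] serves in the vanishing integral and 0 in the formula for [f]. The
   [b'] of the bounded primitive comes from another existential and is not tied to [b], hence the
   shift by [k - b']. *)
have igo (k x : R) : 0 <= x -> x <= 1 ->
   mu.-integrable `]0, x] (EFin \o (fun y => k + \int[lam]_(z in `[0, y]) h z)).
  move=> x0 x1; apply: (@integrable_oc_bounded _ _ _ _ (`|k - b'| + M)) => //.
    have -> : (fun y => k + \int[lam]_(z in `[0, y]) h z) =
       (fun y => (k - b') + (b' + \int[lam]_(z in `[0, y]) h z)).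
      by apply/funext => y; ring.
    apply: measurable_funD => //; apply: measurable_funS mg => //.
    by move=> z /=; rewrite !in_itv/= => /andP[/ltW-> /le_trans]; apply.
  move=> z /andP[z0 zx].
  have -> : k + \int[lam]_(z in `[0, z]) h z = (k - b') + (b' + \int[lam]_(z in `[0, z]) h z) by ring.
  rewrite (le_trans (ler_normD _ _))// lerD2l gM// (ltW z0)/= (le_trans zx)//.
have mo1 (x : R) : measurable (`]0, x]%classic : set S) by exact: measurable_ocitv.
split.
- by move=> x; rewrite fper.
- exact: Lfun2Z.
- by rewrite RintegralZl// h0 mulr0.
- have EZ (x : R) : x <= 1 -> \int[lam]_(z in `[0, x]) (c * h z) = c * \int[lam]_(z in `[0, x]) h z.
    by move=> x1; rewrite RintegralZl//; exact: ihx.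
  exists (c * a), (c * b); split.
    rewrite -[RHS](mulr0 c) -[in RHS]intb -RintegralZl//; last exact: igo.
    by apply: eq_Rintegral => y; rewrite inE/= in_itv/= => /andP[_ y1]; rewrite EZ//; ring.
  move=> x /andP[x0 x1]; rewrite fE ?x0// !mulrDr !mulrA; congr (_ + _).
  rewrite -RintegralZl//; last first.
    by have := igo 0 _ x0 (ltW x1); apply: eq_integrable => // z _; rewrite /= add0r.
  apply: eq_Rintegral => y; rewrite inE/= in_itv/= => /andP[_ yx]; rewrite EZ//.
  exact: le_trans (ltW x1).
Qed.

Variables (phi : R -> R) (lambda : R).
Hypothesis Lphi : phi \in Lfun (@dx1 R) 2%:E.
Hypothesis phi1 : \int[dx1]_x (phi x ^+ 2) = 1.
Hypothesis phiE : gen_laplacian W phi (fun x => lambda * phi x).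

Let mphi : measurable_fun setT phi. Proof. exact: Lfun2_measurable Lphi. Qed.

Lemma eigenvalueE : \int[circle_measure W]_x (gen_derive W phi x * gen_derive W phi x) = - lambda.
Proof.
have := gen_laplacian_parts Winc Wper phiE mphi phiE mphi.
have -> : \int[dx1]_x (lambda * phi x * phi x) = lambda.
  under eq_Rintegral do rewrite -mulrA.
  rewrite RintegralZl//; first by rewrite phi1 mulr1.
  exact: Lfun2_integrable_mul.
lra.
Qed.

Lemma eigenvalue_le0 : lambda <= 0.
Proof.
have : 0 <= \int[circle_measure W]_x (gen_derive W phi x * gen_derive W phi x).
  by apply: Rintegral_ge0 => x _; exact: sqr_ge0.
by rewrite eigenvalueE; lra.
Qed.

(** Cauchy-Schwarz in L^2(dW) for the derivative against the indicator of []0, y]]: the first has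
    squared norm [- lambda], the second [W y - W 0]. *)
Lemma increment_sqr_le (y : R) : 0 <= y < 1 -> (phi y - phi 0) ^+ 2 <= (W 1 - W 0) * - lambda.
Proof.
move=> /andP[y0 y1].
have [mD [M DM] _ D01 [_ fD]] := gen_laplacian_derive Winc Wper phiE mphi.
set D := gen_derive W phi in mD DM D01 fD *.
have moy : measurable (`]0, y]%classic : set S) by exact: measurable_ocitv.
have LD : D \in Lfun (circle_measure W) 2%:E.
  exact: (@Lfun2_bounded _ S R (circle_measure W) D M mD DM).
have L1 : (\1_(`]0, y]%classic : set S) : S -> R) \in Lfun (circle_measure W) 2%:E.
  apply: (@Lfun2_bounded _ _ _ _ _ 1) => // x.
  by rewrite indicE; case: (_ \in _); rewrite ?normr1// normr0 ler01.
have circ1 : circle_measure W (`]0, y]%classic : set S) = (W y - W 0)%:E.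
  rewrite /circle_measure /= /mfrestr /mrestr setIidl; first exact: stieltjes_oc.
  by move=> z /=; rewrite !in_itv/= => /andP[/ltW-> /le_lt_trans]; apply.
have e1 : phi y - phi 0 = \int[circle_measure W]_x (D x * \1_(`]0, y]%classic : set S) x).
  rewrite fD ?lexx ?(ltW y1)//.
  have -> : (fun x => D x * \1_(`]0, y]%classic : set S) x) = D \_ (`]0, y]%classic : set S).
    apply/funext => x; rewrite /patch indicE; case: (_ \in _); first by rewrite mulr1.
    by rewrite mulr0.
  rewrite -Rintegral_mkcond /Rintegral; congr fine.
  apply: eq_measure_integral => B mB By.
  rewrite /circle_measure /= /mfrestr /mrestr setIidl//.
  apply: (subset_trans By) => z /=; rewrite !in_itv/= => /andP[/ltW-> /le_lt_trans]; exact.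
have e2 : \int[circle_measure W]_x (\1_(`]0, y]%classic : set S) x * \1_(`]0, y]%classic : set S) x) = W y - W 0.
  rewrite (_ : (fun x => _) = \1_(`]0, y]%classic : set S)); last first.
    by apply/funext => x; rewrite indicE; case: (_ \in _); rewrite ?mulr1 ?mulr0.
  by rewrite /Rintegral integral_indic// setIT [X in fine X]circ1.
rewrite e1; apply: (le_trans (ip_CS LD L1)); rewrite e2 eigenvalueE mulrC.
apply: ler_wpM2r; first by have := eigenvalue_le0; lra.
by have := Winc y1; lra.
Qed.

(** Membership in the domain of L_W includes zero mean of the image, here [lambda * phi]. *)
Lemma eigenvector_mean : lambda != 0 -> \int[dx1]_x phi x = 0.
Proof.
move=> l0; have [_ Llphi + _] := phiE.
rewrite -Rintegral_dx1; last exact: Lfun2_measurable Llphi.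
rewrite RintegralZl//; last exact: Lfun2_integrable.
by move/eqP; rewrite mulf_eq0 (negbTE l0)/= => /eqP.
Qed.

(** As [phi] has norm one and mean zero, [phi - phi 0] has squared norm [1 + phi 0 ^+ 2], at least
    1; pointwise it is bounded through [increment_sqr_le], and the circle has length one. *)
Lemma eigenvalue_gap : lambda != 0 -> 1 <= (W 1 - W 0) * - lambda.
Proof.
move=> l0; have phi0 := eigenvector_mean l0.
have Lc : cst (- phi 0) \in Lfun (@dx1 R) 2%:E by exact: Lfun2_cst.
have L1 : cst 1 \in Lfun (@dx1 R) 2%:E by exact: Lfun2_cst.
have Ld := Lfun2_comb 1 Lphi Lc.
have e : \int[dx1]_x ((phi x - phi 0) ^+ 2) = 1 + phi 0 ^+ 2.
  transitivity (\int[dx1]_x ((1 * phi x + cst (- phi 0) x) * (1 * phi x + cst (- phi 0) x))).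
    by apply: eq_Rintegral => x _ /=; ring.
  have e1 : \int[dx1]_x (phi x * cst (- phi 0) x) = 0.
    by rewrite RintegralZr// ?phi0 ?mul0r//; exact: Lfun2_integrable.
  have e2 : \int[dx1]_x (cst (- phi 0) x * phi x) = 0 by rewrite ipC.
  rewrite ip_combl// !ip_combr// [X in _ + (_ * X + _)]e2 e1 [X in 1 * (1 * X + _)]phi1.
  by rewrite /= Rintegral_dx1_cst; ring.
apply: (@le_trans _ _ (1 + phi 0 ^+ 2)); first by rewrite lerDl sqr_ge0.
have md : measurable_fun setT (fun x => (phi x - phi 0) ^+ 2).
  by apply: measurable_funX; exact: measurable_funB.
rewrite -e -[leRHS]Rintegral_dx1_cst.
rewrite Rintegral_circle// Rintegral_circle//.
have mI : measurable (`[0, 1[%classic : set S) by exact: measurable_ocitv.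
apply: le_Rintegral => //.
- have := ((Lfun2P _ _).1 Ld).2.
  rewrite integrable_circle; last first.
    apply/measurable_EFinP; apply: measurable_funX; apply: measurable_funD => //.
    exact: measurable_funM.
  by apply: eq_integrable => // x _ /=; rewrite mul1r.
- have mc : measurable_fun [set: S] (EFin \o cst ((W 1 - W 0) * - lambda)).
    by apply/measurable_EFinP; exact: measurable_cst.
  apply: (integrable_circle _ mc).1; exact: finite_measure_integrable_cst.
- by move=> x /=; rewrite in_itv/=; exact: increment_sqr_le.
Qed.

Lemma eigenvector_cst : lambda = 0 -> phi = cst (phi 0).
Proof.
move=> l0; have [fper _ _ _] := phiE.
apply/funext => x; rewrite -(subrK (Num.floor x)%:~R x) (periodic_int fper).
have y01 : 0 <= x - (Num.floor x)%:~R < 1.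
  by have := floor_itv x; rewrite intrD; lra.
have := increment_sqr_le y01; rewrite l0 oppr0 mulr0 => h.
by have /eqP : (phi (x - (Num.floor x)%:~R) - phi 0) ^+ 2 = 0;
  [apply/eqP; rewrite eq_le h sqr_ge0|rewrite sqrf_eq0 subr_eq0 => /eqP].
Qed.

End eigenvectors.

(** * Product measures and products of one-variable functions *)

Section product_measure_step.
Context {R : realType}.
Local Notation S := (measurableTypeR R).
Local Notation fm := {finite_measure set S -> \bar R}.

Variables (n : nat) (m : 'I_n.+1 -> fm).
Let m0 := m ord0.
Let m' := product_measure (fun k => m (lift ord0 k)).

Lemma ge0_integral_product_measureS (F : n.+1.-tuple S -> \bar R) :
  measurable_fun setT F -> (forall x, 0 <= F x)%E ->
  (\int[product_measure m]_x F x = \int[(m0 \x m')%E]_p F (tcons p))%E.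
Proof.
move=> mF F0; rewrite -[RHS](@ge0_integral_pushforward _ _ _ _ _ (@tcons R n) _ (m0 \x m')%E setT F) //.
exact: measurable_tcons.
Qed.

Lemma integrable_product_measureS (F : n.+1.-tuple S -> \bar R) : measurable_fun setT F ->
  (product_measure m).-integrable setT F <-> (m0 \x m')%E.-integrable setT (F \o @tcons R n).
Proof.
move=> mF; have mFt : measurable_fun setT (F \o @tcons R n).
  by apply: measurableT_comp => //; exact: measurable_tcons.
have e : (\int[product_measure m]_x `|F x| = \int[(m0 \x m')%E]_p `|F (tcons p)|)%E.
  by rewrite (@ge0_integral_product_measureS (abse \o F))//; [exact: measurableT_comp|move=> x; exact: abse_ge0].
by split=> /integrableP[_ Foo]; apply/integrableP; split => //; [rewrite -e|rewrite e].
Qed.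

Lemma integral_product_measureS (F : n.+1.-tuple S -> \bar R) : measurable_fun setT F ->
  (\int[product_measure m]_x F x = \int[(m0 \x m')%E]_p F (tcons p))%E.
Proof.
move=> mF; rewrite integralE [RHS]integralE.
congr (_ - _)%E.
  rewrite (@ge0_integral_product_measureS (F^\+)%E (measurable_funepos mF) (funepos_ge0 F)).
  by apply: eq_integral => p _; rewrite !funeposE.
rewrite (@ge0_integral_product_measureS (F^\-)%E (measurable_funeneg mF) (funeneg_ge0 F)).
by apply: eq_integral => p _; rewrite !funenegE.
Qed.

End product_measure_step.

Section tensor_product.
Context {R : realType}.
Local Notation S := (measurableTypeR R).
Local Notation fm := {finite_measure set S -> \bar R}.

Lemma tnth_tcons0 n (p : S * n.-tuple S) : tnth (tcons p) ord0 = p.1.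
Proof. by []. Qed.

Lemma tnth_tcons_lift n (p : S * n.-tuple S) (k : 'I_n) :
  tnth (tcons p) (lift ord0 k) = tnth p.2 k.
Proof. exact: tnthS. Qed.

Lemma tensor_tcons n (u : 'I_n.+1 -> S -> R) (p : S * n.-tuple S) :
  \prod_k u k (tnth (tcons p) k) = u ord0 p.1 * \prod_k u (lift ord0 k) (tnth p.2 k).
Proof.
rewrite big_ord_recl tnth_tcons0; congr (_ * _); apply: eq_bigr => k _.
by rewrite tnth_tcons_lift.
Qed.

Lemma measurable_tensor n (u : 'I_n -> S -> R) : (forall k, measurable_fun setT (u k)) ->
  measurable_fun setT (fun x : n.-tuple S => \prod_k u k (tnth x k)).
Proof.
move=> mu'; apply: measurable_prod => k _.
by apply: (measurableT_comp (mu' k)); exact: measurable_tnth.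
Qed.

(** One induction for both claims: splitting off a factor by Fubini needs the integrability of the
    product of the others. *)
Lemma integrable_Rintegral_prod n (m : 'I_n -> fm) (u : 'I_n -> S -> R) :
  (forall k, (m k).-integrable setT (EFin \o u k)) ->
  (product_measure m).-integrable setT (EFin \o (fun x => \prod_k u k (tnth x k))) /\
  \int[product_measure m]_x (\prod_k u k (tnth x k)) = \prod_k \int[m k]_t u k t.
Proof.
elim: n m u => [|n ih] m u iu.
  under eq_fun do rewrite big_ord0; split.
    exact: finite_measure_integrable_cst.
  rewrite big_ord0 Rintegral_cst//= mul1r.
  by rewrite indicT.
have mu' k : measurable_fun setT (u k).
  by have := measurable_int _ (iu k); move/measurable_EFinP.
have mP : measurable_fun setT (EFin \o (fun x : n.+1.-tuple S => \prod_k u k (tnth x k))).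
  by apply/measurable_EFinP; exact: measurable_tensor.
have [ii e] := ih (fun k => m (lift ord0 k)) (fun k => u (lift ord0 k)) (fun k => iu (lift ord0 k)).
have E : (fun x : n.+1.-tuple S => \prod_k u k (tnth x k)) \o @tcons R n =
    fun p => u ord0 p.1 * \prod_k u (lift ord0 k) (tnth p.2 k).
  by apply/funext => p; exact: tensor_tcons.
split.
  apply/integrable_product_measureS => //; rewrite -compA E.
  exact: (integrable_tensor (iu ord0) ii).
rewrite big_ord_recl -e -(Rintegral_tensor (iu ord0) ii).
rewrite /Rintegral integral_product_measureS//.
by congr fine; apply: eq_integral => p _; rewrite tensor_tcons.
Qed.

Lemma product_measure_coord_ae n (m : 'I_n -> fm) (k : 'I_n) (B : set S) :
  measurable B -> m k (~` B) = 0%E -> {ae product_measure m, forall x, B (tnth x k)}.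
Proof.
move=> mB mkB; pose u j : S -> R := if j == k then \1_(~` B) else cst 1.
have mCB : measurable (~` B) by exact: measurableC.
have iu j : (m j).-integrable setT (EFin \o u j).
  rewrite /u; case: ifP => _; last exact: finite_measure_integrable_cst.
  apply: Lfun2_integrable; apply: (@Lfun2_bounded _ _ _ _ _ 1) => // x.
  by rewrite indicE; case: (_ \in _); rewrite ?normr1// normr0 ler01.
have [ii e] := integrable_Rintegral_prod iu.
have u0 x : \prod_j u j (tnth x j) = \1_(~` B) (tnth x k).
  by rewrite (bigD1 k)//= big1 ?mulr1 /u ?eqxx// => j /negbTE ->.
have e0 : \prod_j \int[m j]_t u j t = 0.
  rewrite (bigD1 k)//= {1}/u eqxx.
  by rewrite [X in X * _](_ : _ = 0) ?mul0r// /Rintegral integral_indic// setIT [X in fine X]mkB.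
have : (\int[product_measure m]_x `|(\prod_j u j (tnth x j))%:E| = 0)%E.
  under eq_integral do rewrite gee0_abs ?lee_fin ?u0//.
  under eq_integral do rewrite -u0.
  by rewrite -[LHS]fineK ?[fine _]e ?e0//; exact: integrable_fin_num ii.
move/(ae_eq_integral_abs _ measurableT (measurable_int _ ii)).1.
apply: filterS => x /(_ I) /= []; rewrite u0 indicE => h.
apply/not_notP => nB; move: h; rewrite mem_set// => /eqP; rewrite oner_eq0//.
Qed.

End tensor_product.

(** * Fubini along one coordinate *)

Section coordinate_fubini.
Context {R : realType}.
Local Notation S := (measurableTypeR R).
Local Notation fm := {finite_measure set S -> \bar R}.

(** The tuple inside [slice], named so that [slice f x i t] folds to [f (set_coord i t x)]. *)
Definition set_coord n (i : 'I_n) (t : S) (x : n.-tuple S) : n.-tuple S :=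
  [tuple if k == i then t else tnth x k | k < n].

Lemma tnth_set_coord n (i k : 'I_n) t x :
  tnth (set_coord i t x) k = if k == i then t else tnth x k.
Proof. by rewrite tnth_mktuple. Qed.

Lemma measurable_set_coord n (i : 'I_n) :
  measurable_fun setT (fun p : n.-tuple S * S => set_coord i p.2 p.1).
Proof.
apply/measurable_fun_tnthP => k.
rewrite (_ : _ \o _ = fun p : n.-tuple S * S => if k == i then p.2 else tnth p.1 k); last first.
  by apply/funext => p /=; rewrite tnth_set_coord.
have [_|_] := eqVneq k i; first exact: measurable_snd.
exact: (measurableT_comp (measurable_tnth k) measurable_fst).
Qed.

Lemma set_coord_tcons0 n t (p : S * n.-tuple S) : set_coord ord0 t (tcons p) = tcons (t, p.2).
Proof.
apply: eq_from_tnth => k; rewrite tnth_set_coord.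
case: (unliftP ord0 k) => [j|] ->; last by rewrite eqxx tnth_tcons0.
by rewrite !tnth_tcons_lift eq_sym (negbTE (neq_lift _ _)).
Qed.

Lemma set_coord_tcons_lift n (j : 'I_n) t (p : S * n.-tuple S) :
  set_coord (lift ord0 j) t (tcons p) = tcons (p.1, set_coord j t p.2).
Proof.
apply: eq_from_tnth => k; rewrite tnth_set_coord.
case: (unliftP ord0 k) => [l|] ->; last by rewrite !tnth_tcons0 (negbTE (neq_lift _ _)).
by rewrite !tnth_tcons_lift (inj_eq lift_inj) tnth_set_coord.
Qed.

(* The mass at 0 in slot i makes the outer integral independent of x_i. *)
Definition drop_coord n (m : 'I_n -> fm) (i : 'I_n) (k : 'I_n) : fm :=
  if k == i then (dirac (0 : S) : fm) else m k.

Lemma drop_coord0 n (m : 'I_n.+1 -> fm) :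
  (fun k => drop_coord m ord0 (lift ord0 k)) = (fun k => m (lift ord0 k)).
Proof. by apply/funext => k; rewrite /drop_coord eq_sym (negbTE (neq_lift _ _)). Qed.

Lemma drop_coord_lift n (m : 'I_n.+1 -> fm) (j : 'I_n) :
  (fun k => drop_coord m (lift ord0 j) (lift ord0 k)) = drop_coord (fun k => m (lift ord0 k)) j.
Proof. by apply/funext => k; rewrite /drop_coord (inj_eq lift_inj). Qed.

Lemma measurable_coord_integral n (mi : fm) (i : 'I_n) (F : n.-tuple S -> \bar R) :
  measurable_fun setT F -> (forall x, 0 <= F x)%E ->
  measurable_fun setT (fun x => \int[mi]_t F (set_coord i t x))%E.
Proof.
move=> mF F0.
apply: (@measurable_fun_fubini_tonelli_F _ _ (n.-tuple S) S R mi (fun p => F (set_coord i p.2 p.1))).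
  by apply: (measurableT_comp mF); exact: measurable_set_coord.
by move=> p; exact: F0.
Qed.

(** A later coordinate is handled by induction under the integral in the first variable. For the
    first coordinate Tonelli is applied with that variable inside; on the other side the Dirac mass
    evaluates an integrand that [set_coord] has made independent of it. *)
Lemma coordinate_tonelli n (m : 'I_n -> fm) (i : 'I_n) (F : n.-tuple S -> \bar R) :
  measurable_fun setT F -> (forall x, 0 <= F x)%E ->
  (\int[product_measure m]_x F x =
   \int[product_measure (drop_coord m i)]_x \int[m i]_t F (set_coord i t x))%E.
Proof.
elim: n m i F => [|n ih] m i F mF F0; first by case: i.
have mFt : measurable_fun setT (F \o @tcons R n).
  by apply: measurableT_comp => //; exact: measurable_tcons.
have mFs (s : S) : measurable_fun setT (fun y => F (tcons (s, y))).
  exact: (measurableT_comp mFt (pair1_measurable s)).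
pose K x := (\int[m i]_t F (set_coord i t x))%E.
have mK : measurable_fun setT K by exact: measurable_coord_integral.
have K0 x : (0 <= K x)%E by exact: integral_ge0.
have mKt : measurable_fun setT (K \o @tcons R n).
  by apply: measurableT_comp => //; exact: measurable_tcons.
rewrite ge0_integral_product_measureS// (@ge0_integral_product_measureS _ _ _ K)//.
case: (unliftP ord0 i) @K mK K0 mKt => [j|] -> K mK K0 mKt.
  rewrite drop_coord_lift (_ : drop_coord m (lift ord0 j) ord0 = m ord0); last first.
    by rewrite /drop_coord (negbTE (neq_lift _ _)).
  rewrite [LHS](fubini_tonelli1 (F \o @tcons R n) mFt (fun p => F0 _)).
  rewrite [RHS](fubini_tonelli1 (K \o @tcons R n) mKt (fun p => K0 _)).
  apply: eq_integral => s _; rewrite /fubini_F/= (ih _ j)//.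
  apply: eq_integral => y _; apply: eq_integral => t _.
  by rewrite set_coord_tcons_lift.
rewrite drop_coord0 (_ : drop_coord m ord0 ord0 = (dirac (0 : S) : fm)); last first.
  by rewrite /drop_coord eqxx.
rewrite [LHS](fubini_tonelli2 (F \o @tcons R n) mFt (fun p => F0 _)).
rewrite [RHS](fubini_tonelli2 (K \o @tcons R n) mKt (fun p => K0 _)).
apply: eq_integral => y _; rewrite /fubini_G/= integral_dirac//; last first.
  exact: (measurableT_comp mKt (pair2_measurable y)).
rewrite diracT mul1e; apply: eq_integral => t _.
by rewrite set_coord_tcons0.
Qed.

Lemma coordinate_fubini n (m : 'I_n -> fm) (i : 'I_n) (F : n.-tuple S -> \bar R) :
  (product_measure m).-integrable setT F ->
  (\int[product_measure m]_x F x =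
   \int[product_measure (drop_coord m i)]_x \int[m i]_t F (set_coord i t x))%E.
Proof.
move=> /[dup] iF /integrableP[mF Foo].
have ip := integrable_funepos measurableT iF.
have iN := integrable_funeneg measurableT iF.
have iK (G : n.-tuple S -> \bar R) : (forall x, 0 <= G x)%E -> (product_measure m).-integrable setT G ->
    (product_measure (drop_coord m i)).-integrable setT (fun x => \int[m i]_t G (set_coord i t x))%E.
  move=> G0 /integrableP[mG Goo]; apply/integrableP; split.
    exact: measurable_coord_integral.
  under eq_integral do rewrite gee0_abs ?integral_ge0//.
  rewrite -coordinate_tonelli//.
  by move: Goo; under eq_integral do rewrite gee0_abs ?G0//.
rewrite integralE (coordinate_tonelli _ i (measurable_funepos mF) (funepos_ge0 F)).
rewrite (coordinate_tonelli _ i (measurable_funeneg mF) (funeneg_ge0 F)).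
rewrite -integralB//; last 2 first.
- exact: (iK _ (funepos_ge0 F)).
- exact: (iK _ (funeneg_ge0 F)).
apply: eq_integral => x _; rewrite [RHS]integralE.
by congr (_ - _)%E; apply: eq_integral => t _; rewrite ?funeposE ?funenegE.
Qed.

End coordinate_fubini.

(** * Completeness of products of complete systems *)

Lemma ae_countable (d : measure_display) (T : measurableType d) (R : realType)
  (mu : {measure set T -> \bar R}) (I : Type) (A : set I) (P : I -> T -> Prop) :
  countable A -> (forall i, A i -> {ae mu, forall x, P i x}) ->
  {ae mu, forall x, forall i, A i -> P i x}.
Proof.
move=> /countable_injP[f finj] AP.
suff : {ae mu, forall x, forall n i, A i -> f i = n -> P i x}.
  by apply: filterS => x h i Ai; exact: h Ai erefl.
apply: ae_foralln => n.
have [[i [Ai fi]]|nA] := pselect (exists i, A i /\ f i = n).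
  apply: filterS (AP _ Ai) => x Pix j Aj fj.
  by rewrite (finj j i) ?inE// fi fj.
by apply: filterE => x i Ai fi; exfalso; apply: nA; exists i.
Qed.

Section tensor_completeness.
Context {R : realType}.
Local Notation S := (measurableTypeR R).
Local Notation fm := {finite_measure set S -> \bar R}.

Lemma Lfun2_tensor n (m : 'I_n -> fm) (u : 'I_n -> S -> R) :
  (forall k, u k \in Lfun (m k) 2%:E) ->
  (fun x => \prod_k u k (tnth x k)) \in Lfun (product_measure m) 2%:E.
Proof.
move=> Lu; apply/Lfun2P; split.
  by apply: measurable_tensor => k; exact: Lfun2_measurable (Lu k).
have [+ _] := integrable_Rintegral_prod (fun k => ((Lfun2P _ _).1 (Lu k)).2).
by apply: eq_integrable => // x _ /=; rewrite prodrXl.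
Qed.

Section step.
Variables (n : nat) (m : 'I_n.+1 -> fm).
Let m0 := m ord0.
Let m' := product_measure (fun k => m (lift ord0 k)).
Variable g : n.+1.-tuple S -> R.
Hypothesis Lg : g \in Lfun (product_measure m) 2%:E.

Let mg : measurable_fun setT g. Proof. exact: Lfun2_measurable Lg. Qed.

Lemma integrable_tcons (F : n.+1.-tuple S -> R) :
  (product_measure m).-integrable setT (EFin \o F) ->
  (m0 \x m')%E.-integrable setT (fun p => (F (tcons p))%:E).
Proof.
move=> iF; have := (@integrable_product_measureS _ _ m (EFin \o F) (measurable_int _ iF)).1 iF.
exact.
Qed.

Lemma measurable_section y : measurable_fun setT (fun t : S => g (tcons (t, y))).
Proof.
apply: (measurableT_comp mg); apply: (measurableT_comp (@measurable_tcons R n)).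
exact: pair2_measurable.
Qed.

Lemma section_Lfun2_ae :
  {ae m', forall y, (fun t => g (tcons (t, y))) \in Lfun m0 2%:E}.
Proof.
have := integrable_tcons ((Lfun2P _ _).1 Lg).2 => /ae_integrable2.
apply: filterS => y iy; apply/Lfun2P; split; first exact: measurable_section.
exact: iy.
Qed.

Variable phi : S -> R.
Hypothesis Lphi : phi \in Lfun m0 2%:E.

Definition partial_coefficient y := \int[m0]_t (phi t * g (tcons (t, y))).

Let phi_first : (fun x : n.+1.-tuple S => phi (tnth x ord0)) \in Lfun (product_measure m) 2%:E.
Proof.
pose u (k : 'I_n.+1) : S -> R := if k == ord0 then phi else cst 1.
have Lu (k : 'I_n.+1) : u k \in Lfun (m k) 2%:E.
  by rewrite /u; case: eqP => [->//|_]; exact: Lfun2_cst.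
have := Lfun2_tensor Lu; rewrite (_ : (fun x => _) = fun x => phi (tnth x ord0))//.
by apply/funext => x; rewrite big_ord_recl {1}/u eqxx big1 ?mulr1.
Qed.

(** Cauchy-Schwarz on almost every section bounds the squared coefficient by the squared norm of
    [phi] times that of the section, which is integrable in [y]. *)
Lemma partial_coefficient_Lfun2 : partial_coefficient \in Lfun m' 2%:E.
Proof.
have ipg := integrable_tcons (Lfun2_integrable_mul phi_first Lg).
have mc : measurable_fun setT partial_coefficient.
  by apply: (measurableT_comp (fine_measurable measurableT)); exact: (measurable_fubini_G ipg).
apply/Lfun2P; split => //; apply/integrableP; split.
  by apply/measurable_EFinP; exact: measurable_funX.
have ig2 := integrable_tcons ((Lfun2P _ _).1 Lg).2.
pose K := \int[m0]_t (phi t * phi t).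
have K0 : 0 <= K by exact: ip_ge0.
have mg2 := measurable_fubini_G ig2.
have G20 y : (0 <= fubini_G m0 (fun p => (g (tcons p) ^+ 2)%:E) y)%E.
  by apply: integral_ge0 => t _; rewrite lee_fin sqr_ge0.
apply: (@le_lt_trans _ _ (\int[m']_y (K%:E * fubini_G m0 (fun p => (g (tcons p) ^+ 2)%:E) y))%E).
  apply: ae_ge0_le_integral => //.
  - by apply: measurableT_comp => //; apply/measurable_EFinP; exact: measurable_funX.
  - by move=> y _; rewrite mule_ge0.
  - exact: measurable_funeM.
  - apply: filterS section_Lfun2_ae => y Ly _.
    rewrite gee0_abs ?lee_fin ?sqr_ge0//.
    rewrite -[X in (_ * X)%E]fineK; last first.
      exact: integrable_fin_num ((Lfun2P _ _).1 Ly).2.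
    by rewrite -EFinM lee_fin; exact: ip_CS.
rewrite ge0_integralZl//.
rewrite (integral21_prod_meas1 ig2).
by rewrite lte_mul_pinfty ?lee_fin//; exact: integrable_lty ig2.
Qed.

Lemma partial_coefficient_tensor (u : 'I_n -> S -> R) :
  (forall k, u k \in Lfun (m (lift ord0 k)) 2%:E) ->
  \int[m']_y ((\prod_k u k (tnth y k)) * partial_coefficient y) =
  \int[product_measure m]_x ((phi (tnth x ord0) * \prod_k u k (tnth x (lift ord0 k))) * g x).
Proof.
move=> Lu.
pose v (k : 'I_n.+1) : S -> R := if unlift ord0 k is Some j then u j else phi.
have Lv (k : 'I_n.+1) : v k \in Lfun (m k) 2%:E.
  by rewrite /v; case: (unliftP ord0 k) => [j|] ->.
have vE x : \prod_k v k (tnth x k) = phi (tnth x ord0) * \prod_k u k (tnth x (lift ord0 k)).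
  rewrite big_ord_recl {1}/v unlift_none; congr (_ * _).
  by apply: eq_bigr => k _; rewrite /v liftK.
have iv : (product_measure m).-integrable setT
    (EFin \o (fun x => (phi (tnth x ord0) * \prod_k u k (tnth x (lift ord0 k))) * g x)).
  have := Lfun2_integrable_mul (Lfun2_tensor Lv) Lg.
  by apply: eq_integrable => // x _ /=; rewrite vE.
have ivt := integrable_tcons iv.
rewrite /Rintegral (integral_product_measureS _ (measurable_int _ iv)).
rewrite -(integral21_prod_meas1 ivt); congr fine.
apply: ae_eq_integral => //.
- apply/measurable_EFinP; apply: measurable_funM.
    by apply: measurable_tensor => k; exact: Lfun2_measurable (Lu k).
  exact: Lfun2_measurable partial_coefficient_Lfun2.
- exact: (measurable_fubini_G ivt).
- apply: filterS section_Lfun2_ae => y Ly _.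
  rewrite EFinM /partial_coefficient /Rintegral fineK; last first.
    exact: integrable_fin_num (Lfun2_integrable_mul Lphi Ly).
  rewrite -integralZl//; last exact: Lfun2_integrable_mul Lphi Ly.
  apply: eq_integral => t _; rewrite -EFinM; congr EFin.
  rewrite tnth_tcons0; under [in RHS]eq_bigr do rewrite tnth_tcons_lift.
  by ring.
Qed.

End step.

(** Induction on the number of factors. For each [phi] of the first system, the coefficient of the
    sections of [g] along [phi] is orthogonal to all products of the remaining factors, hence
    vanishes almost everywhere. Almost every section is then orthogonal to the whole first system,
    hence null, and the squared norm of [g] is the integral of those of its sections. *)
Lemma tensor_complete n (m : 'I_n -> fm) (A : 'I_n -> set (S -> R)) :
  (forall k, countable (A k)) -> (forall k f, A k f -> f \in Lfun (m k) 2%:E) ->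
  (forall k g, g \in Lfun (m k) 2%:E -> (forall f, A k f -> \int[m k]_t (f t * g t) = 0) ->
     g = cst 0 %[ae m k]) ->
  forall g, g \in Lfun (product_measure m) 2%:E ->
    (forall phi : 'I_n -> S -> R, (forall k, A k (phi k)) ->
       \int[product_measure m]_x ((\prod_k phi k (tnth x k)) * g x) = 0) ->
    g = cst 0 %[ae product_measure m].
Proof.
elim: n m A => [|n ih] m A cA LA compA g Lg gA.
  apply: filterE => x _ /=.
  have := gA (fun _ _ => 1) (fun k => match k with Ordinal _ h => False_ind _ (notF h) end).
  rewrite [X in X = _ -> _](_ : _ = \int[product_measure m]_x cst (g [tuple]) x); last first.
    by apply: eq_Rintegral => y _; rewrite big_ord0 mul1r (tuple0 y).
  rewrite Rintegral_cst//= indicT/= mulr1 (tuple0 x); exact.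
pose m' := product_measure (fun k => m (lift ord0 k)).
have coef0 phi : A ord0 phi -> {ae m', forall y, partial_coefficient m g phi y = 0}.
  move=> Aphi; have Lphi := LA _ _ Aphi.
  have := @ih (fun k => m (lift ord0 k)) (fun k => A (lift ord0 k)) (fun k => cA _)
    (fun k => LA _) (fun k => compA _) _ (partial_coefficient_Lfun2 Lg Lphi).
  move=> /(_ _)/wrap[psi Apsi|]; last by apply: filterS => y /(_ I).
  rewrite partial_coefficient_tensor//; last by move=> k; exact: LA.
  pose v (k : 'I_n.+1) : S -> R := if unlift ord0 k is Some j then psi j else phi.
  rewrite -[RHS](gA v); last by move=> k; rewrite /v; case: (unliftP ord0 k) => [j|] ->.
  apply: eq_Rintegral => x _; congr (_ * _).
  rewrite big_ord_recl {1}/v unlift_none; congr (_ * _).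
  by apply: eq_bigr => k _; rewrite /v liftK.
have sec0 : {ae m', forall y, \int[m ord0]_t (g (tcons (t, y)) ^+ 2)%:E = 0}%E.
  (* The exceptional null set of [coef0] depends on [phi]; countability of the system gives a common
     one. *)
  have := ae_countable (cA ord0) coef0.
  apply: filterS2 (section_Lfun2_ae Lg) => y Ly cy.
  have := compA _ _ Ly cy => h.
  have e0 : (\int[m ord0]_t (0 : \bar R) = 0)%E by rewrite integral0.
  rewrite -[RHS]e0; apply: ae_eq_integral => //.
    apply/measurable_EFinP; apply: measurable_funX; exact: Lfun2_measurable Ly.
  by apply: filterS h => t /(_ I) ->; rewrite expr0n.
apply: ip_self_eq0 => //.
have ig2 := ((Lfun2P _ _).1 Lg).2.
rewrite /Rintegral (integral_product_measureS _ (measurable_int _ ig2)).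
rewrite -(integral21_prod_meas1 (integrable_tcons ig2)).
rewrite (ae_eq_integral (cst 0%E))//= ?integral0//.
- exact: (measurable_fubini_G (integrable_tcons ig2)).
- by apply: filterS sec0 => y h _.
Qed.

End tensor_completeness.

(** * Limits and Cauchy-Schwarz for finite sums *)

Lemma cvg_sum_seq (R : realType) (T I : Type) (F : set_system T) (FF : Filter F)
  (s : seq I) (f : I -> T -> R) (l : I -> R) :
  (forall i, f i x @[x --> F] --> l i) ->
  \sum_(i <- s) f i x @[x --> F] --> \sum_(i <- s) l i.
Proof.
move=> fl; elim: s => [|i s ih].
  by under eq_fun do rewrite big_nil; rewrite big_nil; exact: cvg_cst.
by under eq_fun do rewrite big_cons; rewrite big_cons; exact: cvgD.
Qed.

Section append_ord.
Context {T : Type} {n m : nat}.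
Variables (a : 'I_n -> T) (b : 'I_m -> T).

Definition append_ord (j : 'I_(n + m)) : T :=
  match fintype.split j with inl k => a k | inr k => b k end.

Lemma append_ord_lshift j : append_ord (lshift m j) = a j.
Proof. by rewrite /append_ord (unsplitK (inl j)). Qed.

Lemma append_ord_rshift j : append_ord (rshift n j) = b j.
Proof. by rewrite /append_ord (unsplitK (inr j)). Qed.

Lemma append_ord_forall (P : T -> Prop) : (forall j, P (a j)) -> (forall j, P (b j)) ->
  forall j, P (append_ord j).
Proof. by move=> aP bP j; rewrite /append_ord; case: fintype.split. Qed.

End append_ord.

Lemma L2cvg_ae (disp : measure_display) (T : measurableType disp) (R : realType)
    (mu : {finite_measure set T -> \bar R}) (fs : nat -> T -> R) (f g : T -> R) :
  (forall n, fs n \in Lfun mu 2%:E) -> f \in Lfun mu 2%:E -> g \in Lfun mu 2%:E ->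
  f = g %[ae mu] -> L2cvg mu fs f -> L2cvg mu fs g.
Proof.
move=> Lfs Lf Lg fg; rewrite /L2cvg.
have e n : \int[mu]_x ((fs n x - f x) ^+ 2) = \int[mu]_x ((fs n x - g x) ^+ 2).
  have L1 := Lfun2B (Lfs n) Lf; have L2 := Lfun2B (Lfs n) Lg.
  congr fine; apply: ae_eq_integral => //.
  - by have := measurable_int _ ((Lfun2P _ _).1 L1).2.
  - by have := measurable_int _ ((Lfun2P _ _).1 L2).2.
  - by apply: filterS fg => x /= h /h ->.
by under eq_fun do rewrite e.
Qed.

Lemma cvg_le_lim (R : realType) (u v : nat -> R) (a b : R) :
  (forall n, u n <= v n) -> u @ \oo --> a -> v @ \oo --> b -> a <= b.
Proof.
move=> uv ua vb; rewrite -(cvg_lim (@Rhausdorff R) ua) -(cvg_lim (@Rhausdorff R) vb).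
by apply: ler_lim; [apply/cvg_ex; exists a|apply/cvg_ex; exists b|exact: nearW].
Qed.

Lemma approximate_riesz_cvg (R : realType) (V : lmodType R) (D : set V) (q : V -> V -> R)
    (l : V -> R) (v : nat -> V) :
  (forall n w, D w -> (q (v n) w - l w) ^+ 2 <= 4^-1 ^+ n * q w w) ->
  forall w, D w -> (fun n => q (v n) w) @ \oo --> l w.
Proof.
move=> vP w Dw.
have c0 : (fun n => 4^-1 ^+ n * q w w) @ \oo --> (0 : R).
  under eq_fun do rewrite mulrC.
  by apply: cvg_geometric; rewrite ger0_norm// invf_lt1// ltr1n.
apply: (cvg_dist_le _ (sqrt_cvg0 c0)) => n.
by rewrite -sqrtr_sqr ler_wsqrtr// vP.
Qed.

Section cauchy_schwarz_sum.
Context {R : realType}.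

(** Cauchy-Schwarz in a direct sum, free of square roots. The cross term obeys
    [(a b)^2 <= (A D)(C B)], whence [2|a b| <= A D + C B] by the inequality of arithmetic and
    geometric means. *)
Lemma cauchy_schwarz_add (a b A B C D : R) : 0 <= A -> 0 <= B -> 0 <= C -> 0 <= D ->
  a ^+ 2 <= A * B -> b ^+ 2 <= C * D -> (a + b) ^+ 2 <= (A + C) * (B + D).
Proof.
move=> A0 B0 C0 D0 aAB bCD.
have ab : (a * b) ^+ 2 <= (A * D) * (C * B).
  have -> : A * D * (C * B) = (A * B) * (C * D) by ring.
  by rewrite exprMn ler_pM// ?sqr_ge0.
have [AD CB] : 0 <= A * D /\ 0 <= C * B by split; exact: mulr_ge0.
have : `|a * b| *+ 2 <= A * D + C * B.
  rewrite -ler_sqr ?nnegrE ?mulrn_wge0// ?addr_ge0//.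
  have := sqr_ge0 (A * D - C * B).
  rewrite -(mulr_natr `|a * b|) exprMn real_normK ?num_real//; nra.
by have := ler_norm (a * b); nra.
Qed.

Lemma cauchy_schwarz_sum (I : Type) (s : seq I) (a A B : I -> R) :
  (forall i, 0 <= A i) -> (forall i, 0 <= B i) -> (forall i, a i ^+ 2 <= A i * B i) ->
  (\sum_(i <- s) a i) ^+ 2 <= (\sum_(i <- s) A i) * (\sum_(i <- s) B i).
Proof.
move=> A0 B0 aAB; elim: s => [|i s ih]; first by rewrite !big_nil expr0n mul0r.
by rewrite !big_cons; apply: cauchy_schwarz_add => //; exact: sumr_ge0.
Qed.

End cauchy_schwarz_sum.

(** * The span D_W and its Dirichlet form *)

Section span_of_eigenvectors.
Context {R : realType} {d : nat}.
Local Notation S := (measurableTypeR R).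
Local Notation X := (d.-tuple S).
Variables (W : 'I_d -> cumulative R R) (A : 'I_d -> set (R -> R)).
Hypothesis W_increasing : forall k x y, x < y -> W k x < W k y.
Hypothesis W_periodic : forall k x, W k (x + 1) - W k x = W k 1 - W k 0.
Hypothesis A_basis : forall k, orthonormal_eigenbasis (W k) (A k).
Local Notation DW := (in_DW A).
Implicit Types (i k : 'I_d) (u : R -> R) (phi psi : 'I_d -> R -> R).

Definition tensor phi (x : X) := \prod_k phi k (tnth x k).

Definition in_basis phi := forall k, A k (phi k).

(** The factors of the [i]-th derivative of [tensor phi], which is again a product and so is
    integrated factor by factor against [dxW]. *)
Definition diff_factor i phi k := if k == i then gen_derive (W i) (phi k) else phi k.

(** The default 0 matters only outside the basis, where there may be no eigenvalue. *)
Definition eigenvalue k u : R := xget 0 [set l | gen_laplacian (W k) u (fun x => l * u x)].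

Lemma basis_L2 k u : A k u -> u \in Lfun (@dx1 R) 2%:E.
Proof. by move=> Au; have [_ /(_ u Au)[]] := A_basis k. Qed.

Lemma basis_measurable k u : A k u -> measurable_fun setT u.
Proof. by move=> /basis_L2 /Lfun2_measurable. Qed.

Lemma basis_norm k u : A k u -> \int[dx1]_x (u x ^+ 2) = 1.
Proof. by move=> Au; have [_ _ /(_ u Au)] := A_basis k. Qed.

Lemma basis_eigen k u : A k u -> gen_laplacian (W k) u (fun x => eigenvalue k u * u x).
Proof.
move=> Au; have [_ /(_ u Au)[_ [_ [l lP]]] _ _ _] := A_basis k.
by have := @xgetPex _ 0 [set l | gen_laplacian (W k) u (fun x => l * u x)]; apply; exists l.
Qed.

Lemma basis_derive_L2 k u : A k u -> gen_derive (W k) u \in Lfun (circle_measure (W k)) 2%:E.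
Proof.
move=> Au.
have [mD [M DM] _ _ _] := gen_laplacian_derive (@W_increasing k) (@W_periodic k)
  (basis_eigen Au) (basis_measurable Au).
exact: (@Lfun2_bounded _ S R (circle_measure (W k)) _ M mD DM).
Qed.

Lemma tensor_L2 phi : in_basis phi -> tensor phi \in Lfun (@dx R d) 2%:E.
Proof. by move=> Bphi; apply: Lfun2_tensor => k; exact: basis_L2. Qed.

Lemma diff_factor_L2 i phi k : in_basis phi ->
  diff_factor i phi k \in Lfun (if k == i then circle_measure (W i) else dx1) 2%:E.
Proof.
move=> Bphi; rewrite /diff_factor; case: eqP => [->|_]; last exact: basis_L2 (Bphi k).
exact: basis_derive_L2.
Qed.

Lemma diff_tensor_L2 i phi : in_basis phi ->
  tensor (diff_factor i phi) \in Lfun (dxW W i) 2%:E.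
Proof. by move=> Bphi; apply: Lfun2_tensor => k; exact: diff_factor_L2. Qed.

Lemma tensor_set_coord i phi t (x : X) :
  tensor phi (set_coord i t x) = phi i t * \prod_(k | k != i) phi k (tnth x k).
Proof.
rewrite /tensor (bigD1 i)//= tnth_set_coord eqxx; congr (_ * _).
by apply: eq_bigr => k /negbTE ki; rewrite tnth_set_coord ki.
Qed.

Lemma set_coord_tnth i (x : X) : set_coord i (tnth x i) x = x.
Proof.
apply: eq_from_tnth => k; rewrite tnth_set_coord; case: eqP => [->//|//].
Qed.

Lemma diff_tensor_set_coord i phi t (x : X) :
  tensor (diff_factor i phi) (set_coord i t x) =
  gen_derive (W i) (phi i) t * \prod_(k | k != i) phi k (tnth x k).
Proof.
rewrite tensor_set_coord {1}/diff_factor eqxx; congr (_ * _).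
by apply: eq_bigr => k /negbTE ki; rewrite /diff_factor ki.
Qed.

(** [gen_derive] is a bare [lim], linear only where the quotients converge; for eigenvectors they
    converge at every point, so the formula holds everywhere and not just almost everywhere. *)
Lemma partial_W_sum i n (c : 'I_n -> R) (phi : 'I_n -> 'I_d -> R -> R) :
  (forall j, in_basis (phi j)) ->
  partial_W W i (fun x => \sum_j c j * tensor (phi j) x) =
  (fun x => \sum_j c j * tensor (diff_factor i (phi j)) x).
Proof.
move=> Bphi; apply/funext => x; rewrite /partial_W /gen_derive.
set f := slice _ _ _.
have fE t : f t = \sum_j (c j * \prod_(k | k != i) phi j k (tnth x k)) * phi j i t.
  rewrite /f /slice -/(set_coord i t x); apply: eq_bigr => j _.
  by rewrite tensor_set_coord; ring.
apply: cvg_lim; first exact: Rhausdorff.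
have -> : \sum_j c j * tensor (diff_factor i (phi j)) x =
    \sum_j (c j * \prod_(k | k != i) phi j k (tnth x k)) * gen_derive (W i) (phi j i) (tnth x i).
  by apply: eq_bigr => j _; rewrite -{1}(set_coord_tnth i x) diff_tensor_set_coord; ring.
have -> : (fun e => (f (tnth x i + e) - f (tnth x i)) / (W i (tnth x i + e) - W i (tnth x i))) =
  (fun e => \sum_j (c j * \prod_(k | k != i) phi j k (tnth x k)) *
     increment_quotient (W i) (phi j i) (tnth x i) e).
  apply/funext => e; rewrite !fE -sumrB mulr_suml; apply: eq_bigr => j _.
  by rewrite /increment_quotient; ring.
apply: cvg_sum_seq => j; apply: cvgM; first exact: cvg_cst.
by have [_ _ + _ _] := gen_laplacian_derive (@W_increasing i) (@W_periodic i)
  (basis_eigen (Bphi j i)) (basis_measurable (Bphi j i)); apply.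
Qed.

Lemma sum_append_ord a n m (c : 'I_n -> R) (e : 'I_m -> R) (phi : 'I_n -> 'I_d -> R -> R)
    (psi : 'I_m -> 'I_d -> R -> R) (F : ('I_d -> R -> R) -> X -> R) x :
  a * (\sum_j c j * F (phi j) x) + \sum_j e j * F (psi j) x =
  \sum_j append_ord (fun j => a * c j) e j * F (append_ord phi psi j) x.
Proof.
rewrite big_split_ord/= mulr_sumr; congr (_ + _); apply: eq_bigr => j _.
  by rewrite !append_ord_lshift mulrA.
by rewrite !append_ord_rshift.
Qed.

Lemma in_DW_comb a f g : DW f -> DW g -> DW (fun x => a * f x + g x).
Proof.
move=> [n [c [phi [Bphi ->]]]] [m [e [psi [Bpsi ->]]]].
exists (n + m)%N, (append_ord (fun j => a * c j) e), (append_ord phi psi); split.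
  exact: (append_ord_forall (P := in_basis)).
by apply/funext => x; rewrite (sum_append_ord a c e phi psi tensor).
Qed.

Lemma partial_W_comb i a f g : DW f -> DW g ->
  partial_W W i (fun x => a * f x + g x) =
  (fun x => a * partial_W W i f x + partial_W W i g x).
Proof.
move=> [n [c [phi [Bphi ->]]]] [m [e [psi [Bpsi ->]]]].
under [X in partial_W _ _ X]eq_fun do rewrite (sum_append_ord a c e phi psi tensor).
rewrite !partial_W_sum//; last exact: (append_ord_forall (P := in_basis)).
by apply/funext => x; rewrite (sum_append_ord a c e phi psi (fun chi => tensor (diff_factor i chi))).
Qed.

Lemma in_DW_tensor phi : in_basis phi -> DW (tensor phi).
Proof.
move=> Bphi; exists 1%N, (fun=> 1), (fun=> phi); split => //.
by apply/funext => x; rewrite big_ord1 mul1r.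
Qed.

Lemma partial_W_tensor i phi : in_basis phi ->
  partial_W W i (tensor phi) = tensor (diff_factor i phi).
Proof.
move=> Bphi.
have e : tensor phi = (fun x => \sum_(j < 1) (fun=> 1) j * tensor ((fun=> phi) j) x).
  by apply/funext => x; rewrite big_ord1 mul1r.
rewrite [in LHS]e partial_W_sum//.
by apply/funext => x; rewrite big_ord1 mul1r.
Qed.

Lemma in_DW_L2 f : DW f -> f \in Lfun (@dx R d) 2%:E.
Proof.
move=> [n [c [phi [Bphi ->]]]].
by apply: Lfun2_sum => j; exact: tensor_L2 (Bphi j).
Qed.

Lemma partial_W_L2 i f : DW f -> partial_W W i f \in Lfun (dxW W i) 2%:E.
Proof.
move=> [n [c [phi [Bphi ->]]]].
rewrite [X in X \in _](partial_W_sum i c Bphi).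
by apply: Lfun2_sum => j; exact: diff_tensor_L2 (Bphi j).
Qed.

Lemma basis_complete (g : X -> R) : g \in Lfun (@dx R d) 2%:E ->
  (forall phi, in_basis phi -> \int[dx]_x (tensor phi x * g x) = 0) ->
  g = cst 0 %[ae (@dx R d)].
Proof.
move=> Lg gA; apply: (@tensor_complete _ _ _ A) => //.
- by move=> k; have [] := A_basis k.
- by move=> k f; exact: basis_L2.
- by move=> k f; have [_ _ _ _] := A_basis k; apply.
Qed.

(** If no eigenvalue were 0, all basis elements would have zero mean; the constant 1 would be
    orthogonal to the basis, hence null by completeness. *)
Lemma basis_cst k : exists2 u, A k u & eigenvalue k u = 0.
Proof.
apply: contrapT => nA.
have n0 u : A k u -> eigenvalue k u != 0.
  by move=> Au; apply/eqP => e; apply: nA; exists u.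
have [_ _ _ _ comp] := A_basis k.
have c1 := comp (cst 1) (Lfun2_cst _ _).
have h : forall u, A k u -> \int[dx1]_x (u x * cst 1 x) = 0.
  move=> u Au; under eq_Rintegral do rewrite mulr1.
  exact: (eigenvector_mean (basis_L2 Au) (basis_eigen Au) (n0 _ Au)).
move/c1 : h => h.
have := @ae_eq_ip _ _ _ (@dx1 R) _ _ (cst 1) (Lfun2_cst _ 1) (Lfun2_cst _ 0) (Lfun2_cst _ 1) h.
by rewrite /= !mul1r mul0r !Rintegral_dx1_cst => /eqP; rewrite oner_eq0.
Qed.

(** Eigenvectors of eigenvalue 0, one in each coordinate, are constants; none of them vanishes,
    being of norm one, so their product can be rescaled to [c]. *)
Lemma in_DW_cst (c : R) : DW (cst c).
Proof.
have /choice[phi phiP] : forall k, exists u, A k u /\ eigenvalue k u = 0.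
  by move=> k; have [u] := basis_cst k; exists u.
have Bphi : in_basis phi by move=> k; case: (phiP k).
have cphi k : phi k = cst (phi k 0).
  apply: (eigenvector_cst (@W_increasing k) (@W_periodic k) (basis_L2 (Bphi k)) (basis_norm (Bphi k)) (basis_eigen (Bphi k))).
  by case: (phiP k).
have nphi : \prod_k phi k 0 != 0.
  apply/prodf_neq0 => k _; apply/eqP => e.
  have := basis_norm (Bphi k); rewrite cphi e.
  by under eq_Rintegral do rewrite expr0n/=; rewrite Rintegral_dx1_cst => /eqP; rewrite eq_sym oner_eq0.
(* The combination [-t + t] is the zero summand that [in_DW_comb] asks for. *)
have := in_DW_comb (c / \prod_k phi k 0) (in_DW_tensor Bphi) (in_DW_comb (-1) (in_DW_tensor Bphi) (in_DW_tensor Bphi)).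
congr (DW _); apply/funext => x; rewrite mulN1r addNr addr0 /tensor.
have e : \prod_k phi k (tnth x k) = \prod_k phi k 0.
  by apply: eq_bigr => k _; rewrite [in LHS]cphi.
by rewrite e divfK.
Qed.

Lemma dxW_tensor_integral i (u : 'I_d -> R -> R) :
  (forall k, u k \in Lfun (if k == i then circle_measure (W i) else dx1) 2%:E) ->
  \int[dxW W i]_x tensor u x =
  \int[circle_measure (W i)]_t u i t * \prod_(k | k != i) \int[dx1]_t u k t.
Proof.
move=> Lu; have [_] := integrable_Rintegral_prod (fun k => Lfun2_integrable (Lu k)).
rewrite /dxW => ->; rewrite (bigD1 i)//= eqxx; congr (_ * _).
by apply: eq_bigr => k /negbTE ->.
Qed.

Lemma diff_tensor_mean i phi : in_basis phi ->
  \int[dxW W i]_x tensor (diff_factor i phi) x = 0.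
Proof.
move=> Bphi; rewrite dxW_tensor_integral; last by move=> k; exact: diff_factor_L2.
rewrite {1}/diff_factor eqxx.
rewrite (gen_laplacian_derive_mean (@W_increasing i) (@W_periodic i) (basis_eigen (Bphi i)) (basis_measurable (Bphi i))).
by rewrite mul0r.
Qed.

Lemma partial_W_mean i f : DW f -> \int[dxW W i]_x partial_W W i f x = 0.
Proof.
move=> [n [c [phi [Bphi ->]]]].
rewrite [X in Rintegral _ _ X](partial_W_sum i c Bphi) Rintegral_ip1 ip_suml; last 2 first.
- by move=> j; exact: diff_tensor_L2.
- exact: Lfun2_cst.
by apply: big1 => j _; rewrite -Rintegral_ip1 diff_tensor_mean ?mulr0.
Qed.

Lemma tensor_mean phi k : in_basis phi -> eigenvalue k (phi k) != 0 ->
  \int[dx]_x tensor phi x = 0.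
Proof.
move=> Bphi lk.
have [_ ->] := integrable_Rintegral_prod (fun k => Lfun2_integrable (basis_L2 (Bphi k))).
rewrite (bigD1 k)//= (eigenvector_mean (basis_L2 (Bphi k)) (basis_eigen (Bphi k)) lk).
by rewrite mul0r.
Qed.

Lemma tensor_orthogonal phi psi : in_basis phi -> in_basis psi -> phi <> psi ->
  \int[dx]_x (tensor phi x * tensor psi x) = 0.
Proof.
move=> Bphi Bpsi pp.
have [k pk] : exists k, phi k <> psi k.
  by apply: contrapT => n; apply: pp; apply/funext => k; apply: contrapT => h; apply: n; exists k.
have [_] := integrable_Rintegral_prod (fun k => Lfun2_integrable_mul (basis_L2 (Bphi k)) (basis_L2 (Bpsi k))).
under eq_Rintegral do rewrite big_split/=.
move=> ->; rewrite (bigD1 k)//=.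
have [_ _ _ ort _] := A_basis k.
by rewrite (ort _ _ (Bphi k) (Bpsi k) pk) mul0r.
Qed.

Lemma in_DW_measurable f : DW f -> measurable_fun setT f.
Proof. by move=> /in_DW_L2 /Lfun2_measurable. Qed.

Lemma measurable_slice f i (x : X) : measurable_fun setT f -> measurable_fun setT (slice f x i).
Proof.
move=> mf; have -> : slice f x i = (fun p : X * S => f (set_coord i p.2 p.1)) \o pair x by [].
apply: measurableT_comp; last exact: pair1_measurable.
by apply: (measurableT_comp mf); exact: measurable_set_coord.
Qed.

Lemma slice_set_coord f i t (x : X) : slice f (set_coord i t x) i = slice f x i.
Proof.
apply/funext => s; rewrite /slice; congr f; apply: eq_from_tnth => k.
by rewrite !tnth_mktuple; case: eqP => // _; rewrite tnth_set_coord; case: eqP.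
Qed.

(* One-dimensional integration by parts on every line parallel to the i-th axis. *)
Lemma partial_xW_parts i f h phi : DW f -> is_partial_xW W i f h -> in_basis phi ->
  \int[dx]_x (h x * tensor phi x) =
  - \int[dxW W i]_x (partial_W W i f x * tensor (diff_factor i phi) x).
Proof.
move=> Df [Lh fh] Bphi.
have iL := Lfun2_integrable_mul Lh (tensor_L2 Bphi).
have iR := Lfun2_integrable_mul (partial_W_L2 i Df) (diff_tensor_L2 i Bphi).
have iR' := integrable_EFinZ measurableT (-1) iR.
rewrite -mulN1r -RintegralZl// /Rintegral; congr fine.
rewrite [LHS](coordinate_fubini i iL) [RHS](coordinate_fubini i iR') eqxx.
(* The two measures differ in slot [i] only, so the outer integrals are over the same measure and
   the identity can be checked line by line. *)
have -> : drop_coord (fun k => if k == i then circle_measure (W i) else dx1) i =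
    drop_coord (fun=> @dx1 R) i.
  by apply/funext => k; rewrite /drop_coord; case: eqP.
apply: eq_integral => x _.
pose P := \prod_(k | k != i) phi k (tnth x k).
have msf : measurable_fun setT (slice f x i).
  by apply: measurable_slice; exact: in_DW_measurable.
have [_ Lsh _ _] := fh x.
have [mD [M DM] _ _ _] := gen_laplacian_derive (@W_increasing i) (@W_periodic i) (fh x) msf.
have LD := @Lfun2_bounded _ S R (circle_measure (W i)) _ M mD DM.
have LE := basis_derive_L2 (Bphi i).
have i1 := Lfun2_integrable_mul Lsh (basis_L2 (Bphi i)).
have i2 := Lfun2_integrable_mul LD LE.
transitivity (\int[dx1]_t (P * (slice h x i t * phi i t))%:E)%E.
  apply: eq_integral => t _ /=; congr EFin.
  by rewrite tensor_set_coord -/P /slice -/(set_coord i t x); ring.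
transitivity (\int[circle_measure (W i)]_t
    (- P * (gen_derive (W i) (slice f x i) t * gen_derive (W i) (phi i) t))%:E)%E; last first.
  apply: eq_integral => t _ /=; congr EFin.
  by rewrite diff_tensor_set_coord -/P /partial_W slice_set_coord tnth_set_coord eqxx; ring.
rewrite -[LHS]fineK; last by apply: integrable_fin_num => //; exact: integrable_EFinZ.
rewrite -[RHS]fineK; last by apply: integrable_fin_num => //; exact: integrable_EFinZ.
have eL := @RintegralZl _ _ _ dx1 setT _ P measurableT i1.
have eR := @RintegralZl _ _ _ (circle_measure (W i)) setT _ (- P) measurableT i2.
refine (congr1 EFin (etrans (etrans eL _) (esym eR))).
rewrite (gen_laplacian_parts (@W_increasing i) (@W_periodic i) (fh x) msf (basis_eigen (Bphi i)) (basis_measurable (Bphi i))).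
by ring.
Qed.

Lemma tensor_is_partial_xW i phi : in_basis phi ->
  is_partial_xW W i (tensor phi) (fun x => eigenvalue i (phi i) * tensor phi x).
Proof.
move=> Bphi; split; first by apply: Lfun2Z; exact: tensor_L2.
move=> x; pose P := \prod_(k | k != i) phi k (tnth x k).
have -> : slice (tensor phi) x i = (fun t => P * phi i t).
  by apply/funext => t; rewrite /slice -/(set_coord i t x) tensor_set_coord mulrC.
have -> : slice (fun x => eigenvalue i (phi i) * tensor phi x) x i =
    (fun t => P * (eigenvalue i (phi i) * phi i t)).
  by apply/funext => t; rewrite /slice -/(set_coord i t x) tensor_set_coord -/P; ring.
by apply: gen_laplacianZ; exact: basis_eigen.
Qed.

Lemma diff_tensor_ip i phi psi : in_basis phi -> in_basis psi ->
  \int[dxW W i]_x (tensor (diff_factor i phi) x * tensor (diff_factor i psi) x) =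
  - eigenvalue i (phi i) * \int[dx]_x (tensor phi x * tensor psi x).
Proof.
move=> Bphi Bpsi.
have := partial_xW_parts (in_DW_tensor Bphi) (tensor_is_partial_xW i Bphi) Bpsi.
rewrite partial_W_tensor// => e; rewrite -[LHS]opprK -e mulNr; congr (- _).
under eq_Rintegral do rewrite -mulrA.
rewrite RintegralZl//.
by apply: Lfun2_integrable_mul; exact: tensor_L2.
Qed.

(** The Poincare constant: it dominates the gap constant [W k 1 - W k 0] of every coordinate. *)
Definition mass_sum := \sum_k (W k 1 - W k 0).

Lemma variation_ge0 k : 0 <= W k 1 - W k 0.
Proof. by rewrite subr_ge0 ltW// W_increasing. Qed.

Lemma mass_sum_ge0 : 0 <= mass_sum.
Proof. by apply: sumr_ge0 => k _; exact: variation_ge0. Qed.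

Definition eigenvalue_sum phi := \sum_i - eigenvalue i (phi i).

Lemma eigenvalueN_ge0 i phi : in_basis phi -> 0 <= - eigenvalue i (phi i).
Proof.
move=> Bphi; have := eigenvalue_le0 (@W_increasing i) (@W_periodic i) (basis_L2 (Bphi i)) (basis_norm (Bphi i)) (basis_eigen (Bphi i)).
by rewrite oppr_ge0.
Qed.

(** One nonconstant factor is enough, since the other coordinates only add nonnegative terms to both
    sums. *)
Lemma spectral_gap phi k : in_basis phi -> eigenvalue k (phi k) != 0 ->
  1 <= mass_sum * eigenvalue_sum phi.
Proof.
move=> Bphi lk.
have := eigenvalue_gap (@W_increasing k) (@W_periodic k) (basis_L2 (Bphi k)) (basis_norm (Bphi k)) (basis_eigen (Bphi k)) lk.
move=> /le_trans; apply; apply: ler_pM.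
- exact: variation_ge0.
- exact: eigenvalueN_ge0.
- by rewrite /mass_sum (bigD1 k)//= lerDl sumr_ge0// => j _; exact: variation_ge0.
- by rewrite /eigenvalue_sum (bigD1 k)//= lerDl sumr_ge0// => j _; exact: eigenvalueN_ge0.
Qed.

Lemma Rintegral_dx_cst (c : R) : \int[@dx R d]_x c = c.
Proof.
have i1 (k : 'I_d) : (@dx1 R).-integrable setT (EFin \o (fun=> 1 : R)).
  exact: finite_measure_integrable_cst.
have [ii e] := integrable_Rintegral_prod i1.
transitivity (\int[@dx R d]_x (c * \prod_(k < d) 1)).
  by apply: eq_Rintegral => x _; rewrite big1 ?mulr1.
rewrite RintegralZl// e big1 ?mulr1// => k _; exact: Rintegral_dx1_cst.
Qed.

Lemma double_ip_sum (disp : measure_display) (T : measurableType disp)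
    (mu : {finite_measure set T -> \bar R}) n (a b : 'I_n -> R) (F : 'I_n -> T -> R) :
  (forall j, F j \in Lfun mu 2%:E) ->
  \int[mu]_x ((\sum_j a j * F j x) * (\sum_l b l * F l x)) =
  \sum_j \sum_l a j * b l * \int[mu]_x (F j x * F l x).
Proof.
move=> LF; rewrite ip_suml//; last exact: Lfun2_sum.
apply: eq_bigr => j _; rewrite ip_sumr// mulr_sumr.
by apply: eq_bigr => l _; rewrite mulrA.
Qed.

(* For distinct basis elements the Gram matrix vanishes, so the difference of
   both sides is the square norm of sum_j c_j sqrt (TV * M_j - 1) e_j, M_j being
   the eigenvalue of e_j, over the non constant e_j. *)
Lemma poincare_in_DW f : DW f ->
  \int[dx]_x ((f x - \int[dx]_y f y) ^+ 2) <=
  mass_sum * \sum_i \int[dxW W i]_x (partial_W W i f x ^+ 2).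
Proof.
move=> [n [c [phi [Bphi ->]]]].
pose e j : X -> R := tensor (phi j).
have Le j : e j \in Lfun (@dx R d) 2%:E by exact: tensor_L2.
pose nc (p : 'I_d -> R -> R) := [exists k, eigenvalue k (p k) != 0].
(* Centring removes exactly the constant products, the others having zero mean. *)
pose c' j := if nc (phi j) then c j else 0.
(* For nonconstant products the radicand is nonnegative by [spectral_gap]; otherwise the eigenvalue
   sum is 0 and the value of [s j] is immaterial, because [c' j = 0]. *)
pose s j := Num.sqrt (mass_sum * eigenvalue_sum (phi j) - 1).
have means x : \sum_j c j * e j x - \int[dx]_y (\sum_j c j * e j y) = \sum_j c' j * e j x.
  rewrite Rintegral_ip1 ip_suml//; last exact: Lfun2_cst.
  rewrite -sumrB; apply: eq_bigr => j _; rewrite -Rintegral_ip1 /c' /nc.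
  case: existsP => [[k lk]|nk]; first by rewrite (tensor_mean (Bphi j) lk) mulr0 subr0.
  have ecst : e j = cst (\prod_k phi j k 0).
    apply/funext => y; apply: eq_bigr => k _.
    rewrite [in LHS](@eigenvector_cst _ (W k) (@W_increasing k) (@W_periodic k) _ _
      (basis_L2 (Bphi j k)) (basis_norm (Bphi j k)) (basis_eigen (Bphi j k)))//.
    by apply/eqP; apply: contrapT => h; apply: nk; exists k; apply/negP.
  by rewrite ecst Rintegral_dx_cst subrr mul0r.
under eq_Rintegral do rewrite -/(tensor _ _) means.
rewrite sqE double_ip_sum//.
have pE i : \int[dxW W i]_x (partial_W W i (fun x => \sum_j c j * tensor (phi j) x) x ^+ 2) =
    \sum_j \sum_l c j * c l * (- eigenvalue i (phi j i) * \int[dx]_x (tensor (phi j) x * tensor (phi l) x)).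
  rewrite (partial_W_sum i c Bphi) sqE double_ip_sum; last by move=> j; exact: diff_tensor_L2.
  by apply: eq_bigr => j _; apply: eq_bigr => l _; rewrite diff_tensor_ip.
rewrite (eq_bigr _ (fun i _ => pE i)).
rewrite [X in _ <= _ * X]exchange_big/= mulr_sumr -subr_ge0 -sumrB.
have -> : \sum_j (mass_sum * (\sum_i \sum_l c j * c l * (- eigenvalue i (phi j i) * \int[dx]_x (tensor (phi j) x * tensor (phi l) x)))
   - \sum_l c' j * c' l * \int[dx]_x (e j x * e l x)) =
  \int[dx]_x ((\sum_j (c' j * s j) * e j x) * (\sum_l (c' l * s l) * e l x)).
  rewrite double_ip_sum//; apply: eq_bigr => j _.
  rewrite exchange_big/= mulr_sumr -sumrB; apply: eq_bigr => l _.
  rewrite -mulr_sumr -mulr_suml -/(eigenvalue_sum _) -/(e j) -/(e l).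
  (* The split is on [phi j = phi l] and not on [j = l]: an element of D_W may list the same product
     several times. *)
  have [pjl|pjl] := pselect (phi j = phi l); last first.
    by rewrite (tensor_orthogonal (Bphi j) (Bphi l) pjl) !mulr0 subrr.
  rewrite /c' /s /nc pjl; case: existsP => [[k lk]|nk].
    have := spectral_gap (Bphi l) lk => gap.
    set q := Num.sqrt _.
    have qq : q * q = mass_sum * eigenvalue_sum (phi l) - 1.
      by rewrite -expr2 sqr_sqrtr// subr_ge0.
    by rewrite (mulrACA (c j) q) qq; ring.
  have -> : eigenvalue_sum (phi l) = 0.
    apply: big1 => k _; apply/eqP; rewrite oppr_eq0; apply: contrapT => h.
    by apply: nk; exists k; apply/negP.
  by ring.
exact: ip_ge0.
Qed.

(** The weak identity for elements of D_W with their classical derivative, against every admissible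
    version [h], as the definition of the weak derivative demands. *)
Lemma partial_xW_parts_in_DW i f h g : DW f -> is_partial_xW W i f h -> DW g ->
  \int[dx]_x (h x * g x) = - \int[dxW W i]_x (partial_W W i f x * partial_W W i g x).
Proof.
move=> Df fh [n [c [phi [Bphi ->]]]]; have [Lh _] := fh.
rewrite (ip_sumr _ _ (fun j => tensor_L2 (Bphi j)) Lh) (partial_W_sum i c Bphi).
rewrite (ip_sumr _ _ (fun j => diff_tensor_L2 i (Bphi j)) (partial_W_L2 i Df)) -sumrN.
by apply: eq_bigr => j _; rewrite (partial_xW_parts Df fh (Bphi j)) mulrN.
Qed.

(** * The space H_{1,W} as the closure of D_W *)

(** [(v, G)] lies in the closure of the graph of the gradient over D_W, as witnessed by [fs]. *)
Definition DWcvg (fs : nat -> X -> R) (v : X -> R) (G : 'I_d -> X -> R) :=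
  [/\ forall n, DW (fs n), L2cvg dx fs v &
      forall i, L2cvg (dxW W i) (fun n => partial_W W i (fs n)) (G i)].

(** Zero mean and the weak identity survive L^2 limits, and the sequence itself witnesses the
    closure condition. *)
Lemma DWcvg_weak_partial fs v G i : v \in Lfun (@dx R d) 2%:E ->
  (forall i, G i \in Lfun (dxW W i) 2%:E) -> DWcvg fs v G ->
  is_weak_partial_W W A i v (G i) /\ closure_partial_W W A i (G i).
Proof.
move=> Lv LG [Dfs cfs cG].
have Lfs n := in_DW_L2 (Dfs n); have Lp n := partial_W_L2 i (Dfs n).
split; last first.
  move=> e e0; have /cvgrPdist_lt/(_ e e0) := cG i.
  case=> N _ /(_ N (leqnn N)) /=; rewrite sub0r normrN => h.
  by exists (fs N) => //; exact: le_lt_trans (ler_norm _) h.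
split.
  split => //.
  have c := L2cvg_ip Lp (LG i) (fun=> Lfun2_cst _ 1) (Lfun2_cst _ 1) (cG i) (@L2cvg_cst _ _ _ _ _).
  rewrite Rintegral_ip1 -(cvg_lim (@Rhausdorff R) c).
  under eq_fun do rewrite -Rintegral_ip1 partial_W_mean//.
  by rewrite lim_cst//; exact: Rhausdorff.
move=> f h Df fh; have [Lh _] := fh.
have c1 := L2cvg_ip (fun=> Lh) Lh Lfs Lv (@L2cvg_cst _ _ _ _ _) cfs.
have c2 := L2cvg_ip (fun=> partial_W_L2 i Df) (partial_W_L2 i Df) Lp (LG i) (@L2cvg_cst _ _ _ _ _) (cG i).
have c3 : (fun n => \int[dx]_x (h x * fs n x)) @ \oo -->
    - \int[dxW W i]_x (partial_W W i f x * G i x).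
  under eq_fun do rewrite (partial_xW_parts_in_DW Df fh (Dfs _)).
  exact: cvgN c2.
by rewrite -(cvg_lim (@Rhausdorff R) c1) -(cvg_lim (@Rhausdorff R) c3).
Qed.

Lemma closure_partial_W_seq i G : G \in Lfun (dxW W i) 2%:E -> closure_partial_W W A i G ->
  exists fs : nat -> X -> R, (forall n, DW (fs n)) /\
    L2cvg (dxW W i) (fun n => partial_W W i (fs n)) G.
Proof.
move=> LG cG.
have ex (n : nat) : exists f, DW f /\ \int[dxW W i]_x ((partial_W W i f x - G x) ^+ 2) < n.+1%:R^-1.
  have n0 : 0 < n.+1%:R^-1 :> R by rewrite invr_gt0.
  by have [f Df h] := cG _ n0; exists f.
have /choice[fs fsP] := ex; exists fs; split=> [n|]; first by case: (fsP n).
apply: (@cvg0_le _ _ (fun n => n.+1%:R^-1)); last exact: cvg_harmonic.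
move=> n; rewrite ger0_norm; last by apply: Rintegral_ge0 => x _; exact: sqr_ge0.
by case: (fsP n) => _ /ltW.
Qed.

(** The pairings of a weak derivative with gradients of basis elements depend on [g] only, whichever
    version [G] is taken. *)
Lemma weak_partial_tensor i g G phi : g \in Lfun (@dx R d) 2%:E ->
  is_weak_partial_W W A i g G -> in_basis phi ->
  \int[dxW W i]_x (tensor (diff_factor i phi) x * G x) =
  - eigenvalue i (phi i) * \int[dx]_x (tensor phi x * g x).
Proof.
move=> Lg [_ wG] Bphi.
have := wG _ _ (in_DW_tensor Bphi) (tensor_is_partial_xW i Bphi).
rewrite partial_W_tensor// => e; rewrite -[LHS]opprK -e mulNr; congr (- _).
under eq_Rintegral do rewrite -mulrA.
by rewrite RintegralZl//; apply: Lfun2_integrable_mul => //; exact: tensor_L2.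
Qed.

(** The difference is orthogonal to all gradients from D_W, hence to their closure, to which both
    versions belong; so it is orthogonal to itself. *)
Lemma weak_partial_unique i g G G' : g \in Lfun (@dx R d) 2%:E ->
  is_weak_partial_W W A i g G -> closure_partial_W W A i G ->
  is_weak_partial_W W A i g G' -> closure_partial_W W A i G' ->
  G = G' %[ae dxW W i].
Proof.
move=> Lg wG cG wG' cG'.
have [[LG _] _] := wG; have [[LG' _] _] := wG'.
pose K x := G x - G' x.
have LK : K \in Lfun (dxW W i) 2%:E by exact: Lfun2B.
have K0 f : DW f -> \int[dxW W i]_x (partial_W W i f x * K x) = 0.
  move=> [n [c [phi [Bphi ->]]]]; rewrite (partial_W_sum i c Bphi).
  rewrite (ip_suml _ _ (fun j => diff_tensor_L2 i (Bphi j)) LK); apply: big1 => j _.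
  rewrite ipBr//; last exact: diff_tensor_L2.
  by rewrite (weak_partial_tensor Lg wG (Bphi j)) (weak_partial_tensor Lg wG' (Bphi j)) subrr mulr0.
have lim0 H : H \in Lfun (dxW W i) 2%:E -> closure_partial_W W A i H ->
    \int[dxW W i]_x (H x * K x) = 0.
  move=> LH cH; have [fs [Dfs cfs]] := closure_partial_W_seq LH cH.
  have c := L2cvg_ip (fun n => partial_W_L2 i (Dfs n)) LH (fun=> LK) LK cfs (@L2cvg_cst _ _ _ _ _).
  rewrite -(cvg_lim (@Rhausdorff R) c); under eq_fun do rewrite K0//.
  by rewrite lim_cst//; exact: Rhausdorff.
have KK : \int[dxW W i]_x (K x * K x) = 0.
  by rewrite ipBl// (lim0 _ LG cG) (lim0 _ LG' cG') subrr.
apply: filterS (ip_self_eq0 LK KK) => x h /h /eqP.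
by rewrite subr_eq0 => /eqP.
Qed.

Lemma weak_partial_WP i g G : g \in Lfun (@dx R d) 2%:E ->
  is_weak_partial_W W A i g G -> closure_partial_W W A i G ->
  [/\ is_weak_partial_W W A i g (weak_partial_W W A i g),
      closure_partial_W W A i (weak_partial_W W A i g) &
      weak_partial_W W A i g = G %[ae dxW W i]].
Proof.
move=> Lg wG cG.
have [w c] : [set G : X -> R | is_weak_partial_W W A i g G /\ closure_partial_W W A i G]
    (weak_partial_W W A i g).
  by apply: xgetPex; exists G.
by split => //; exact: (weak_partial_unique Lg w c wG cG).
Qed.

Lemma DWcvg_H1W fs v G : v \in Lfun (@dx R d) 2%:E ->
  (forall i, G i \in Lfun (dxW W i) 2%:E) -> DWcvg fs v G ->
  H1W W A v /\ forall i, weak_partial_W W A i v = G i %[ae dxW W i].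
Proof.
move=> Lv LG cv; split.
  by split => // i; exists (G i); have [] := DWcvg_weak_partial i Lv LG cv.
by move=> i; have [w c] := DWcvg_weak_partial i Lv LG cv; have [] := weak_partial_WP Lv w c.
Qed.

Lemma partial_W_B i f g : DW f -> DW g ->
  partial_W W i (f - g) = (fun x => partial_W W i f x - partial_W W i g x).
Proof.
move=> Df Dg; rewrite [X in partial_W W i X](_ : _ = fun x => -1 * g x + f x); last first.
  by apply/funext => x; rewrite mulN1r addrC.
by rewrite partial_W_comb//; apply/funext => x; rewrite mulN1r addrC.
Qed.

(* The defect r = v - p of the projection p of v on the closure of the graph of
   the gradient satisfies <r, e> (1 + M_e) = 0 for every basis element e. *)
Lemma H1W_density v : H1W W A v ->
  (forall i, weak_partial_W W A i v \in Lfun (dxW W i) 2%:E) /\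
  exists fs, DWcvg fs v (fun i => weak_partial_W W A i v).
Proof.
(* [G] is any family of weak derivatives, possibly outside the closure of the gradients; beyond its
   norm, only its pairings with gradients enter. *)
move=> [Lv /choice[G wG]].
have LG i : G i \in Lfun (dxW W i) 2%:E by have [[]] := wG i.
pose q (f g : X -> R) : R := \int[dx]_x (f x * g x) +
  \sum_i \int[dxW W i]_x (partial_W W i f x * partial_W W i g x).
pose l (g : X -> R) : R := \int[dx]_x (v x * g x) +
  \sum_i \int[dxW W i]_x (G i x * partial_W W i g x).
have DWc a f g : DW f -> DW g -> DW (a *: f + g) by exact: in_DW_comb.
have q_comb a f g h : DW f -> DW g -> DW h -> q (a *: f + g) h = a * q f h + q g h.
  move=> Df Dg Dh; rewrite /q ip_combl ?in_DW_L2// mulrDr addrACA; congr (_ + _).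
  rewrite mulr_sumr -big_split/=; apply: eq_bigr => i _.
  by rewrite partial_W_comb// ip_combl//; exact: partial_W_L2.
have q_sym f g : DW f -> DW g -> q f g = q g f.
  move=> _ _; rewrite /q (ipC dx f g).
  by rewrite (eq_bigr _ (fun i _ => ipC (dxW W i) (partial_W W i f) (partial_W W i g))).
have q_ge0 f : DW f -> 0 <= q f f.
  by move=> Df; rewrite addr_ge0 ?ip_ge0// sumr_ge0// => i _; exact: ip_ge0.
have l_comb a f g : DW f -> DW g -> l (a *: f + g) = a * l f + l g.
  move=> Df Dg; rewrite /l ip_combr ?Lv ?in_DW_L2// mulrDr addrACA; congr (_ + _).
  rewrite mulr_sumr -big_split/=; apply: eq_bigr => i _.
  by rewrite partial_W_comb// ip_combr//; exact: partial_W_L2.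
pose C := \int[dx]_x (v x * v x) + \sum_i \int[dxW W i]_x (G i x * G i x).
have lC g : DW g -> l g ^+ 2 <= C * q g g.
  move=> Dg; apply: cauchy_schwarz_add.
  - exact: ip_ge0.
  - exact: ip_ge0.
  - by apply: sumr_ge0 => i _; exact: ip_ge0.
  - by apply: sumr_ge0 => i _; exact: ip_ge0.
  - by apply: ip_CS => //; exact: in_DW_L2.
  - apply: cauchy_schwarz_sum => i; [exact: ip_ge0|exact: ip_ge0|].
    by apply: ip_CS => //; exact: partial_W_L2.
have [|fs [Dfs fsP]] := approximate_riesz DWc q_comb q_sym q_ge0 l_comb _ lC.
  by exists (cst 0); exact: in_DW_cst.
have cau := approximate_riesz_cauchy DWc q_comb q_ge0 Dfs fsP.
have Lfs n := in_DW_L2 (Dfs n).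
have [p Lp cp] : exists2 p, p \in Lfun dx 2%:E & L2cvg dx fs p.
  apply: (L2_complete (K := 2) Lfs) => n m; apply: le_trans (cau n m).
  by rewrite lerDl sumr_ge0// => i _; exact: ip_ge0.
have /choice[P PP] : forall i, exists P : X -> R, P \in Lfun (dxW W i) 2%:E /\
    L2cvg (dxW W i) (fun n => partial_W W i (fs n)) P.
  move=> i.
  have [||P LP cP] := @L2_complete _ _ _ (dxW W i) (fun n => partial_W W i (fs n)) 2.
  - by move=> n; exact: partial_W_L2.
  - move=> n m; apply: le_trans (cau n m).
    rewrite /q [in leRHS](bigD1 i)//= partial_W_B// addrCA lerDl.
    by rewrite addr_ge0 ?ip_ge0// sumr_ge0// => j _; exact: ip_ge0.
  - by exists P.
have LP i : P i \in Lfun (dxW W i) 2%:E by case: (PP i).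
have cP : DWcvg fs p P by split => // i; case: (PP i).
have wP i := (DWcvg_weak_partial i Lp LP cP).1.
have qlim phi : in_basis phi -> \int[dx]_x (p x * tensor phi x) +
    \sum_i \int[dxW W i]_x (P i x * tensor (diff_factor i phi) x) = l (tensor phi).
  move=> Bphi; have Dt := in_DW_tensor Bphi.
  have c1 : (fun n => q (fs n) (tensor phi)) @ \oo --> l (tensor phi).
    exact: (approximate_riesz_cvg fsP Dt).
  have c2 : (fun n => q (fs n) (tensor phi)) @ \oo --> \int[dx]_x (p x * tensor phi x) +
    \sum_i \int[dxW W i]_x (P i x * tensor (diff_factor i phi) x).
    apply: cvgD.
      exact: (L2cvg_ip Lfs Lp (fun=> tensor_L2 Bphi) (tensor_L2 Bphi) cp (@L2cvg_cst _ _ _ _ _)).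
    apply: cvg_sum_seq => i; rewrite partial_W_tensor//.
    exact: (L2cvg_ip (fun n => partial_W_L2 i (Dfs n)) (LP i) (fun=> diff_tensor_L2 i Bphi)
      (diff_tensor_L2 i Bphi) (PP i).2 (@L2cvg_cst _ _ _ _ _)).
  by rewrite -(cvg_lim (@Rhausdorff R) c1) -(cvg_lim (@Rhausdorff R) c2).
have vp : v = p %[ae (@dx R d)].
  have Lr : (fun x => v x - p x) \in Lfun (@dx R d) 2%:E by exact: Lfun2B.
  have : (fun x => v x - p x) = cst 0 %[ae (@dx R d)].
    apply: basis_complete => // phi Bphi.
    have := qlim _ Bphi; rewrite /l.
    under [in RHS]eq_bigr => i _.
      rewrite partial_W_tensor// ipC (weak_partial_tensor Lv (wG i) Bphi); over.
    under [in LHS]eq_bigr => i _.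
      rewrite ipC (weak_partial_tensor Lp (wP i) Bphi); over.
    rewrite -!mulr_suml -/(eigenvalue_sum phi) ipBr//; last exact: tensor_L2.
    rewrite !(ipC _ _ (tensor phi)) => e.
    have M0 : 0 <= eigenvalue_sum phi by apply: sumr_ge0 => i _; exact: eigenvalueN_ge0.
    have : (1 + eigenvalue_sum phi) *
      (\int[dx]_x (tensor phi x * v x) - \int[dx]_x (tensor phi x * p x)) = 0.
      rewrite mulrBr !mulrDl !mul1r -e subrr//.
    by move/eqP; rewrite mulf_eq0 => /orP[/eqP|/eqP//]; lra.
  by apply: filterS => x /= h /h /eqP; rewrite subr_eq0 => /eqP.
have pv : p = v %[ae (@dx R d)] by apply: filterS vp => x /= h /h.
(* The same sequence converges to [v], so [P] is a weak derivative of [v] lying in the closure, and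
   uniqueness identifies it with [weak_partial_W]. *)
have cvP : DWcvg fs v P.
  by case: cP => _ _ cP; split => //; exact: (L2cvg_ae Lfs Lp Lv pv).
have [_ wvP] := DWcvg_H1W Lv LP cvP.
have Lwp i : weak_partial_W W A i v \in Lfun (dxW W i) 2%:E.
  have [w c] := DWcvg_weak_partial i Lv LP cvP.
  by have [[[]]] := weak_partial_WP Lv w c.
split => //; exists fs; case: cvP => _ cv cPi; split => // i.
apply: (L2cvg_ae _ (LP i) (Lwp i) _ (cPi i)); first by move=> n; exact: partial_W_L2.
by apply: filterS (wvP i) => x /= h /h.
Qed.

Lemma variance_dx (f : X -> R) : f \in Lfun (@dx R d) 2%:E ->
  \int[dx]_x ((f x - \int[dx]_y f y) ^+ 2) =
  \int[dx]_x (f x * f x) - (\int[dx]_y f y) ^+ 2.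
Proof.
move=> Lf; set m := \int[dx]_y f y.
have Lc : cst (- m) \in Lfun (@dx R d) 2%:E by exact: Lfun2_cst.
have Ld := Lfun2_comb 1 Lf Lc.
transitivity (\int[dx]_x ((1 * f x + cst (- m) x) * (1 * f x + cst (- m) x))).
  by apply: eq_Rintegral => x _ /=; ring.
have e1 : \int[dx]_x (f x * cst (- m) x) = - m ^+ 2.
  by rewrite RintegralZr//; [rewrite -/m; ring|exact: Lfun2_integrable].
rewrite ip_combl// !ip_combr// (ipC _ (cst (- m)) f) e1 /= Rintegral_dx_cst; ring.
Qed.

(** By [variance_dx] the centred norm is a difference of inner products, each continuous along the
    approximating sequence. *)
Lemma poincare_H1W v : H1W W A v ->
  \int[dx]_x ((v x - \int[dx]_y v y) ^+ 2) <=
  mass_sum * \sum_i \int[dxW W i]_x (weak_partial_W W A i v x ^+ 2).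
Proof.
move=> Hv; have [Lv _] := Hv; have [Lw [fs [Dfs cv cw]]] := H1W_density Hv.
have Lfs n := in_DW_L2 (Dfs n).
have c1 := L2cvg_ip Lfs Lv Lfs Lv cv cv.
have c2 := L2cvg_ip Lfs Lv (fun=> Lfun2_cst _ 1) (Lfun2_cst _ 1) cv (@L2cvg_cst _ _ _ _ _).
apply: (cvg_le_lim (fun n => poincare_in_DW (Dfs n))).
  rewrite variance_dx//; under eq_fun do rewrite variance_dx// (Rintegral_ip1 _ (fs _)).
  rewrite (Rintegral_ip1 _ v); apply: cvgB => //.
  by rewrite expr2; under eq_fun do rewrite expr2; exact: cvgM.
apply: cvgM; first exact: cvg_cst.
apply: cvg_sum_seq => i.
have Lp n := partial_W_L2 i (Dfs n).
exact: (L2cvg_ip Lp (Lw i) Lp (Lw i) (cw i) (cw i)).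
Qed.

Lemma H1W_cst c : H1W W A (cst c) /\ forall i, weak_partial_W W A i (cst c) = cst 0 %[ae dxW W i].
Proof.
apply: (@DWcvg_H1W (fun=> cst c) (cst c) (fun=> cst 0)).
- exact: Lfun2_cst.
- by move=> i; exact: Lfun2_cst.
- split; [by move=> _; exact: in_DW_cst|exact: L2cvg_cst|move=> i].
  rewrite (_ : (fun=> _) = fun=> cst 0); first exact: L2cvg_cst.
  by apply/funext => n; apply/funext => x; exact: gen_derive_cst.
Qed.

(** Linearity of the chosen derivative is obtained by combining approximating sequences, and holds
    almost everywhere only. *)
Lemma H1W_comb (a : R) (u v : X -> R) : H1W W A u -> H1W W A v ->
  H1W W A (fun x => a * u x + v x) /\
  forall i, weak_partial_W W A i (fun x => a * u x + v x) =
    (fun x => a * weak_partial_W W A i u x + weak_partial_W W A i v x) %[ae dxW W i].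
Proof.
move=> Hu Hv; have [Lu _] := Hu; have [Lv _] := Hv.
have [Lwu [fs [Dfs cu cwu]]] := H1W_density Hu.
have [Lwv [gs [Dgs cv cwv]]] := H1W_density Hv.
apply: (@DWcvg_H1W (fun n x => a * fs n x + gs n x) _
  (fun i x => a * weak_partial_W W A i u x + weak_partial_W W A i v x)).
- exact: Lfun2_comb.
- by move=> i; exact: Lfun2_comb.
- split; first by move=> n; exact: in_DW_comb.
    apply: L2cvg_comb => // n; exact: in_DW_L2.
  move=> i; under eq_fun do rewrite partial_W_comb//.
  by apply: L2cvg_comb => // n; exact: partial_W_L2.
Qed.

(** * Weak solutions for coefficients bounded on the whole space *)

Section weak_solutions.
Variables (a : 'I_d -> X -> R) (theta : R).
Hypothesis a_measurable : forall i, measurable_fun setT (a i).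
Hypothesis theta_gt0 : 0 < theta.
Hypothesis a_bounds : forall i x, theta^-1 <= a i x <= theta.
Local Notation D := (weak_partial_W W A).

Let a_norm i x : `|a i x| <= theta.
Proof.
have /andP[l r] := a_bounds i x.
by rewrite ger0_norm//; apply: le_trans l; rewrite invr_ge0 ltW.
Qed.

Let a_L2 i (F : X -> R) : F \in Lfun (dxW W i) 2%:E -> (fun x => a i x * F x) \in Lfun (dxW W i) 2%:E.
Proof. by move=> LF; exact: Lfun2M LF (a_measurable i) (a_norm i). Qed.

Lemma coercive i (F : X -> R) : F \in Lfun (dxW W i) 2%:E ->
  \int[dxW W i]_x (F x * F x) <= theta * \int[dxW W i]_x (a i x * F x * F x).
Proof.
move=> LF; have iaF := Lfun2_integrable_mul (a_L2 LF) LF.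
rewrite -RintegralZl//; apply: le_Rintegral => //.
- exact: Lfun2_integrable_mul.
- exact: integrable_EFinZ.
- move=> x _; have /andP[l _] := a_bounds i x.
  rewrite -[leLHS]mul1r -(mulrA (a i x)) [leRHS]mulrA ler_wpM2r ?sqr_ge0//.
  by rewrite mulrC -ler_pdivrMr// mul1r.
Qed.

Lemma weak_solution_mean (f u : X -> R) : weak_solution W A a f u -> \int[dx]_x f x = 0.
Proof.
move=> [Hu /(_ (cst 1))]; have [H1 D1] := H1W_cst 1; move=> /(_ H1).
have [Lwu _] := H1W_density Hu; have [Lw1 _] := H1W_density H1.
rewrite big1 => [|i _]; last first.
  rewrite ipC (ae_eq_ip (Lw1 i) (Lfun2_cst _ 0) (a_L2 (Lwu i)) (D1 i)).
  by under eq_Rintegral do rewrite mul0r; rewrite Rintegral_cst// mul0r.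
rewrite -Rintegral_ip1 => /eqP.
by rewrite eq_sym oppr_eq0 => /eqP.
Qed.

(** Subtracting the two equations tested with [w = u - v] gives zero energy; coercivity makes the
    gradient of [w] vanish, and the Poincare inequality makes [w] equal to its mean. *)
Lemma weak_solution_unique (f u v : X -> R) : weak_solution W A a f u -> weak_solution W A a f v ->
  u = v \+ cst (\int[dx]_x u x - \int[dx]_x v x) %[ae (@dx R d)].
Proof.
move=> [Hu eu] [Hv ev].
have [Lu _] := Hu; have [Lv _] := Hv.
have [Hw Dw] := H1W_comb (-1) Hv Hu; set w := fun x => _ in Hw Dw.
have [Lwu _] := H1W_density Hu; have [Lwv _] := H1W_density Hv.
have [Lww _] := H1W_density Hw; have [Lw _] := Hw.
have z : \sum_i \int[dxW W i]_x (a i x * D i w x * D i w x) = 0.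
  transitivity (\sum_i (\int[dxW W i]_x (a i x * D i u x * D i w x) -
      \int[dxW W i]_x (a i x * D i v x * D i w x))); last first.
    refine (etrans (sumrB _ _ _ _) (etrans (congr2 (fun x y => x - y) (eu _ Hw) (ev _ Hw)) (subrr _))).
  apply: eq_bigr => i _.
  have LaD := Lfun2_comb (-1) (Lwv i) (Lwu i).
  have e : (fun x => a i x * D i w x) = (fun x => a i x * (-1 * D i v x + D i u x)) %[ae dxW W i].
    by apply: filterS (Dw i) => x /= h /h ->.
  rewrite (ae_eq_ip (a_L2 (Lww i)) (a_L2 LaD) (Lww i) e) -ipBl//.
  - by apply: eq_Rintegral => x _; ring.
  - exact: a_L2.
  - exact: a_L2.
have z2 : \sum_i \int[dxW W i]_x (D i w x ^+ 2) <= 0.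
  apply: (@le_trans _ _ (theta * \sum_i \int[dxW W i]_x (a i x * D i w x * D i w x))).
    by rewrite mulr_sumr; apply: ler_sum => i _; exact: coercive.
  by rewrite z mulr0.
have z3 : \int[dx]_x ((w x - \int[dx]_y w y) * (w x - \int[dx]_y w y)) = 0.
  apply/eqP; rewrite eq_le ip_ge0 andbT.
  apply: le_trans (poincare_H1W Hw) _.
  by rewrite mulr_ge0_le0// mass_sum_ge0.
have mw : \int[dx]_y w y = \int[dx]_x u x - \int[dx]_x v x.
  rewrite Rintegral_ip1 ip_combl//; last exact: Lfun2_cst.
  by rewrite -!Rintegral_ip1; ring.
have Lwm := Lfun2B Lw (Lfun2_cst _ (\int[dx]_y w y)).
apply: filterS (ip_self_eq0 Lwm z3) => x h _; have := h I.
by rewrite mw /w /=; lra.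
Qed.

(** The energy [q] is degenerate on constants, but so is [l] when [f] has zero mean; this is what
    makes [l] bounded with respect to [q]. *)
Lemma weak_solution_exists (f : X -> R) : f \in Lfun (@dx R d) 2%:E -> \int[dx]_x f x = 0 ->
  exists u : X -> R, H1W_perp W A u /\ weak_solution W A a f u.
Proof.
move=> Lf f0.
pose q (g h : X -> R) : R := \sum_i \int[dxW W i]_x (a i x * partial_W W i g x * partial_W W i h x).
pose l (g : X -> R) : R := - \int[dx]_x (f x * g x).
have DWc (c : R) g h : DW g -> DW h -> DW (c *: g + h) by exact: in_DW_comb.
have q_comb (c : R) g h w : DW g -> DW h -> DW w -> q (c *: g + h) w = c * q g w + q h w.
  move=> Dg Dh Dw; rewrite /q mulr_sumr -big_split/=; apply: eq_bigr => i _.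
  rewrite partial_W_comb// -ip_combl//; try by [apply: a_L2; exact: partial_W_L2 | exact: partial_W_L2].
  by apply: eq_Rintegral => x _; ring.
have q_sym g h : DW g -> DW h -> q g h = q h g.
  by move=> Dg Dh; apply: eq_bigr => i _; apply: eq_Rintegral => x _; ring.
have q_coer g : DW g -> \sum_i \int[dxW W i]_x (partial_W W i g x ^+ 2) <= theta * q g g.
  by move=> Dg; rewrite mulr_sumr; apply: ler_sum => i _; apply: coercive; exact: partial_W_L2.
have part_ge0 g : 0 <= \sum_i \int[dxW W i]_x (partial_W W i g x ^+ 2).
  by apply: sumr_ge0 => i _; exact: ip_ge0.
have q_ge0 g : DW g -> 0 <= q g g.
  by move=> Dg; rewrite -(pmulr_rge0 _ theta_gt0); apply: le_trans (q_coer _ Dg).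
have l_comb (c : R) g h : DW g -> DW h -> l (c *: g + h) = c * l g + l h.
  by move=> Dg Dh; rewrite /l ip_combr ?Lf ?in_DW_L2// opprD mulrN.
have lC g : DW g -> l g ^+ 2 <= \int[dx]_x (f x * f x) * (mass_sum * theta) * q g g.
  move=> Dg; pose m := \int[dx]_x g x; have Lg := in_DW_L2 Dg.
  have Lgm := Lfun2B Lg (Lfun2_cst _ m).
  (* Zero mean of [f] allows [g] to be centred, after which Cauchy-Schwarz, Poincare and coercivity
     give the constant. *)
  have -> : l g ^+ 2 = (\int[dx]_x (f x * (g x - m))) ^+ 2.
    rewrite (ipBr Lg (Lfun2_cst _ m) Lf) /= RintegralZr//; last exact: Lfun2_integrable.
    by rewrite f0 mul0r subr0 /l sqrrN.
  apply: (le_trans (ip_CS Lf Lgm)); rewrite -mulrA ler_wpM2l ?ip_ge0//.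
  apply: (le_trans (poincare_in_DW Dg)); rewrite -mulrA ler_wpM2l ?mass_sum_ge0//.
  exact: q_coer.
have [|fs [Dfs fsP]] := approximate_riesz DWc q_comb q_sym q_ge0 l_comb _ lC.
  by exists (cst 0); exact: in_DW_cst.
have cau := approximate_riesz_cauchy DWc q_comb q_ge0 Dfs fsP.
pose mean n := \int[dx]_x fs n x.
(* The energy controls [fs] only up to constants. Removing the means leaves the gradients unchanged
   and makes the sequence Cauchy in L^2. *)
pose gs n x := 1 * fs n x + cst (- mean n) x.
have Dgs n : DW (gs n) by apply: in_DW_comb => //; exact: in_DW_cst.
have Lgs n := in_DW_L2 (Dgs n).
have pgs i n : partial_W W i (gs n) = partial_W W i (fs n).
  rewrite partial_W_comb//; last exact: in_DW_cst.
  by apply/funext => x; rewrite mul1r [X in _ + X]gen_derive_cst addr0.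
have mgs n : \int[dx]_x gs n x = 0.
  rewrite Rintegral_ip1 (ip_combl 1 (in_DW_L2 (Dfs n)) (Lfun2_cst _ _) (Lfun2_cst _ _)).
  by rewrite -!Rintegral_ip1 Rintegral_dx_cst -/(mean n); ring.
have Lp i (n : nat) : partial_W W i (gs n) \in Lfun (dxW W i) 2%:E by exact: partial_W_L2.
have caup n m : \sum_i \int[dxW W i]_x (partial_W W i (fs n - fs m) x ^+ 2) <=
    theta * 2 * (4^-1 ^+ n + 4^-1 ^+ m).
  have Dd : DW (fs n - fs m).
    rewrite (_ : fs n - fs m = (-1) *: fs m + fs n); first exact: DWc.
    by rewrite scaleN1r addrC.
  by apply: (le_trans (q_coer _ Dd)); rewrite -mulrA ler_pM2l.
have [u Lu cu] : exists2 u : X -> R, u \in Lfun dx 2%:E & L2cvg dx gs u.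
  apply: (L2_complete (K := mass_sum * (theta * 2)) Lgs) => n m.
  have Dd : DW (fun x => -1 * gs m x + gs n x) by exact: in_DW_comb.
  have := poincare_in_DW Dd.
  have -> : \int[dx]_y (-1 * gs m y + gs n y) = 0.
    rewrite Rintegral_ip1 ip_combl//; last exact: Lfun2_cst.
    by rewrite -!Rintegral_ip1 !mgs; ring.
  under eq_Rintegral do rewrite subr0 mulN1r addrC.
  move=> /le_trans; apply; rewrite -mulrA ler_wpM2l ?mass_sum_ge0//.
  apply: le_trans (caup n m); apply: ler_sum => i _.
  rewrite (partial_W_comb i (-1) (Dgs m) (Dgs n)) !pgs (partial_W_B i (Dfs n) (Dfs m)).
  by under eq_Rintegral do rewrite mulN1r addrC.
have /choice[G PG] : forall i, exists G : X -> R, G \in Lfun (dxW W i) 2%:E /\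
    L2cvg (dxW W i) (fun n => partial_W W i (gs n)) G.
  move=> i.
  have [||G LG cG] := @L2_complete _ _ _ (dxW W i) (fun n => partial_W W i (fs n)) (theta * 2).
  - by move=> n; exact: partial_W_L2.
  - move=> n m; apply: le_trans (caup n m).
    rewrite [in leRHS](bigD1 i)//= (partial_W_B i (Dfs n) (Dfs m)) lerDl.
    by rewrite sumr_ge0// => j _; exact: ip_ge0.
  - have e : (fun n => partial_W W i (gs n)) = (fun n => partial_W W i (fs n)).
      by apply/funext => n; exact: pgs.
    by exists G; split; [exact: LG|rewrite e; exact: cG].
have LG i : G i \in Lfun (dxW W i) 2%:E by case: (PG i).
have cuG : DWcvg gs u G by split => // i; case: (PG i).
have [Hu DuG] := DWcvg_H1W Lu LG cuG.
have [LDu _] := H1W_density Hu.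
(* The equation with test functions in D_W: the limit of the approximate Riesz identities. *)
have testD g : DW g -> \sum_i \int[dxW W i]_x (a i x * G i x * partial_W W i g x) = l g.
  move=> Dg; have c1 := approximate_riesz_cvg fsP Dg.
  rewrite -(cvg_lim (@Rhausdorff R) c1); apply/esym/(cvg_lim (@Rhausdorff R)).
  apply: cvg_sum_seq => i; under eq_fun do rewrite -pgs.
  apply: (L2cvg_ip _ _ (fun=> partial_W_L2 i Dg) (partial_W_L2 i Dg) _ (@L2cvg_cst _ _ _ _ _)).
  - by move=> n; apply: a_L2.
  - exact: a_L2.
  - exact: (L2cvgM (Lp i) (LG i) (a_measurable i) (a_norm i) (PG i).2).
exists u; split; first split => //.
  have c := L2cvg_ip Lgs Lu (fun=> Lfun2_cst _ 1) (Lfun2_cst _ 1) cu (@L2cvg_cst _ _ _ _ _).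
  rewrite Rintegral_ip1 -(cvg_lim (@Rhausdorff R) c).
  by under eq_fun do rewrite -Rintegral_ip1 mgs; rewrite lim_cst//; exact: Rhausdorff.
(* A general test function is approximated by [hs] in D_W with converging gradients, and both sides
   of the equation are continuous along [hs]. *)
split => // v Hv; have [Lv _] := Hv; have [LDv [hs [Dhs cv cDv]]] := H1W_density Hv.
have Lhs n := in_DW_L2 (Dhs n).
have aG i : (fun x => a i x * D i u x) = (fun x => a i x * G i x) %[ae dxW W i].
  by apply: filterS (DuG i) => x /= h /h ->.
under eq_bigr => i _ do rewrite (ae_eq_ip (a_L2 (LDu i)) (a_L2 (LG i)) (LDv i) (aG i)).
have c1 : (fun n => l (hs n)) @ \oo --> - \int[dx]_x (f x * v x).
  by apply: cvgN; exact: (L2cvg_ip (fun=> Lf) Lf Lhs Lv (@L2cvg_cst _ _ _ _ _) cv).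
rewrite -(cvg_lim (@Rhausdorff R) c1); apply/esym/(cvg_lim (@Rhausdorff R)).
under eq_fun do rewrite -testD//.
apply: cvg_sum_seq => i.
exact: (L2cvg_ip (fun=> a_L2 (LG i)) (a_L2 (LG i)) (fun n => partial_W_L2 i (Dhs n)) (LDv i)
  (@L2cvg_cst _ _ _ _ _) (cDv i)).
Qed.

(** Let [s] be the squared norm of the gradient and [T] stand for [mass_sum]. Testing with [u] gives
    [s <= theta |<f, u>|], while Cauchy-Schwarz and Poincare give [<f, u>^2 <= |f|^2 T s]; squaring
    the first and cancelling one [s] leaves [s <= theta^2 T |f|^2]. The factor [T + 1] accounts for
    the L^2 norm of [u], whose square is at most [T s]. *)
Lemma weak_solution_bound (f u : X -> R) : f \in Lfun (@dx R d) 2%:E ->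
  H1W_perp W A u -> weak_solution W A a f u ->
  norm_1W W A u <= Num.sqrt ((mass_sum + 1) * (theta ^+ 2 * mass_sum)) * norm_L2 f.
Proof.
move=> Lf [Hu u0] [_ eu].
have [Lu _] := Hu; have [LDu _] := H1W_density Hu.
have T0 := mass_sum_ge0.
have T1 : 0 <= mass_sum + 1 by rewrite addr_ge0.
have t0 : 0 <= theta ^+ 2 * mass_sum by rewrite mulr_ge0 ?sqr_ge0.
pose s := \sum_i \int[dxW W i]_x (D i u x * D i u x).
have s0 : 0 <= s by apply: sumr_ge0 => i _; exact: ip_ge0.
have pu : \int[dx]_x (u x * u x) <= mass_sum * s.
  have := poincare_H1W Hu; rewrite u0.
  by under eq_Rintegral do rewrite subr0.
have su : s <= theta * - \int[dx]_x (f x * u x).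
  by rewrite -eu// mulr_sumr; apply: ler_sum => i _; exact: coercive.
set F := \int[dx]_x (f x * f x).
have F0 : 0 <= F by exact: ip_ge0.
have fu : (\int[dx]_x (f x * u x)) ^+ 2 <= F * (mass_sum * s).
  by apply: (le_trans (ip_CS Lf Lu)); rewrite ler_wpM2l.
have sF : s <= theta ^+ 2 * mass_sum * F.
  (* The cancellation of [s] needs [s] positive. *)
  have [->|sN0] := eqVneq s 0.
    by rewrite mulr_ge0// mulr_ge0// sqr_ge0.
  have sgt0 : 0 < s by rewrite lt_neqAle eq_sym sN0.
  rewrite -(ler_pM2l sgt0).
  apply: (@le_trans _ _ ((theta * - \int[dx]_x (f x * u x)) ^+ 2)).
    by rewrite -expr2 ler_pXn2r ?nnegrE// (le_trans s0).
  rewrite exprMn sqrrN.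
  apply: (@le_trans _ _ (theta ^+ 2 * (F * (mass_sum * s)))).
    by rewrite ler_wpM2l ?sqr_ge0.
  by rewrite le_eqVlt; apply/orP; left; apply/eqP; ring.
rewrite /norm_1W /norm_L2 -sqrtrM; last first.
  exact: mulr_ge0.
apply: ler_wsqrtr; rewrite /inner_1W -/s.
apply: (@le_trans _ _ ((mass_sum + 1) * s)); first by rewrite mulrDl mul1r lerD2r.
by rewrite -mulrA ler_wpM2l.
Qed.

End weak_solutions.

End span_of_eigenvectors.

(** * Coefficients known on the unit cube only *)

Section almost_everywhere_coefficients.
Context {R : realType} {d : nat}.
Local Notation S := (measurableTypeR R).
Local Notation X := (d.-tuple S).
Variables (W : 'I_d -> cumulative R R) (A : 'I_d -> set (R -> R)).

Lemma circle_measure_setC (V : cumulative R R) :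
  circle_measure V (~` (`[0, 1[%classic : set S)) = 0%E.
Proof. by rewrite /circle_measure /= /mfrestr /mrestr setICl measure0. Qed.

Lemma dxW_cube i : {ae dxW W i, forall x, forall k, 0 <= tnth x k < 1}.
Proof.
apply: filter_forall => k.
have mI : measurable (`[0, 1[%classic : set S) by exact: measurable_ocitv.
apply: filterS (@product_measure_coord_ae R d _ k _ mI _) => [x /=|].
  by rewrite in_itv.
by case: ifP => _; exact: circle_measure_setC.
Qed.

Hypothesis W_increasing : forall k x y, x < y -> W k x < W k y.
Hypothesis W_periodic : forall k x, W k (x + 1) - W k x = W k 1 - W k 0.
Hypothesis A_basis : forall k, orthonormal_eigenbasis (W k) (A k).

(** [dxW] charges the unit cube only, so coefficients that agree there define the same energy; their
    other values are artefacts of representing the torus inside R^d. *)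
Lemma weak_solution_eq_cube (a b : 'I_d -> X -> R) (f u : X -> R) :
  (forall i, measurable_fun setT (a i)) -> (forall i, measurable_fun setT (b i)) ->
  (forall i x, (forall k, 0 <= tnth x k < 1) -> a i x = b i x) ->
  weak_solution W A a f u -> weak_solution W A b f u.
Proof.
move=> ma mb ab [Hu eu]; split => // v Hv; rewrite -(eu v Hv).
apply: eq_bigr => i _; congr fine.
have [/(_ i)/Lfun2_measurable mu' _] := H1W_density W_increasing W_periodic A_basis Hu.
have [/(_ i)/Lfun2_measurable mv' _] := H1W_density W_increasing W_periodic A_basis Hv.
apply: ae_eq_integral => //.
- by apply/measurable_EFinP; do 2 apply: measurable_funM => //.
- by apply/measurable_EFinP; do 2 apply: measurable_funM => //.
- apply: (filterS (P := fun x : X => forall k, 0 <= tnth x k < 1) _ (dxW_cube i)) => x cx _.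
  by rewrite ab.
Qed.

End almost_everywhere_coefficients.

Theorem corollary3p3 (R : realType) (d : nat) (d_gt0 : (0 < d)%N)
    (W : 'I_d -> cumulative R R)
    (W_increasing : forall k x y, x < y -> W k x < W k y)
    (W_periodic : forall k x, W k (x + 1) - W k x = W k 1 - W k 0)
    (A : 'I_d -> set (R -> R))
    (A_basis : forall k, orthonormal_eigenbasis (W k) (A k))
    (a : 'I_d -> d.-tuple (measurableTypeR R) -> R)
    (a_measurable : forall i, measurable_fun setT (a i))
    (theta : R) (theta_gt0 : 0 < theta)
    (a_bounds : forall i x, (forall k, 0 <= tnth x k < 1) ->
       theta^-1 <= a i x <= theta) :
  (forall f, f \in Lfun (@dx R d) 2%:E ->
     ((exists u, weak_solution W A a f u) <-> \int[dx]_x f x = 0)) /\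
  (forall f, f \in Lfun (@dx R d) 2%:E -> \int[dx]_x f x = 0 ->
     forall u v, weak_solution W A a f u -> weak_solution W A a f v ->
       exists c : R, u = v \+ cst c %[ae (@dx R d)]) /\
  (exists C : R, forall f, f \in Lfun (@dx R d) 2%:E -> \int[dx]_x f x = 0 ->
     [/\ exists u, H1W_perp W A u /\ weak_solution W A a f u,
         forall u v, H1W_perp W A u -> weak_solution W A a f u ->
           H1W_perp W A v -> weak_solution W A a f v ->
           u = v %[ae (@dx R d)]
       & forall u, H1W_perp W A u -> weak_solution W A a f u ->
           norm_1W W A u <= C * norm_L2 f]).
Proof.
(* [a] clamped to [[theta^-1, theta]]: unchanged on the cube, and bounded on the whole space as the
   preceding results require. *)
pose b i x := Num.max theta^-1 (Num.min theta (a i x)).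
have b_measurable i : measurable_fun setT (b i).
  by apply: measurable_maxr => //; apply: measurable_minr.
have ab i x : (forall k, 0 <= tnth x k < 1) -> a i x = b i x.
  by move=> /(a_bounds i)/andP[l r]; rewrite /b (min_idPr r) (max_idPr l).
(* Clamping needs a nonempty interval; this is read off the bounds of one coefficient at the origin,
   [d_gt0] supplying the coefficient. *)
have theta_inv : theta^-1 <= theta.
  have /(a_bounds (Ordinal d_gt0))/andP[l r] : forall k, 0 <= tnth [tuple of nseq d (0 : R)] k < 1.
    by move=> k; rewrite tnth_nseq lexx ltr01.
  exact: le_trans l r.
have b_bounds i x : theta^-1 <= b i x <= theta.
  by rewrite /b le_max lexx/= ge_max theta_inv ge_min lexx.
have toB f u : weak_solution W A a f u -> weak_solution W A b f u.
  exact: weak_solution_eq_cube.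
have ofB f u : weak_solution W A b f u -> weak_solution W A a f u.
  by apply: weak_solution_eq_cube => // i x cx; rewrite ab.
have uniq f u v : weak_solution W A a f u -> weak_solution W A a f v ->
    u = v \+ cst (\int[dx]_x u x - \int[dx]_x v x) %[ae (@dx R d)].
  move=> /toB su /toB sv.
  exact: (weak_solution_unique W_increasing W_periodic A_basis b_measurable theta_gt0 b_bounds su sv).
have exist f : f \in Lfun (@dx R d) 2%:E -> \int[dx]_x f x = 0 ->
    exists u, H1W_perp W A u /\ weak_solution W A a f u.
  move=> Lf f0.
  have [u [pu su]] := weak_solution_exists W_increasing W_periodic A_basis b_measurable theta_gt0 b_bounds Lf f0.
  by exists u; split => //; exact: ofB.
split; [|split].
- move=> f Lf; split=> [[u /toB su]|/(exist f Lf)[u [_ su]]]; last by exists u.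
  exact: (weak_solution_mean W_increasing W_periodic A_basis b_measurable theta_gt0 b_bounds su).
- by move=> f _ _ u v su sv; eexists; exact: uniq su sv.
- exists (Num.sqrt ((mass_sum W + 1) * (theta ^+ 2 * mass_sum W))) => f Lf f0.
  split; first exact: exist.
    move=> u v [_ u0] su [_ v0] sv; have := uniq _ _ _ su sv; rewrite u0 v0 subrr.
    by apply: filterS => x /= h /h ->; rewrite addr0.
  move=> u pu /toB su.
  exact: (weak_solution_bound W_increasing W_periodic A_basis b_measurable theta_gt0 b_bounds Lf pu su).
Qed.
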